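(* Let $H,T\in\mathbb C^{2n\times2n}$ be Hamiltonian, let $\lambda\in\mathbb C$ be nonimaginary (nonzero real part), and suppose there is an invertible $\Phi=[\,\Xi\;\;\Xi_c\;\;\Phi_C\,]$ with $$H\Phi=\Phi\,\mathrm{diag}\big(\lambda I_p+N,\ -(\lambda I_p+N)^*,\ H_C\big),\qquad \Phi^*J_n\Phi=\mathrm{diag}(J_p,J_{n-p}),\qquad \lambda,-\bar\lambda\notin\Lambda(H_C),$$ with $N,p,s_1,\dots,s_m$ as in the context. With $\Xi_{ji},\Xi_{ji}^{(c)},\Upsilon_k,\Upsilon_k^{(c)}$ as in the context, put $\Psi_k=(\Upsilon_k^{(c)})^*(J_nT)\Upsilon_k$, $k=1,\dots,m$. Fix $\rho\in\{1,\dots,m\}$ and, if $\rho<m$, assume $\Psi_{\rho+1}$ is invertible and set $$\widehat G_\rho=-\Psi_{\rho+1}^{-1}(\Upsilon_{\rho+1}^{(c)})^*J_nT\,\Xi_{\rho1},\qquad \widehat G_\rho^{(c)}=-\Psi_{\rho+1}^{-*}\Upsilon_{\rho+1}^*J_nT\,\Xi_{\rho\rho}^{(c)}.$$ Let $$\widehat S_\rho=\begin{cases}(\Xi_{\rho\rho}^{(c)})^*J_nT(\Xi_{\rho1}+\Upsilon_{\rho+1}\widehat G_\rho)&\rho<m\\(\Xi_{mm}^{(c)})^*J_nT\,\Xi_{m1}&\rho=m,\end{cases}$$ and let $\gamma_1^{(\rho)},\dots,\gamma_{s_\rho}^{(\rho)}$ be the eigenvalues of $-\widehat S_\rho$. (a)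 For each $i\in\{1,\dots,s_\rho\}$ let $\mu_{i1}^{(\rho)},\dots,\mu_{i\rho}^{(\rho)}$ be the $\rho$th roots of $\gamma_i^{(\rho)}$. Then for $t>0$ sufficiently small $H+tT$ has $\rho s_\rho$ pairs of eigenvalues $\lambda_{ij}^{(\rho)}(t),-\overline{\lambda_{ij}^{(\rho)}(t)}$ with $$\lambda_{ij}^{(\rho)}(t)=\lambda+t^{1/\rho}\mu_{ij}^{(\rho)}+o(t^{1/\rho}),\qquad i=1,\dots,s_\rho,\ j=1,\dots,\rho.$$ (b) Suppose all of $\Psi_1,\dots,\Psi_m$ are invertible. Then for $t>0$ sufficiently small there are matrices $$\widetilde\Xi_\rho(t)=\Upsilon_\rho\begin{bmatrix}I_{s_\rho}&0\\\widehat G_\rho&0\end{bmatrix}+\sum_{k=1}^m\Xi_k\widetilde X_{k\rho}(t)+O(t),\qquad \widetilde\Xi_\rho^{(c)}(t)=\Upsilon_\rho^{(c)}\begin{bmatrix}0&I_{s_\rho}\\0&\widehat G_\rho^{(c)}\end{bmatrix}+\sum_{k=1}^m\Xi_k^{(c)}\widetilde X_{k\rho}^{(c)}(t)+O(t)$$ (each with $\rho s_\rho$ columns), where $\widetilde X_{k\rho}(t)=O(\delta_k(t))$ and $\widetilde X_{k\rho}^{(c)}(t)=O(\delta_k^{c}(t))$ for $k\ne\rho$, and $$\widetilde X_{\rho\rho}(t)=\mathrm{diag}(0_{s_\rho},t^{1/\rho}I_{s_\rho},\dots,t^{1-1/\rho}I_{s_\rho}),\qquad \widetilde X_{\rho\rho}^{(c)}(t)=\mathrm{diag}(t^{1-1/\rho}I_{s_\rho},\dots,t^{1/\rho}I_{s_\rho},0_{s_\rho})+O(\delta_\rho^{c}(t)),$$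 such that $\widetilde\Phi_\rho(t)=[\,\widetilde\Xi_\rho(t)\;\;\widetilde\Xi_\rho^{(c)}(t)\,]$ satisfies $$(H+tT)\widetilde\Phi_\rho(t)=\widetilde\Phi_\rho(t)\begin{bmatrix}\lambda I_{\rho s_\rho}+t^{1/\rho}\widetilde\Theta_\rho^{(h)}(t)&0\\0&-(\lambda I_{\rho s_\rho}+t^{1/\rho}\widetilde\Theta_\rho^{(h)}(t))^*\end{bmatrix},\qquad \widetilde\Phi_\rho^*(t)J_n\widetilde\Phi_\rho(t)=t^{1-1/\rho}J_{\rho s_\rho},$$ where $\widetilde\Theta_\rho^{(h)}(t)=\Theta_\rho(-\widehat S_\rho)+O(t^{1/\rho})$.
   Context: $J_k=\begin{bmatrix}0&I_k\\-I_k&0\end{bmatrix}$. $H\in\mathbb C^{2n\times2n}$ is Hamiltonian if $J_nH=(J_nH)^*$. $\Lambda(\cdot)$ is the spectrum; $^*$ is conjugate transpose; $A^{-*}=(A^{-1})^*$. Jordan structure: integers $m\ge1$, $s_1,\dots,s_{m-1}\ge0$, $s_m>0$, $p=\sum_{j=1}^m js_j$, $N=\mathrm{diag}(N_1,\dots,N_m)$, where $N_j$ is the $j\times j$ block matrix with blocks of size $s_j\times s_j$, having $I_{s_j}$ on the first block superdiagonal and zeros elsewhere ($N_1=0_{s_1}$). Partitions: $\Xi=[\Xi_1\ \dots\ \Xi_m]$, $\Xi_c=[\Xi_1^{(c)}\ \dots\ \Xi_m^{(c)}]$ with $\Xi_j,\Xi_j^{(c)}$ having $js_j$ columns, and $\Xi_j=[\Xi_{j1}\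 \dots\ \Xi_{jj}]$, $\Xi_j^{(c)}=[\Xi_{j1}^{(c)}\ \dots\ \Xi_{jj}^{(c)}]$ with each block having $s_j$ columns. For $k=1,\dots,m$: $\Upsilon_k=[\Xi_{k1}\ \Xi_{k+1,1}\ \dots\ \Xi_{m1}]$, $\Upsilon_k^{(c)}=[\Xi_{kk}^{(c)}\ \Xi_{k+1,k+1}^{(c)}\ \dots\ \Xi_{mm}^{(c)}]$. If $\rho=m$, the blocks $\widehat G_\rho,\widehat G_\rho^{(c)}$ are absent (empty). $\Theta_\rho(S)$ is the $\rho\times\rho$ block matrix with $s_\rho\times s_\rho$ blocks, with $I_{s_\rho}$ on the first block superdiagonal, $S$ in the bottom-left block, zeros elsewhere ($\Theta_1(S)=S$). Order notation: $t>0$ is real and sufficiently small; $O(t^d)$ is a matrix with norm at most a constant (independent of $t$) times $t^d$ for all sufficiently small $t>0$; $o(t^d)$ is a term that divided by $t^d$ tends to $0$ as $t\to0^+$. For a matrix with $k$ block rows, $O([t^{d_1}\ \dots\ t^{d_k}]^T)$ means the $i$th block row is $O(t^{d_i})$. For fixed $\rho$, $\delta_k(t)$ is the following vector of length $k$ (applied to matrices with $k$ block rows of height $s_k$): for $k<\rho$, $[t^{1-k/\rho}\ t^{1-(k-1)/\rho}\ \dots\ t^{1-1/\rho}]^T$; for $k=\rho$, $[t^{1/\rho}\ t^{2/\rho}\ \dots\ t]^T$; for $k>\rho$, $[t^{1/\rho}\ t^{1/\rho}\ t^{2/\rho}\ \dots\ t\ \dots\ t]^T$, i.e. first entry $t^{1/\rho}$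 and $i$th entry $t^{\min(i-1,\rho)/\rho}$ for $i\ge2$. $\delta_k^{c}(t)$ is $\delta_k(t)$ with entries in reverse order. *)

(* Defs.v *)
(* MathComp + MathComp-Analysis; C is R[i] for a realType R. *)
From HB Require Import structures.
From mathcomp Require Import all_boot all_order all_algebra.
From mathcomp Require Import all_classical all_reals all_analysis.
From mathcomp Require Import complex.

Set Implicit Arguments.
Unset Strict Implicit.
Unset Printing Implicit Defensive.

Import Order.TTheory GRing.Theory Num.Theory.
Import numFieldNormedType.Exports.

Local Open Scope classical_set_scope.
Local Open Scope ring_scope.
Local Open Scope complex_scope.
Local Open Scope sesquilinear_scope.

(* Indexing: s : nat -> nat is used 1-based (s j is s_j), whereas block
   positions are 0-based ordinals, i.e. j : 'I_m stands for j.+1 in the usual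
   1-based notation.  Blocks of zero rows or columns (s j = 0) are allowed. *)

Definition Jmx {R : realType} (k : nat) : 'M[R[i]]_(k + k) :=
  block_mx 0 1%:M (- 1%:M) 0.

Definition hamiltonian {R : realType} (n : nat) (H : 'M[R[i]]_(n + n)) :=
  Jmx n *m H = (Jmx n *m H) ^t*.

Definition bdiag_mx {R : realType} (a b : nat) (A : 'M[R[i]]_a)
  (B : 'M[R[i]]_b) : 'M[R[i]]_(a + b) := block_mx A 0 0 B.

(* b copies of the width h; as a number, b * h (see pdimE). *)
Definition bdim (b h : nat) : nat := \sum_(a < b) h.

Definition pdim (m : nat) (s : nat -> nat) : nat :=
  \sum_(j < m) bdim j.+1 (s j.+1).

Lemma pdimE m s : pdim m s = (\sum_(j < m) j.+1 * s j.+1)%N.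
Proof. by apply: eq_bigr => j _; rewrite /bdim sum_nat_const card_ord. Qed.

Lemma Phi_dimE (p n : nat) :
  (p <= n)%N -> ((p + p) + ((n - p) + (n - p)) = n + n)%N.
Proof. by move=> le_pn; rewrite addnACA subnKC. Qed.

Definition Nblock {R : realType} (b h : nat) : 'M[R[i]]_(bdim b h) :=
  \mxblock_(x < b, y < b) (if y == x.+1 :> nat then 1%:M else 0 : 'M[R[i]]_h).

Definition Nmx {R : realType} (m : nat) (s : nat -> nat) :
    'M[R[i]]_(pdim m s) :=
  \mxdiag_(j < m) Nblock j.+1 (s j.+1).

Definition Thetamx {R : realType} (r h : nat) (S : 'M[R[i]]_h) :
    'M[R[i]]_(bdim r h) :=
  \mxblock_(x < r, y < r)
    (if y == x.+1 :> nat then 1%:M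
     else if (x.+1 == r :> nat) && (y == 0 :> nat) then S else 0 : 'M[R[i]]_h).

Definition shift_ord (m k : nat) (i : 'I_(m - k)) : 'I_m :=
  Ordinal (etrans (esym (ltn_subRL k i m)) (ltn_ord i)).

Section Blocks.
Context {R : realType} {n m : nat} {s : nat -> nat}.
Implicit Type Xi : 'M[R[i]]_(n + n, pdim m s).

Definition Xi_ Xi (j : 'I_m) : 'M[R[i]]_(n + n, bdim j.+1 (s j.+1)) :=
  submxrow (q_ := fun j : 'I_m => bdim j.+1 (s j.+1)) Xi j.

Definition Xi2_ Xi (j : 'I_m) (a : 'I_j.+1) : 'M[R[i]]_(n + n, s j.+1) :=
  submxrow (q_ := fun _ : 'I_j.+1 => s j.+1) (Xi_ Xi j) a.

Arguments Xi2_ : clear implicits.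

Definition udim (k : nat) : nat := \sum_(i < m - k) s (k + i).+1.

(* These are Upsilon_{k+1} and Upsilon^{(c)}_{k+1}; for k = m they have no
   columns. *)
Definition Ups Xi (k : nat) : 'M[R[i]]_(n + n, udim k) :=
  \mxrow_(i < m - k) Xi2_ Xi (shift_ord i) ord0.

Definition Upsc Xic (k : nat) : 'M[R[i]]_(n + n, udim k) :=
  \mxrow_(i < m - k) Xi2_ Xic (shift_ord i) ord_max.

Definition Psi (T : 'M[R[i]]_(n + n)) Xi Xic (k : nat) : 'M[R[i]]_(udim k) :=
  (Upsc Xic k) ^t* *m (Jmx n *m T) *m Ups Xi k.

(* For rho.+1 = m the next two matrices have no rows. *)
Definition Ghat (T : 'M[R[i]]_(n + n)) Xi Xic (rho : 'I_m) :
    'M[R[i]]_(udim rho.+1, s rho.+1) :=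
  - (invmx (Psi T Xi Xic rho.+1) *m (Upsc Xic rho.+1) ^t* *m
     (Jmx n *m T) *m Xi2_ Xi rho ord0).

Definition Ghatc (T : 'M[R[i]]_(n + n)) Xi Xic (rho : 'I_m) :
    'M[R[i]]_(udim rho.+1, s rho.+1) :=
  - ((invmx (Psi T Xi Xic rho.+1)) ^t* *m (Ups Xi rho.+1) ^t* *m
     (Jmx n *m T) *m Xi2_ Xic rho ord_max).

Definition Shat (T : 'M[R[i]]_(n + n)) Xi Xic (rho : 'I_m) :
    'M[R[i]]_(s rho.+1) :=
  if (rho.+1 < m)%N then
    (Xi2_ Xic rho ord_max) ^t* *m (Jmx n *m T) *m
      (Xi2_ Xi rho ord0 + Ups Xi rho.+1 *m Ghat T Xi Xic rho)
  else (Xi2_ Xic rho ord_max) ^t* *m (Jmx n *m T) *m Xi2_ Xi rho ord0.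

Lemma udim_recl (rho : 'I_m) : (s rho.+1 + udim rho.+1)%N = udim rho.
Proof.
rewrite /udim -(subnSK (ltn_ord rho)) big_ord_recl /= addn0.
by congr addn; apply: eq_bigr => i _; rewrite addnS.
Qed.

(* [I 0; G 0] and [0 I; 0 G], with rho.+1 block columns of width s rho.+1;
   castmx only regroups the rows to match the columns of Ups Xi rho. *)
Definition IG_first (rho : 'I_m) (G : 'M[R[i]]_(udim rho.+1, s rho.+1)) :
    'M[R[i]]_(udim rho, bdim rho.+1 (s rho.+1)) :=
  castmx (udim_recl rho, erefl)
    (\mxrow_(a < rho.+1) (if a == ord0 then col_mx 1%:M G else 0)).

Definition IG_last (rho : 'I_m) (G : 'M[R[i]]_(udim rho.+1, s rho.+1)) :
    'M[R[i]]_(udim rho, bdim rho.+1 (s rho.+1)) :=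
  castmx (udim_recl rho, erefl)
    (\mxrow_(a < rho.+1) (if a == ord_max then col_mx 1%:M G else 0)).

End Blocks.

Arguments Xi2_ {R n m s} Xi j a.

Section Orders.
Context {R : realType}.

Definition tpow (t d : R) : R[i] := (t `^ d)%:C.

(* A(t) = O(t^d) as t -> 0+, in the entrywise maximum norm. *)
Definition is_bigO (d : R) (a b : nat) (A : R -> 'M[R[i]]_(a, b)) :=
  exists c : R, \forall t \near 0^'+, forall x y, `|A t x y| <= (c * t `^ d)%:C.

(* A(t) = O([t^(d 0) ... t^(d (k-1))]^T), for k block rows of height h. *)
Definition is_bigO_rows (k h b : nat) (d : 'I_k -> R)
    (A : R -> 'M[R[i]]_(bdim k h, b)) :=
  forall x : 'I_k,
    is_bigO (d x) (fun t => submxcol (p_ := fun _ : 'I_k => h) (A t) x).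

(* f(t) = o(t^d) as t -> 0+. *)
Definition is_littleo (d : R) (f : R -> R[i]) :=
  (fun t : R => ComplexField.Normc.normc (f t) / t `^ d) @ 0^'+ --> (0 : R).

(* Exponents of t in delta_k(t), for rho = r; x is the 0-based position. *)
Definition delta_exp (r k : nat) (x : 'I_k) : R :=
  if (k < r)%N then 1 - (k - x)%:R / r%:R
  else if k == r then x.+1%:R / r%:R
  else if x == 0 :> nat then r%:R^-1
  else (minn x r)%:R / r%:R.

Definition deltac_exp (r k : nat) (x : 'I_k) : R := delta_exp r (rev_ord x).

Definition Xtilde_diag (r h : nat) (t : R) : 'M[R[i]]_(bdim r h) :=
  \mxdiag_(x < r)
    (if x == 0 :> nat then 0 else (tpow t (x%:R / r%:R))%:M : 'M[R[i]]_h).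

Definition Xtildec_diag (r h : nat) (t : R) : 'M[R[i]]_(bdim r h) :=
  \mxdiag_(x < r)
    (if x.+1 == r :> nat then 0
     else (tpow t ((r - x.+1)%:R / r%:R))%:M : 'M[R[i]]_h).

End Orders.

(* Main.v *)
(* Put z = t^(1/rho).  In the basis Phi the eigenvalue problem for H + tT near
   lambda is diag(N, B) + z^rho M = z mu with B invertible.  Scaling the
   coordinates of each position of each Jordan chain by a suitable power of z
   turns it into a pencil A(z) - mu K(z) that is polynomial in z and whose limit
   at z = 0 has an explicit deflating subspace Y0: its leading vectors are
   supported on the chain tops of length >= rho and annihilate the rows of M at
   the chain ends of length > rho, which produces hat G_rho, and the Schur
   complement that is left at the ends of the chains of length rho is -hat S_rho.
   A normalisation Q Y = 1 makes the linearised problem at z = 0 injective, so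
   that a contraction argument continues Y0 with an error O(z).

   For (a), normalising on all chains of length <= rho uses Psi_(rho+1) alone;
   the characteristic polynomial of the limit is divisible by that of
   Theta_rho(-hat S_rho), whose roots are the mu_ij, and the roots of a
   polynomial depend continuously on its coefficients.  The eigenvalues near
   -conj(lambda) come from the Hamiltonian symmetry of the spectrum.

   For (b), normalising on the chains of length rho gives a subspace with
   spectrum near lambda.  The same construction for (-H, -T, conj(lambda)) and
   the reversed chains of Xi^(c) gives the other one.  Both are isotropic because
   a Sylvester equation with separated spectra has only the zero solution, and
   the Gram matrix between them is z^(rho-1) (1 + O(z)) up to reversal of the
   blocks, so that it can be normalised on one side. *)

Require Import Defs.
From HB Require Import structures.
From mathcomp Require Import all_boot all_order all_algebra.
From mathcomp Require Import all_classical all_reals all_analysis.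
From mathcomp Require Import complex.
From mathcomp Require Import ring lra zify.

Set Implicit Arguments.
Unset Strict Implicit.
Unset Printing Implicit Defensive.

Import Order.TTheory GRing.Theory Num.Theory.
Import numFieldNormedType.Exports.
Import ComplexField.Normc.

Local Open Scope classical_set_scope.
Local Open Scope ring_scope.
Local Open Scope complex_scope.
Local Open Scope sesquilinear_scope.

(** * The entrywise 1-norm and contractions of matrices *)

(** At [z = 0] the matrix [K] vanishes on the complement of the chains, so the limit is a pencil and
    not an eigenvalue problem. The condition [Q K = Q] makes up for this: together with [Q Y = 1] it
    forces [Th = Q A Y], which leaves a quadratic equation for [Y] alone.

    Two normalisations are needed because of the chains that are too short. In the linearised limit
    their rows satisfy [y_(a+1) = y_a Th] and vanish past the end of the chain. This forces them to
    be zero only if [Th] can be cancelled. In (b) the pivots for length at least [rho] and for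
    length greater than [rho] are both invertible, so their Schur complement is, and with it [Th].
    In (a) the Schur complement may be singular, and the short chains have to be fixed by [Q]
    itself.

    In the code [rho] is 0-based: the distinguished chain length is [r = rho.+1], [z] is the [r]-th
    root of [t], and the Gram matrix has order [z ^ rho]. *)

Section MatrixNorm.
Context {R : realType}.
Local Notation C := R[i].

Lemma normc_ge0 (x : C) : 0 <= normc x.
Proof. by case: x => a b; apply: sqrtr_ge0. Qed.

Lemma normcD (x y : C) : normc (x + y) <= normc x + normc y.
Proof. exact: le_normcD. Qed.

Lemma normc_sum (I : Type) (s : seq I) (F : I -> C) :
  normc (\sum_(i <- s) F i) <= \sum_(i <- s) normc (F i).
Proof.
elim: s => [|i s IHs]; first by rewrite !big_nil normc0.
by rewrite !big_cons (le_trans (normcD _ _)) // lerD2l.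
Qed.

Definition mnorm a b (A : 'M[C]_(a, b)) : R := \sum_i \sum_j normc (A i j).

Lemma mnorm_ge0 a b (A : 'M[C]_(a, b)) : 0 <= mnorm A.
Proof. by do 2![apply: sumr_ge0 => ? _]; apply: normc_ge0. Qed.

Lemma normc_le_mnorm a b (A : 'M[C]_(a, b)) i j : normc (A i j) <= mnorm A.
Proof.
rewrite /mnorm (bigD1 i) //= (bigD1 j) //= -addrA lerDl addr_ge0 //.
  by apply: sumr_ge0 => ? _; apply: normc_ge0.
by do 2![apply: sumr_ge0 => ? _]; apply: normc_ge0.
Qed.

Lemma mnorm_le a b (A : 'M[C]_(a, b)) (c : R) :
  (forall i j, normc (A i j) <= c) -> mnorm A <= (a * b)%:R * c.
Proof.
move=> Ac; apply: (@le_trans _ _ (\sum_(i < a) \sum_(j < b) c)).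
  by do 2![apply: ler_sum => ? _]; apply: Ac.
by rewrite !(sumr_const, card_ord) -mulrnA mulr_natl mulnC.
Qed.

Lemma mnorm0 a b : mnorm (0 : 'M[C]_(a, b)) = 0.
Proof. by rewrite /mnorm big1 // => i _; rewrite big1 // => j _; rewrite mxE normc0. Qed.

Lemma mnorm_eq0 a b (A : 'M[C]_(a, b)) : mnorm A = 0 -> A = 0.
Proof.
move=> A0; apply/matrixP => i j; rewrite mxE; apply: eq0_normc; apply/eqP.
by rewrite eq_le normc_ge0 andbT -A0 normc_le_mnorm.
Qed.

Lemma mnormD a b (A B : 'M[C]_(a, b)) : mnorm (A + B) <= mnorm A + mnorm B.
Proof.
rewrite /mnorm -big_split; apply: ler_sum => i _; rewrite -big_split /=.
by apply: ler_sum => j _; rewrite mxE normcD.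
Qed.

Lemma mnormN a b (A : 'M[C]_(a, b)) : mnorm (- A) = mnorm A.
Proof. by rewrite /mnorm; do 2![apply: eq_bigr => ? _]; rewrite mxE normcN. Qed.

Lemma mnormB a b (A B : 'M[C]_(a, b)) : mnorm (A - B) <= mnorm A + mnorm B.
Proof. by rewrite -(mnormN B) mnormD. Qed.

Lemma mnormZ a b c (A : 'M[C]_(a, b)) : mnorm (c *: A) = normc c * mnorm A.
Proof.
rewrite /mnorm mulr_sumr; apply: eq_bigr => i _.
by rewrite mulr_sumr; apply: eq_bigr => j _; rewrite mxE normcM.
Qed.

Lemma mnorm_sum a b (I : Type) (s : seq I) (F : I -> 'M[C]_(a, b)) :
  mnorm (\sum_(i <- s) F i) <= \sum_(i <- s) mnorm (F i).
Proof.
elim: s => [|i s IHs]; first by rewrite !big_nil mnorm0.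
by rewrite !big_cons (le_trans (mnormD _ _)) // lerD2l.
Qed.

Lemma mnormM a b d (A : 'M[C]_(a, b)) (B : 'M[C]_(b, d)) :
  mnorm (A *m B) <= mnorm A * mnorm B.
Proof.
rewrite mulr_suml; apply: ler_sum => i _; rewrite mulr_suml.
apply: (@le_trans _ _ (\sum_(k < d) \sum_(j < b) normc (A i j) * normc (B j k))).
  apply: ler_sum => k _; rewrite mxE (le_trans (normc_sum _ _)) //.
  by apply: ler_sum => j _; rewrite normcM.
rewrite exchange_big; apply: ler_sum => j _ /=; rewrite -mulr_sumr.
apply: ler_wpM2l; first exact: normc_ge0.
rewrite /mnorm (bigD1 j) //= lerDl.
by do 2![apply: sumr_ge0 => ? _]; apply: normc_ge0.
Qed.

Lemma linear_bounded a b a' b' (f : {linear 'M[C]_(a, b) -> 'M[C]_(a', b')}) :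
  exists2 c : R, 0 <= c & forall A, mnorm (f A) <= c * mnorm A.
Proof.
exists (\sum_i \sum_j mnorm (f (delta_mx i j))).
  by do 2![apply: sumr_ge0 => ? _]; apply: mnorm_ge0.
move=> A; rewrite {1}[A]matrix_sum_delta linear_sum.
rewrite (le_trans (mnorm_sum _ _)) // mulr_suml; apply: ler_sum => i _.
rewrite linear_sum (le_trans (mnorm_sum _ _)) // mulr_suml.
apply: ler_sum => j _; rewrite linearZ mnormZ mulrC ler_wpM2l ?mnorm_ge0 //.
exact: normc_le_mnorm.
Qed.

Lemma linear_inj_inverse a b (f : {linear 'M[C]_(a, b) -> 'M[C]_(a, b)}) :
  (forall A, f A = 0 -> A = 0) ->
  exists g : {linear 'M[C]_(a, b) -> 'M[C]_(a, b)}, forall A, f (g A) = A.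
Proof.
move=> finj; have fu : lin_mx f \in unitmx.
  rewrite -row_free_unit -kermx_eq0; apply/eqP/row_matrixP => i.
  rewrite row0; set v := row i _.
  have : v *m lin_mx f = 0 by apply/sub_kermxP; rewrite row_sub.
  rewrite -[v]vec_mxK mul_vec_lin => /(congr1 vec_mx); rewrite mxvecK linear0.
  by move=> /finj ->; rewrite linear0.
exists (vec_mx \o mulmxr (invmx (lin_mx f)) \o mxvec) => A /=.
by apply: (can_inj mxvecK); rewrite -mul_vec_lin vec_mxK mulmxKV.
Qed.


(** The intervals of radius [2 * c / 2 ^+ k] around [u k] are nested, so the supremum of their left
    ends lies in all of them. The explicit rate is what [contraction_fixpoint] uses to pass to the
    limit. *)
Lemma geometric_limit_real (u : nat -> R) (c : R) :
  (forall k, `|u k.+1 - u k| <= c / 2 ^+ k) ->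
  exists l, forall k, `|u k - l| <= 2 * c / 2 ^+ k.
Proof.
move=> uc; pose e k := 2 * c / 2 ^+ k.
have eS k : e k = e k.+1 + c / 2 ^+ k.
  rewrite /e exprS; field; rewrite expf_neq0 //.
have c0 : 0 <= c by have := le_trans (normr_ge0 _) (uc 0); rewrite expr0 divr1.
have e0 k : 0 <= e k by rewrite /e divr_ge0 ?mulr_ge0 ?exprn_ge0.
have vS k : u k - e k <= u k.+1 - e k.+1.
  have := uc k; rewrite ler_norml eS => /andP[? ?]; lra.
have wS k : u k.+1 + e k.+1 <= u k + e k.
  have := uc k; rewrite ler_norml [e k]eS => /andP[? ?]; lra.
have vmono i k : u i - e i <= u (i + k)%N - e (i + k)%N.
  elim: k => [|k IHk]; first by rewrite addn0.
  by rewrite addnS (le_trans IHk).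
have wmono i k : u (i + k)%N + e (i + k)%N <= u i + e i.
  elim: k => [|k IHk]; first by rewrite addn0.
  by rewrite addnS (le_trans _ IHk).
have vw i k : u i - e i <= u k + e k.
  apply: le_trans (vmono i k) _; rewrite addnC; apply: le_trans (wmono k i).
  by rewrite lerD2l (le_trans _ (e0 _)) // oppr_le0.
pose S := range (fun k => u k - e k).
have S0 : S !=set0 by exists (u 0 - e 0), 0%N.
have Sub k : ubound S (u k + e k) by move=> _ [i _ <-]; apply: vw.
exists (sup S) => k; rewrite ler_norml -/(e k).
have le1 : u k - e k <= sup S.
  by apply: ub_le_sup; [exists (u 0%N + e 0%N); apply: Sub | exists k].
have le2 : sup S <= u k + e k by apply: ge_sup.
by apply/andP; split; lra.
Qed.

Lemma normc_le_ReIm (x : C) : normc x <= `|complex.Re x| + `|complex.Im x|.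
Proof.
case: x => a b /=; rewrite -[leRHS]ger0_norm ?addr_ge0 // -sqrtr_sqr.
rewrite ler_wsqrtr // sqrrD !real_normK ?num_real //.
by rewrite -addrA lerD2l lerDr mulrn_wge0 // mulr_ge0.
Qed.

Lemma Re_le_normc (x : C) : `|complex.Re x| <= normc x.
Proof.
case: x => a b /=; rewrite -sqrtr_sqr ler_wsqrtr // lerDl; exact: sqr_ge0.
Qed.

Lemma Im_le_normc (x : C) : `|complex.Im x| <= normc x.
Proof.
case: x => a b /=; rewrite -sqrtr_sqr ler_wsqrtr // lerDr; exact: sqr_ge0.
Qed.

Lemma geometric_limit a b (u : nat -> 'M[C]_(a, b)) (c : R) :
  (forall k, mnorm (u k.+1 - u k) <= c / 2 ^+ k) ->
  exists2 K, 0 <= K &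
    exists l, forall k, mnorm (u k - l) <= K / 2 ^+ k.
Proof.
move=> uc.
have c0 : 0 <= c.
  by have := le_trans (mnorm_ge0 _) (uc 0); rewrite expr0 divr1.
have lim i j : {l : C | forall k, normc (u k i j - l) <= 4 * c / 2 ^+ k}.
  apply: cid.
  have [|x xP] := @geometric_limit_real (fun k => complex.Re (u k i j)) c.
    move=> k; apply: le_trans (uc k); apply: le_trans (normc_le_mnorm _ i j).
    by rewrite !mxE -!raddfB; apply: Re_le_normc.
  have [|y yP] := @geometric_limit_real (fun k => complex.Im (u k i j)) c.
    move=> k; apply: le_trans (uc k); apply: le_trans (normc_le_mnorm _ i j).
    by rewrite !mxE -!raddfB; apply: Im_le_normc.
  exists (x +i* y) => k; apply: le_trans (normc_le_ReIm _) _.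
  have -> : 4 * c / 2 ^+ k = 2 * c / 2 ^+ k + 2 * c / 2 ^+ k by lra.
  by move: (xP k) (yP k); case: (u k i j) => p q /= *; apply: lerD.
exists ((a * b)%:R * (4 * c)); first by rewrite !mulr_ge0.
exists (\matrix_(i, j) projT1 (lim i j)) => k; rewrite -mulrA.
by apply: mnorm_le => i j; rewrite !mxE; case: (lim i j) => l /=.
Qed.

(** A value of norm at most [r / 2] at [0] and the factor 1/2 keep the ball of radius [r] invariant;
    the iterates from [0] then move by at most [(r / 2) / 2 ^+ k]. *)
Lemma contraction_fixpoint a b (G : 'M[C]_(a, b) -> 'M[C]_(a, b)) (r : R) :
  0 <= r -> mnorm (G 0) <= r / 2 ->
  (forall x y, mnorm x <= r -> mnorm y <= r ->
     mnorm (G x - G y) <= mnorm (x - y) / 2) ->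
  exists2 x, mnorm x <= r & G x = x.
Proof.
move=> r0 G0 Gc; pose u k := iter k G 0.
have Gr x : mnorm x <= r -> mnorm (G x) <= r.
  move=> xr; have := Gc x 0 xr; rewrite mnorm0 subr0 => /(_ r0) ?.
  have := mnormD (G x - G 0) (G 0); rewrite subrK; lra.
have ur k : mnorm (u k) <= r by elim: k => [|k IHk]; [rewrite mnorm0|apply: Gr].
have uS k : mnorm (u k.+1 - u k) <= (r / 2) / 2 ^+ k.
  elim: k => [|k IHk]; first by rewrite /u /= subr0 expr0 divr1.
  apply: (@le_trans _ _ (mnorm (u k.+1 - u k) / 2)).
    exact: (Gc _ _ (ur k.+1) (ur k)).
  by rewrite exprSr invfM mulrA ler_pM2r.
have [K K0 [x xP]] := geometric_limit uS.
(* Archimedean property: a bound by [e / 2 ^+ k] for all [k] forces [y <= 0]. It stands in for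
   limits of inequalities below. *)
have small (y e : R) : 0 <= e -> (forall k, y <= e / 2 ^+ k) -> y <= 0.
  move=> e0 ye; rewrite leNgt; apply/negP => y0.
  have := upper_nthrootP (leqnn (Num.Def.archi_bound (e / y))).
  rewrite ltr_pdivrMr // mulrC -ltr_pdivrMr ?exprn_gt0 // ltNge.
  by rewrite ye.
have xr : mnorm x <= r.
  rewrite -subr_le0; apply: (small _ K) => // k; rewrite lerBlDr.
  have := mnormD (x - u k) (u k); rewrite subrK => h; apply: le_trans h _.
  by apply: lerD => //; rewrite -mnormN opprB.
exists x => //; apply/eqP; rewrite -subr_eq0; apply/eqP/mnorm_eq0/eqP.
rewrite eq_le mnorm_ge0 andbT; apply: (small _ (K + K)) => [|k].
  by rewrite addr_ge0.
have -> : G x - x = (G x - G (u k)) + (u k.+1 - x) by rewrite /= addrA subrK.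
apply: le_trans (mnormD _ _) _; rewrite mulrDl; apply: lerD.
  apply: le_trans (Gc _ _ xr (ur k)) _.
  apply: (@le_trans _ _ (mnorm (x - u k))).
    by rewrite ler_pdivrMr // ler_peMr ?mnorm_ge0 // ler1n.
  by rewrite -mnormN opprB.
apply: le_trans (xP _) _; apply: ler_wpM2l => //.
by rewrite lef_pV2 ?posrE ?exprn_gt0 // exprS ler_peMl ?exprn_ge0 // ler1n.
Qed.

End MatrixNorm.

(** * Lipschitz classes near [z = 0] and an implicit function argument *)

Section Lipschitz.
Context {R : realType}.
Local Notation C := R[i].

(** Integer exponents suffice in the variable [z]; the fractional exponents of [t] come back through
    [bigOz_is_bigO]. *)
Definition bigOz a b (F : R -> 'M[C]_(a, b)) (k : nat) :=
  exists2 c : R, 0 <= c & \forall z \near 0^'+, mnorm (F z) <= c * z ^+ k.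

Lemma near_z1 : \forall z \near (0 : R)^'+, 0 < z /\ z <= 1.
Proof.
near=> z; split; first by near: z; exact: nbhs_right_gt.
by apply: ltW; near: z; apply: nbhs_right_lt.
Unshelve. all: by end_near. Qed.

Section Classes.
Variables (a b : nat).
Implicit Types y : 'M[C]_(a, b).

(* [lipo] is what the implicit function argument needs: value [O(z)] at [0] and
   local Lipschitz constant [O(z + |y|)].  A product of two [lip_small] maps is
   [lipo], see [lipoSS]. *)
Definition lipO a' b' (F : R -> 'M[C]_(a, b) -> 'M[C]_(a', b')) :=
  exists2 c : R, 0 <= c & \forall z \near 0^'+,
    forall y, mnorm y <= 1 -> mnorm (F z y) <= c /\
    forall y', mnorm y' <= 1 -> mnorm (F z y - F z y') <= c * mnorm (y - y').

Definition lip_small a' b' (F : R -> 'M[C]_(a, b) -> 'M[C]_(a', b')) :=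
  exists2 c : R, 0 <= c & \forall z \near 0^'+,
    forall y, mnorm y <= 1 -> mnorm (F z y) <= c * (z + mnorm y) /\
    forall y', mnorm y' <= 1 -> mnorm (F z y - F z y') <= c * mnorm (y - y').

Definition lipo a' b' (F : R -> 'M[C]_(a, b) -> 'M[C]_(a', b')) :=
  exists2 c : R, 0 <= c & \forall z \near 0^'+,
    mnorm (F z 0) <= c * z /\
    forall y y', mnorm y <= 1 -> mnorm y' <= 1 ->
     mnorm (F z y - F z y') <= c * (z + mnorm y + mnorm y') * mnorm (y - y').

Lemma lip_small_lipO a' b' (F : R -> 'M[C]_(a, b) -> 'M[C]_(a', b')) :
  lip_small F -> lipO F.
Proof.
case=> c c0 Fc; exists (c + c); first exact: addr_ge0.
move: near_z1 Fc; apply: filterS2 => z [z0 z1] Fc y y1.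
have [h1 h2] := Fc y y1; split.
  by apply: (le_trans h1); have := mnorm_ge0 y; nra.
by move=> y' /h2 h; apply: le_trans h _; have := mnorm_ge0 (y - y'); nra.
Qed.

Lemma lipo_lip_small a' b' (F : R -> 'M[C]_(a, b) -> 'M[C]_(a', b')) :
  lipo F -> lip_small F.
Proof.
case=> c c0 Fc; exists (c + c + c); first by rewrite !addr_ge0.
move: near_z1 Fc; apply: filterS2 => z [z0 z1] [F0 Fc] y y1.
have n0 := mnorm_ge0 y; split.
  have := Fc y 0 y1; rewrite mnorm0 subr0 addr0 => /(_ ler01) h.
  have := mnormD (F z y - F z 0) (F z 0); rewrite subrK => h2.
  have h3 : c * (z + mnorm y) * mnorm y <= c * (z + mnorm y).
    by apply: ler_piMr => //; rewrite mulr_ge0 // addr_ge0 // ltW.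
  have h4 : 0 <= c * mnorm y by apply: mulr_ge0.
  have h5 : 0 <= c * z by rewrite mulr_ge0 // ltW.
  lra.
move=> y' y'1; apply: le_trans (Fc y y' y1 y'1) _.
apply: ler_wpM2r; first exact: mnorm_ge0.
have n'0 := mnorm_ge0 y'; nra.
Qed.

Lemma lipoD a' b' (F G : R -> 'M[C]_(a, b) -> 'M[C]_(a', b')) :
  lipo F -> lipo G -> lipo (fun z y => F z y + G z y).
Proof.
move=> [c c0 Fc] [d d0 Gd]; exists (c + d); first exact: addr_ge0.
move: Fc Gd; apply: filterS2 => z [F0 Fc] [G0 Gc]; split.
  by rewrite mulrDl (le_trans (mnormD _ _)) ?lerD.
move=> y y' y1 y'1; rewrite opprD addrACA (le_trans (mnormD _ _)) //.
by rewrite -mulrA mulrDl !mulrA lerD // ?Fc ?Gc.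
Qed.

Lemma lipoN a' b' (F : R -> 'M[C]_(a, b) -> 'M[C]_(a', b')) :
  lipo F -> lipo (fun z y => - F z y).
Proof.
move=> [c c0 Fc]; exists c => //; move: Fc; apply: filterS => z [F0 Fc].
split; first by rewrite mnormN.
by move=> y y' y1 y'1; rewrite -opprD mnormN Fc.
Qed.

Lemma lipoMl a' b' d (B : 'M[C]_(d, a'))
    (F : R -> 'M[C]_(a, b) -> 'M[C]_(a', b')) :
  lipo F -> lipo (fun z y => B *m F z y).
Proof.
move=> [c c0 Fc]; have B0 := mnorm_ge0 B; exists (mnorm B * c).
  exact: mulr_ge0.
move: Fc; apply: filterS => z [F0 Fc]; split.
  by rewrite (le_trans (mnormM _ _)) // -mulrA ler_wpM2l.
move=> y y' y1 y'1; rewrite -mulmxBr (le_trans (mnormM _ _)) //.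
by rewrite -!mulrA ler_wpM2l // mulrA Fc.
Qed.

Lemma lipoOM a' b' d (B : R -> 'M[C]_(d, a'))
    (F : R -> 'M[C]_(a, b) -> 'M[C]_(a', b')) :
  bigOz B 1 -> lipO F -> lipo (fun z y => B z *m F z y).
Proof.
move=> [e e0 Be] [c c0 Fc]; exists (e * c); first exact: mulr_ge0.
move: near_z1 Be Fc; apply: filterS3 => z [z0 z1] Be Fc.
rewrite expr1 in Be.
have B0 := mnorm_ge0 (B z); split.
  have [|h _] := Fc 0; first by rewrite mnorm0.
  rewrite (le_trans (mnormM _ _)) // mulrAC.
  by apply: ler_pM => //; apply: mnorm_ge0.
move=> y y' y1 y'1; have [_ /(_ _ y'1) h] := Fc y y1.
rewrite -mulmxBr (le_trans (mnormM _ _)) //.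
apply: (@le_trans _ _ ((e * z) * (c * mnorm (y - y')))).
  by apply: ler_pM => //; apply: mnorm_ge0.
rewrite [leLHS](_ : _ = (e * c) * z * mnorm (y - y')); last by ring.
apply: ler_wpM2r; first exact: mnorm_ge0.
apply: ler_wpM2l; first exact: mulr_ge0.
by have := mnorm_ge0 y; have := mnorm_ge0 y'; lra.
Qed.

(** Split [F G - F' G'] as [(F - F') G + F' (G - G')]: each summand has one factor of size
    [O(z + |y|)] and one Lipschitz difference. *)
Lemma lipoSS a' b' d (F : R -> 'M[C]_(a, b) -> 'M[C]_(a', b'))
    (G : R -> 'M[C]_(a, b) -> 'M[C]_(b', d)) :
  lip_small F -> lip_small G -> lipo (fun z y => F z y *m G z y).
Proof.
move=> [c c0 Fc] [e e0 Ge]; exists (c * e + c * e).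
  by rewrite addr_ge0 ?mulr_ge0.
move: near_z1 Fc Ge; apply: filterS3 => z [z0 z1] Fc Ge; split.
  have [|h _] := Fc 0; first by rewrite mnorm0.
  have [|h' _] := Ge 0; first by rewrite mnorm0.
  rewrite mnorm0 addr0 in h h'.
  rewrite (le_trans (mnormM _ _)) //.
  apply: (@le_trans _ _ ((c * z) * (e * z))).
    by apply: ler_pM => //; apply: mnorm_ge0.
  have : 0 <= c * e by apply: mulr_ge0.
  set k := c * e => k0; rewrite (_ : _ * _ = k * z * z); last by rewrite /k; ring.
  have kz : 0 <= k * z by rewrite mulr_ge0 // ltW.
  by have := ler_piMr kz z1; lra.
move=> y y' y1 y'1; have [h1 /(_ _ y'1) h2] := Fc y y1.
have [h3 /(_ _ y'1) h4] := Ge y y1; have [h5 _] := Fc _ y'1.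
have -> : F z y *m G z y - F z y' *m G z y' =
    (F z y - F z y') *m G z y + F z y' *m (G z y - G z y').
  by rewrite mulmxBl mulmxBr addrA subrK.
rewrite (le_trans (mnormD _ _)) //.
have n0 := mnorm_ge0 y; have n0' := mnorm_ge0 y'.
have m0 := mnorm_ge0 (y - y').
apply: (@le_trans _ _ ((c * mnorm (y - y')) * (e * (z + mnorm y)) +
   (c * (z + mnorm y')) * (e * mnorm (y - y')))).
  by apply: lerD; rewrite (le_trans (mnormM _ _)) //; apply: ler_pM => //;
     apply: mnorm_ge0.
rewrite [leLHS](_ : _ = (c * e) * ((z + mnorm y) + (z + mnorm y')) * mnorm (y - y'));
  last by ring.
apply: ler_wpM2r => //; have : 0 <= c * e by apply: mulr_ge0.
by set k := c * e => k0; nra.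
Qed.

Lemma lipOM a' b' d (F : R -> 'M[C]_(a, b) -> 'M[C]_(a', b'))
    (G : R -> 'M[C]_(a, b) -> 'M[C]_(b', d)) :
  lipO F -> lipO G -> lipO (fun z y => F z y *m G z y).
Proof.
move=> [c c0 Fc] [e e0 Ge]; exists (c * e + c * e).
  by rewrite addr_ge0 ?mulr_ge0.
move: Fc Ge; apply: filterS2 => z Fc Ge y y1.
have [h1 h2] := Fc y y1; have [h3 h4] := Ge y y1.
have ce0 : 0 <= c * e by apply: mulr_ge0.
split.
  rewrite (le_trans (mnormM _ _)) // (@le_trans _ _ (c * e)) ?lerDl //.
  by apply: ler_pM => //; apply: mnorm_ge0.
move=> y' y'1; have {}h2 := h2 _ y'1; have {}h4 := h4 _ y'1.
have [h5 _] := Fc _ y'1.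
have -> : F z y *m G z y - F z y' *m G z y' =
    (F z y - F z y') *m G z y + F z y' *m (G z y - G z y').
  by rewrite mulmxBl mulmxBr addrA subrK.
rewrite (le_trans (mnormD _ _)) //.
apply: (@le_trans _ _ ((c * mnorm (y - y')) * e + c * (e * mnorm (y - y')))).
  by apply: lerD; rewrite (le_trans (mnormM _ _)) //; apply: ler_pM => //;
     apply: mnorm_ge0.
by rewrite mulrAC mulrA -mulrDl.
Qed.

Lemma lipOD a' b' (F G : R -> 'M[C]_(a, b) -> 'M[C]_(a', b')) :
  lipO F -> lipO G -> lipO (fun z y => F z y + G z y).
Proof.
move=> [c c0 Fc] [d d0 Gd]; exists (c + d); first exact: addr_ge0.
move: Fc Gd; apply: filterS2 => z Fc Gc y y1.
have [h1 h2] := Fc y y1; have [h3 h4] := Gc y y1; split.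
  by rewrite (le_trans (mnormD _ _)) ?lerD.
move=> y' y'1; rewrite opprD addrACA (le_trans (mnormD _ _)) //.
by rewrite mulrDl lerD ?h2 ?h4.
Qed.

Lemma lip_smallD a' b' (F G : R -> 'M[C]_(a, b) -> 'M[C]_(a', b')) :
  lip_small F -> lip_small G -> lip_small (fun z y => F z y + G z y).
Proof.
move=> [c c0 Fc] [d d0 Gd]; exists (c + d); first exact: addr_ge0.
move: Fc Gd; apply: filterS2 => z Fc Gc y y1.
have [h1 h2] := Fc y y1; have [h3 h4] := Gc y y1; split.
  by rewrite mulrDl (le_trans (mnormD _ _)) ?lerD.
move=> y' y'1; rewrite opprD addrACA (le_trans (mnormD _ _)) //.
by rewrite mulrDl lerD ?h2 ?h4.
Qed.

Lemma lipO_const a' b' (B : R -> 'M[C]_(a', b')) :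
  bigOz B 0 -> lipO (fun z _ => B z).
Proof.
move=> [c c0 Bc]; exists c => //; move: Bc; apply: filterS => z Bc y y1.
rewrite expr0 mulr1 in Bc; split => // y' _.
by rewrite subrr mnorm0 mulr_ge0 // mnorm_ge0.
Qed.

Lemma lip_small_linear a' b' (f : {linear 'M[C]_(a, b) -> 'M[C]_(a', b')}) :
  lip_small (fun=> f).
Proof.
have [c c0 fc] := linear_bounded f; exists c => //.
move: near_z1; apply: filterS => z [z0 z1] y y1; split.
  by apply: le_trans (fc y) _; apply: ler_wpM2l => //; lra.
by move=> y' _; rewrite -linearB.
Qed.

End Classes.

Lemma bigOz_const a b (B : 'M[C]_(a, b)) : bigOz (fun=> B) 0.
Proof.
exists (mnorm B); first exact: mnorm_ge0.
by apply: filterS (@near_z1) => z _; rewrite expr0 mulr1.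
Qed.

(* [L^-1 o E] contracts the ball of radius [O(z)]. *)
Lemma implicit_solution a b
    (L : {linear 'M[C]_(a, b) -> 'M[C]_(a, b)})
    (E : R -> 'M[C]_(a, b) -> 'M[C]_(a, b)) :
  (forall y, L y = 0 -> y = 0) -> lipo E ->
  exists2 Y : R -> 'M[C]_(a, b), bigOz Y 1 &
    \forall z \near 0^'+, L (Y z) + E z (Y z) = 0.
Proof.
move=> Linj [c c0 Ec]; have [g gK] := linear_inj_inverse Linj.
have [k k0 gk] := linear_bounded g.
(* [K * z] bounds [L^-1 (E z 0)]; the ball has twice this radius, as [contraction_fixpoint] asks. *)
pose K := k * c; have K0 : 0 <= K by apply: mulr_ge0.
have sol : \forall z \near 0^'+,
    exists y, mnorm y <= 2 * K * z /\ L y + E z y = 0.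
  near=> z.
  have [z0 _] : 0 < z /\ z <= 1 by near: z; exact: near_z1.
  have [E0 Ez] : mnorm (E z 0) <= c * z /\ forall y y', mnorm y <= 1 ->
     mnorm y' <= 1 -> mnorm (E z y - E z y') <=
     c * (z + mnorm y + mnorm y') * mnorm (y - y') by near: z.
  (* One smallness condition serves twice: the ball stays inside the unit ball, where the bounds on
     [E] hold, and the contraction factor is at most 1/2. *)
  have zs : z * (2 * (K + 1) * (4 * K + 1)) <= 1.
    rewrite -ler_pdivlMr ?mul1r; last by rewrite !mulr_gt0 ?ltr_wpDl ?mulr_ge0.
    apply: ltW; near: z; apply: nbhs_right_lt.
    by rewrite invr_gt0 !mulr_gt0 ?ltr_wpDl ?mulr_ge0.
  have r1 : 2 * K * z <= 1 by nra.
  have r2 : K * (z + 2 * K * z + 2 * K * z) <= 1 / 2 by nra.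
  have [||x y xr yr|y yr yE] := @contraction_fixpoint _ _ _ (fun y => - g (E z y)) (2 * K * z).
  - by rewrite !mulr_ge0 // ltW.
  - rewrite mnormN (le_trans (gk _)) //.
    have -> : 2 * K * z / 2 = k * (c * z) by rewrite /K; field.
    by rewrite ler_wpM2l.
  - rewrite -opprD mnormN -linearB (le_trans (gk _)) //.
    have h := Ez x y (le_trans xr r1) (le_trans yr r1).
    apply: (@le_trans _ _ (k * (c * (z + mnorm x + mnorm y) * mnorm (x - y)))).
      by rewrite ler_wpM2l.
    rewrite !mulrA [leRHS]mulrC; apply: ler_wpM2r; first exact: mnorm_ge0.
    rewrite -/K; apply: le_trans (_ : _ <= 1 / 2) _; last by rewrite mul1r.
    by apply: le_trans r2; apply: ler_wpM2l => //; lra.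
  - by exists y; split=> //; rewrite -{1}yE linearN gK addNr.
(* Solutions are known only for [z] near [0]; an implication has a witness at every [z], which makes
   [Y] total. *)
have choice z : exists y, (exists y, mnorm y <= 2 * K * z /\ L y + E z y = 0) ->
    mnorm y <= 2 * K * z /\ L y + E z y = 0.
  by case: (pselect (exists y, mnorm y <= 2 * K * z /\ L y + E z y = 0))
    => [[y yP]|n]; [exists y | exists 0].
pose Y z := projT1 (cid (choice z)).
have YP z : (exists y, mnorm y <= 2 * K * z /\ L y + E z y = 0) ->
    mnorm (Y z) <= 2 * K * z /\ L (Y z) + E z (Y z) = 0.
  by rewrite /Y; case: (cid _).
exists Y; first exists (2 * K); first by rewrite mulr_ge0.
  by apply: filterS sol => z /YP []; rewrite expr1.
by apply: filterS sol => z /YP [].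
Unshelve. all: by end_near. Qed.

End Lipschitz.

(** * Continuation of deflating subspaces *)

Section Deflation.
Context {R : realType}.
Local Notation C := R[i].

Lemma bigOzM a b c (F : R -> 'M[C]_(a, b)) (G : R -> 'M[C]_(b, c)) i j :
  bigOz F i -> bigOz G j -> bigOz (fun z => F z *m G z) (i + j).
Proof.
move=> [f f0 Ff] [g g0 Gg]; exists (f * g); first exact: mulr_ge0.
move: Ff Gg; apply: filterS2 => z Ff Gg; rewrite (le_trans (mnormM _ _)) //.
by rewrite exprD mulrACA ler_pM // mnorm_ge0.
Qed.

Lemma bigOzD a b (F G : R -> 'M[C]_(a, b)) i :
  bigOz F i -> bigOz G i -> bigOz (fun z => F z + G z) i.
Proof.
move=> [f f0 Ff] [g g0 Gg]; exists (f + g); first exact: addr_ge0.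
move: Ff Gg; apply: filterS2 => z Ff Gg; rewrite (le_trans (mnormD _ _)) //.
by rewrite mulrDl lerD.
Qed.

Lemma bigOzW a b (F : R -> 'M[C]_(a, b)) i j :
  (j <= i)%N -> bigOz F i -> bigOz F j.
Proof.
move=> ji [f f0 Ff]; exists f => //; move: (near_z1 (R := R)) Ff.
apply: filterS2 => z [z0 z1] Ff; apply: le_trans Ff _.
by apply: ler_wpM2l => //; apply: ler_wiXn2l => //; apply: ltW.
Qed.

Lemma bigOz_near a b (F G : R -> 'M[C]_(a, b)) i :
  (\forall z \near 0^'+, F z = G z) -> bigOz F i -> bigOz G i.
Proof.
move=> FG [f f0 Ff]; exists f => //; move: FG Ff.
by apply: filterS2 => z ->.
Qed.

Lemma bigOz_limit a b (F : R -> 'M[C]_(a, b)) (F0 : 'M[C]_(a, b)) :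
  bigOz (fun z => F z - F0) 1 -> bigOz F 0.
Proof.
move=> /(bigOzW (leq0n 1)) h.
apply: bigOz_near (bigOzD h (bigOz_const F0)).
by apply: filterS (near_z1 (R := R)) => z _; rewrite subrK.
Qed.

(** Here [th1] is the part of the change of [Th] that is linear in [h], and [th2] the part of order
    [z]. The first line becomes the linearisation; every other term is of order [z] or quadratic. *)
Lemma deflation_residual d q (A0 K0 a k : 'M[C]_d) (Y0 h : 'M[C]_(d, q))
    (Th0 th1 th2 : 'M[C]_q) : A0 *m Y0 = K0 *m (Y0 *m Th0) ->
  A0 *m h - K0 *m (h *m Th0 + Y0 *m th1) +
    (a *m (Y0 + h) - k *m ((Y0 + h) *m (Th0 + (th1 + th2)))
     - K0 *m (Y0 *m th2) - K0 *m (h *m (th1 + th2))) =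
  (A0 + a) *m (Y0 + h) - (K0 + k) *m ((Y0 + h) *m (Th0 + (th1 + th2))).
Proof.
move=> AY0; rewrite !(mulmxDl, mulmxDr) AY0.
do ![match goal with |- context [?X *m ?Y] => move: (X *m Y) => ? end].
by apply/matrixP => i j; rewrite !mxE; ring.
Qed.

Variables (d q : nat) (A K : R -> 'M[C]_d) (A0 K0 : 'M[C]_d).
Variables (Q : 'M[C]_(q, d)) (Qt Y0 : 'M[C]_(d, q)) (Th0 : 'M[C]_q).
Hypotheses (A_A0 : bigOz (fun z => A z - A0) 1)
  (K_K0 : bigOz (fun z => K z - K0) 1).
Hypotheses (QQt : Q *m Qt = 1%:M) (QK0 : Q *m K0 = Q)
  (QK : \forall z \near 0^'+, Q *m K z = Q) (QY0 : Q *m Y0 = 1%:M).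
Hypothesis AY0 : A0 *m Y0 = K0 *m (Y0 *m Th0).
Hypothesis inj : forall y : 'M[C]_(d, q), Q *m y = 0 ->
  A0 *m y = K0 *m (y *m Th0 + Y0 *m (Q *m (A0 *m y))) -> y = 0.

(** Projection onto the kernel of [Q] along [Qt], so that an unrestricted [y] yields an admissible
    correction of [Y0]. *)
Let h : {linear 'M[C]_(d, q) -> 'M[C]_(d, q)} :=
  (idfun \- (mulmx Qt \o mulmx Q)).
(** The linearisation on the kernel of [Q], completed by [Qt Q] to an operator on all matrices.
    Applying [Q] cancels everything but [Q y], so its injectivity reduces to [inj]. *)
Let L : {linear 'M[C]_(d, q) -> 'M[C]_(d, q)} :=
  (((mulmx A0 \o h) \- (mulmx K0 \o ((mulmxr Th0 \o h) \+
     (mulmx Y0 \o mulmx Q \o mulmx A0 \o h)))) \+ (mulmx Qt \o mulmx Q)).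

Let hE y : h y = y - Qt *m (Q *m y). Proof. by []. Qed.

Let LE y : L y = A0 *m h y
  - K0 *m (h y *m Th0 + Y0 *m (Q *m (A0 *m h y))) + Qt *m (Q *m y).
Proof. by []. Qed.

Let Qh y : Q *m h y = 0.
Proof. by rewrite hE mulmxBr [Q *m (Qt *m _)]mulmxA QQt mul1mx subrr. Qed.

Let h_id y : Q *m y = 0 -> h y = y.
Proof. by rewrite hE => ->; rewrite mulmx0 subr0. Qed.

Let QA0Y0 : Q *m (A0 *m Y0) = Th0.
Proof. by rewrite AY0 mulmxA QK0 mulmxA QY0 mul1mx. Qed.

Let L_inj y : L y = 0 -> y = 0.
Proof.
move=> Ly; have Qy : Q *m y = 0.
  move: (congr1 (mulmx Q) Ly); rewrite LE mulmx0 mulmxDr mulmxBr.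
  rewrite [Q *m (K0 *m _)]mulmxA QK0 mulmxDr [Q *m (h y *m _)]mulmxA Qh mul0mx add0r.
  rewrite [Q *m (Y0 *m _)]mulmxA QY0 mul1mx subrr add0r.
  by rewrite mulmxA QQt mul1mx.
move: Ly; rewrite LE h_id // Qy mulmx0 addr0 => /eqP.
by rewrite subr_eq0 => /eqP; apply: inj.
Qed.

(** With [Th] eliminated as [Q A Y], the residual in [h y] has linear part [L] and a remainder in
    the class [lipo], so [implicit_solution] applies. *)
Lemma deflation : exists (Y : R -> 'M[C]_(d, q)) (Th : R -> 'M[C]_q),
  [/\ bigOz (fun z => Y z - Y0) 1, bigOz (fun z => Th z - Th0) 1 &
  \forall z \near 0^'+, Q *m Y z = 1%:M /\ A z *m Y z = K z *m (Y z *m Th z)].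
Proof.
pose Y y := Y0 + h y.
pose a z := A z - A0; pose k z := K z - K0.
pose th z y := Q *m (A0 *m h y) + Q *m (a z *m Y y).
pose E z y := a z *m Y y - k z *m (Y y *m (Th0 + th z y))
  - K0 *m (Y0 *m (Q *m (a z *m Y y))) - K0 *m (h y *m th z y).
have hS : lip_small (fun=> h) by apply: (lip_small_linear h).
have YO : lipO (fun=> Y).
  by apply: lipOD (lip_small_lipO hS); apply: lipO_const (bigOz_const _).
have aY : lipo (fun z y => a z *m Y y) by apply: lipoOM.
have thS : lip_small th.
  apply: lip_smallD; last by apply/lipo_lip_small/lipoMl.
  exact: (lip_small_linear (mulmx Q \o mulmx A0 \o h)).
have ThO : lipO (fun z y => Th0 + th z y).
  by apply: lipOD (lip_small_lipO thS); apply: lipO_const (bigOz_const _).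
have EO : lipo E.
  apply: lipoD; last by apply/lipoN/lipoMl/lipoSS.
  apply: lipoD; last by apply/lipoN; do 3!apply: lipoMl.
  by apply: lipoD => //; apply/lipoN/lipoOM => //; apply: lipOM.
have [y yO yE] := @implicit_solution R d q L E L_inj EO.
have sol z : Q *m K z = Q -> L (y z) + E z (y z) = 0 ->
    Q *m Y (y z) = 1%:M /\
    A z *m Y (y z) = K z *m (Y (y z) *m (Q *m (A z *m Y (y z)))).
  move=> QKz; set w := y z => Ew.
  have QY : Q *m Y w = 1%:M by rewrite /Y mulmxDr QY0 Qh addr0.
  split=> //.
  have AYE : A z *m Y w = A0 *m Y0 + A0 *m h w + a z *m Y w.
    by rewrite -mulmxDr -mulmxDl addrCA subrr addr0.
  have thE : Q *m (A z *m Y w) = Th0 + th z w.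
    by rewrite AYE mulmxDr mulmxDr QA0Y0 -addrA.
  have FE : L w + E z w = A z *m Y w - K z *m (Y w *m (Q *m (A z *m Y w)))
      + Qt *m (Q *m w).
    rewrite thE LE addrAC; congr (_ + _).
    have -> : A z = A0 + a z by rewrite addrC subrK.
    have -> : K z = K0 + k z by rewrite addrC subrK.
    exact: deflation_residual.
  move: Ew; rewrite FE => E0.
  (* [Q] annihilates the residual, so the auxiliary term [Qt Q w] vanishes and with it the residual
     itself. *)
  have Qw : Q *m w = 0.
    move: (congr1 (mulmx Q) E0); rewrite mulmx0 mulmxDr mulmxBr.
    rewrite [Q *m (K z *m _)]mulmxA QKz [Q *m (Y w *m _)]mulmxA QY mul1mx subrr.
    by rewrite add0r mulmxA QQt mul1mx.
  by move: E0; rewrite Qw mulmx0 addr0 => /eqP; rewrite subr_eq0 => /eqP.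
have YY : bigOz (fun z => Y (y z) - Y0) 1.
  have [c c0 cb] := linear_bounded h; case: yO => e e0 eb.
  exists (c * e); first exact: mulr_ge0.
  apply: filterS eb => z eb; rewrite /Y addrC addKr.
  by apply: le_trans (cb _) _; rewrite -mulrA ler_wpM2l.
exists (fun z => Y (y z)), (fun z => Q *m (A z *m Y (y z))); split=> //.
  apply: (@bigOz_near _ _ (fun z => Q *m ((A z - A0) *m Y (y z)) +
      Q *m (A0 *m (Y (y z) - Y0)))).
    apply: filterS (near_z1 (R := R)) => z _.
    by rewrite -mulmxDr mulmxBl mulmxBr addrA subrK mulmxBr QA0Y0.
  apply: bigOzD; first by apply: (bigOzM (bigOz_const Q) (bigOzM A_A0 (bigOz_limit YY))).
  exact: (bigOzM (bigOz_const Q) (bigOzM (bigOz_const A0) YY)).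
by move: QK yE; apply: filterS2.
Qed.

End Deflation.

(** * Continuity of polynomial roots *)

Section RootContinuity.
Context {R : realType}.
Local Notation C := R[i].

Definition cvgC (f : R -> C) (a : C) :=
  forall e, 0 < e -> \forall z \near 0^'+, normc (f z - a) < e.

Lemma cvgC_cst a : cvgC (fun=> a) a.
Proof. by move=> e e0; rewrite subrr normc0; near=> z. Unshelve. all: by end_near. Qed.

Lemma cvgC_near f g a :
  (\forall z \near 0^'+, f z = g z) -> cvgC f a -> cvgC g a.
Proof. by move=> fg fa e /fa; move: fg; apply: filterS2 => z ->. Qed.

Lemma cvgCD f g a b : cvgC f a -> cvgC g b -> cvgC (fun z => f z + g z) (a + b).
Proof.
move=> fa gb e e0; have e20 : 0 < e / 2 by lra.
move: (fa _ e20) (gb _ e20); apply: filterS2 => z h1 h2.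
by rewrite opprD addrACA (le_lt_trans (normcD _ _)) //; lra.
Qed.

Lemma cvgCM f g a b : cvgC f a -> cvgC g b -> cvgC (fun z => f z * g z) (a * b).
Proof.
move=> fa gb e e0.
pose K := normc a + normc b + 1.
have a0 := normc_ge0 a; have b0 := normc_ge0 b.
have K1 : 1 <= K by rewrite /K lerDr addr_ge0.
pose d := Num.min 1 (e / (2 * K)).
have d0 : 0 < d by rewrite lt_min ltr01 divr_gt0 // mulr_gt0 // (lt_le_trans ltr01).
have [d1 dK] : d <= 1 /\ 2 * K * d <= e.
  rewrite ge_min lexx; split=> //.
  have -> : e = 2 * K * (e / (2 * K)) by field; apply/lt0r_neq0/(lt_le_trans ltr01).
  by rewrite ler_pM2l ?ge_min ?lexx ?orbT // mulr_gt0 // (lt_le_trans ltr01).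
move: (fa _ d0) (gb _ d0); apply: filterS2 => z h1 h2.
have -> : f z * g z - a * b = (f z - a) * (g z - b) + a * (g z - b) + (f z - a) * b.
  by ring.
apply: le_lt_trans (normcD _ _) _; rewrite normcM.
have := normcD ((f z - a) * (g z - b)) (a * (g z - b)); rewrite !normcM.
move: (normc_ge0 (f z - a)) (normc_ge0 (g z - b)) h1 h2 => ? ? ? ?.
rewrite /K in dK; nra.
Qed.

Lemma cvgC_sum (I : Type) (s : seq I) (f : I -> R -> C) (a : I -> C) :
  (forall i, cvgC (f i) (a i)) ->
  cvgC (fun z => \sum_(i <- s) f i z) (\sum_(i <- s) a i).
Proof.
move=> fa; elim: s => [|i s IHs].
  by rewrite big_nil; apply: cvgC_near (cvgC_cst 0); near=> z; rewrite big_nil.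
rewrite big_cons; apply: cvgC_near (cvgCD (fa i) IHs).
by near=> z; rewrite big_cons.
Unshelve. all: by end_near. Qed.

Definition pcvg (p : R -> {poly C}) (P : {poly C}) :=
  forall i, cvgC (fun z => (p z)`_i) P`_i.

Lemma pcvg_near p q P :
  (\forall z \near 0^'+, p z = q z) -> pcvg p P -> pcvg q P.
Proof. by move=> pq pP i; apply: cvgC_near (pP i); apply: filterS pq => z ->. Qed.

Lemma pcvg_cst P : pcvg (fun=> P) P.
Proof. by move=> i; apply: cvgC_cst. Qed.

Lemma pcvgD p q P Q : pcvg p P -> pcvg q Q -> pcvg (fun z => p z + q z) (P + Q).
Proof.
move=> pP qQ i; rewrite coefD; apply: cvgC_near (cvgCD (pP i) (qQ i)).
by near=> z; rewrite coefD.
Unshelve. all: by end_near. Qed.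

Lemma pcvgM p q P Q : pcvg p P -> pcvg q Q -> pcvg (fun z => p z * q z) (P * Q).
Proof.
move=> pP qQ i; rewrite coefM; apply: cvgC_near (cvgC_sum _ _); last first.
  by move=> j; apply: cvgCM; [apply: pP | apply: qQ].
by near=> z; rewrite coefM.
Unshelve. all: by end_near. Qed.

Lemma pcvg_sum (I : Type) (s : seq I) (p : I -> R -> {poly C}) P :
  (forall i, pcvg (p i) (P i)) ->
  pcvg (fun z => \sum_(i <- s) p i z) (\sum_(i <- s) P i).
Proof.
move=> fa; elim: s => [|i s IHs].
  by rewrite big_nil; apply: pcvg_near (pcvg_cst 0); near=> z; rewrite big_nil.
rewrite big_cons; apply: pcvg_near (pcvgD (fa i) IHs).
by near=> z; rewrite big_cons.
Unshelve. all: by end_near. Qed.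

Lemma pcvg_prod (I : Type) (s : seq I) (p : I -> R -> {poly C}) P :
  (forall i, pcvg (p i) (P i)) ->
  pcvg (fun z => \prod_(i <- s) p i z) (\prod_(i <- s) P i).
Proof.
move=> fa; elim: s => [|i s IHs].
  by rewrite big_nil; apply: pcvg_near (pcvg_cst 1); near=> z; rewrite big_nil.
rewrite big_cons; apply: pcvg_near (pcvgM (fa i) IHs).
by near=> z; rewrite big_cons.
Unshelve. all: by end_near. Qed.

Lemma pcvg_char_poly q (A : R -> 'M[C]_q) (A0 : 'M[C]_q) :
  (forall i j, cvgC (fun z => A z i j) (A0 i j)) ->
  pcvg (fun z => char_poly (A z)) (char_poly A0).
Proof.
move=> AA0; have ent i j :
    pcvg (fun z => char_poly_mx (A z) i j) (char_poly_mx A0 i j).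
  apply: (@pcvg_near (fun z => ('X *+ (i == j) + (-1)%:P * (A z i j)%:P))).
    by near=> z; rewrite !mxE polyCN mulN1r.
  have -> : char_poly_mx A0 i j = 'X *+ (i == j) + (-1)%:P * (A0 i j)%:P.
    by rewrite !mxE polyCN mulN1r.
  apply: pcvgD; first exact: pcvg_cst.
  apply: pcvgM; first exact: pcvg_cst.
  move=> k; rewrite coefC.
  apply: (@cvgC_near (fun z => if k == 0 then A z i j else 0)).
    by near=> z; rewrite coefC.
  by case: (k == 0); [apply: AA0 | apply: cvgC_cst].
apply: pcvg_sum => s; apply: pcvgM; first exact: pcvg_cst.
by apply: pcvg_prod => i; apply: ent.
Unshelve. all: by end_near. Qed.

(** Each root [x] at distance at least [e] from [a] satisfies
    [|b - x| <= |a - x| (1 + |b - a| / e)]; multiply over at most [D] roots. *)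
Lemma horner_far_roots (p : {poly C}) (D : nat) (a b : C) (e : R) :
  (size p <= D.+1)%N -> 0 < e ->
  (forall x, root p x -> e <= normc (a - x)) ->
  normc p.[b] <= normc p.[a] * (1 + normc (b - a) / e) ^+ D.
Proof.
move=> pD e0; have [->|p0] := eqVneq p 0.
  by rewrite !horner0 normc0 mul0r.
have [rs prs] := closed_field_poly_normal p; move: pD; rewrite prs => pD far.
have {pD} rsD : (size rs <= D)%N.
  by rewrite -ltnS -(size_prod_XsubC rs id) -(@size_scale _ (lead_coef p)) ?lead_coef_eq0.
have {}far x : x \in rs -> e <= normc (a - x).
  by move=> xrs; apply: far; rewrite rootZ ?lead_coef_eq0 // root_prod_XsubC.
rewrite !hornerZ !normcM -mulrA; apply: ler_wpM2l; first exact: normc_ge0.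
set k := 1 + _; have k1 : 1 <= k by rewrite lerDl divr_ge0 ?normc_ge0 // ltW.
apply: le_trans (_ : _ <= normc (\prod_(x <- rs) ('X - x%:P)).[a] * k ^+ size rs) _.
  clear rsD prs; elim: rs far => [|x rs IHrs] far.
    by rewrite !big_nil !hornerC mulr1.
  rewrite !big_cons !hornerM !normcM exprS mulrACA; apply: ler_pM.
  - exact: normc_ge0.
  - exact: normc_ge0.
  - rewrite !hornerXsubC; have -> : b - x = (a - x) + (b - a) by ring.
    apply: le_trans (normcD _ _) _; rewrite mulrDr mulr1 lerD2l mulrCA.
    rewrite ler_peMr ?normc_ge0 // ler_pdivlMr // mul1r.
    by apply: far; rewrite mem_head.
  - by apply: IHrs => y yrs; apply: far; rewrite in_cons yrs orbT.
apply: ler_wpM2l; first exact: normc_ge0.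
exact: ler_weXn2l.
Qed.

Lemma exists_nonroot (p : {poly C}) : p != 0 -> exists b, p.[b] != 0.
Proof.
move=> p0; pose rs : seq C := [seq i%:R | i <- iota 0 (size p)].
have [h|] := boolP (all (root p) rs).
  have : (size rs < size p)%N; last by rewrite size_map size_iota ltnn.
  apply: max_poly_roots => //.
  by rewrite map_inj_uniq ?iota_uniq // => i j /eqP; rewrite eqr_nat => /eqP.
by move=> /allPn[x _ rx]; exists x.
Qed.

Lemma nearest_root (p : {poly C}) (a : C) : (exists x, root p x) ->
  exists r, root p r /\ forall x, root p x -> normc (a - r) <= normc (a - x).
Proof.
have [-> _|p0] := eqVneq p 0.
  by exists a; rewrite root0; split=> // x _; rewrite subrr normc0 normc_ge0.
have [rs prs] := closed_field_poly_normal p.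
have rsE x : root p x = (x \in rs).
  by rewrite prs rootZ ?lead_coef_eq0 // root_prod_XsubC.
case=> x; rewrite rsE => xrs.
have xi : (index x rs < size rs)%N by rewrite index_mem.
case: (@arg_minP _ _ _ (Ordinal xi) xpredT
   (fun i : 'I_(size rs) => normc (a - rs`_i))) => // i _ imin.
exists rs`_i; rewrite rsE mem_nth //; split=> // y; rewrite rsE => yrs.
have yi : (index y rs < size rs)%N by rewrite index_mem.
by have := imin (Ordinal yi) isT; rewrite /= nth_index.
Qed.

Lemma cvgC_horner (p : R -> {poly C}) P D a :
  (forall z, (size (p z) <= D)%N) -> pcvg p P -> cvgC (fun z => (p z).[a]) P.[a].
Proof.
move=> pD pP; pose D' := maxn D (size P).
rewrite (@horner_coef_wide _ D') ?leq_maxr //.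
apply: cvgC_near (cvgC_sum _ _); last first.
  by move=> i; apply: (cvgCM (pP i)); apply: cvgC_cst.
by near=> z; rewrite (@horner_coef_wide _ D') // leq_max pD.
Unshelve. all: by end_near. Qed.

(** If all roots of [p z] stayed at distance [e] from [a], the value of [p z] at a point [b] with
    [P.[b] != 0] would be at most a constant times [(p z).[a]], which tends to [0]. *)
Lemma root_continuity1 (p : R -> {poly C}) P D a :
  (forall z, (size (p z) <= D)%N) -> pcvg p P -> P != 0 -> root P a ->
  exists r, cvgC r a /\ \forall z \near 0^'+, root (p z) (r z).
Proof.
move=> pD pP P0 Pa; have [b Pb] := exists_nonroot P0.
(* Choosing a nearest root makes one selection work for all [e] at once. *)
have sel z : {r | (exists x, root (p z) x) ->
    root (p z) r /\ forall x, root (p z) x -> normc (a - r) <= normc (a - x)}.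
  apply: cid; case: (pselect (exists x, root (p z) x)) => [h|n].
    by have [r rP] := nearest_root a h; exists r.
  by exists 0.
have close e : 0 < e -> \forall z \near 0^'+,
    exists x, root (p z) x /\ normc (a - x) < e.
  move=> e0; pose k := (1 + normc (b - a) / e) ^+ D.
  have k0 : 0 < k.
    by rewrite exprn_gt0 // ltr_wpDr // divr_ge0 ?normc_ge0 // ltW.
  have c0 : 0 < normc P.[b].
    rewrite lt0r normc_ge0 andbT; apply: contra Pb => /eqP /eq0_normc ->.
    exact: eqxx.
  have d0 : 0 < normc P.[b] / (2 * k) by rewrite divr_gt0 // mulr_gt0.
  have c20 : 0 < normc P.[b] / 2 by rewrite divr_gt0.
  move: (@cvgC_horner _ _ _ a pD pP _ d0) (@cvgC_horner _ _ _ b pD pP _ c20).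
  rewrite (rootP Pa); apply: filterS2 => z; rewrite subr0 => ha hb.
  apply: contrapT => none.
  have : normc (p z).[b] <= normc (p z).[a] * k.
    apply: horner_far_roots => //; first by rewrite (leq_trans (pD z)).
    by move=> x rx; rewrite leNgt; apply/negP => lt; apply: none; exists x.
  apply/negP; rewrite -ltNge.
  have h1 : normc (p z).[a] * k < normc P.[b] / 2.
    by move: ha; rewrite invfM mulrA ltr_pdivlMr.
  have := normcD (P.[b] - (p z).[b]) (p z).[b]; rewrite subrK.
  by move: hb; rewrite -normcN opprB; lra.
exists (fun z => projT1 (sel z)); split.
  move=> e /close; apply: filterS => z [x [rx xe]].
  case: (sel z) => r rP /=; have [|_ /(_ _ rx)] := rP; first by exists x.
  by rewrite -normcN opprB => h; apply: le_lt_trans h xe.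
move: (close 1 ltr01); apply: filterS => z [x [rx xe]].
by case: (sel z) => r rP /=; have [|//] := rP; exists x.
Qed.

(** The coefficients of the quotient satisfy [q_i = p_(i+1) + r q_(i+1)]; descend from the degrees
    beyond [N], where they vanish. *)
Lemma root_quotient (p : R -> {poly C}) P r a D :
  (forall z, (size (p z) <= D)%N) ->
  pcvg p (P * ('X - a%:P)) -> cvgC r a ->
  (\forall z \near 0^'+, root (p z) (r z)) ->
  pcvg (fun z => p z %/ ('X - (r z)%:P)) P.
Proof.
move=> pD pP ra pr; set q := fun z => _.
pose N := maxn D (size P).
have big i : (N <= i)%N -> cvgC (fun z => (q z)`_i) P`_i.
  rewrite geq_max => /andP[Di Pi]; rewrite [P`_i]nth_default //.
  apply: cvgC_near (cvgC_cst 0); near=> z; rewrite nth_default //.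
  by rewrite (leq_trans _ (leq_trans (pD z) Di)) // leq_divp.
have coef (f : {poly C}) x i : (f * ('X - x%:P))`_i.+1 = f`_i - x * f`_i.+1.
  by rewrite mulrBr coefB coefMX coefMC mulrC.
suff ind k i : (N <= i + k)%N -> cvgC (fun z => (q z)`_i) P`_i.
  by move=> i; apply: (ind N); rewrite leq_addl.
elim: k i => [|k IHk] i; first by rewrite addn0; apply: big.
rewrite addnS -addSn => /IHk IH.
have -> : P`_i = (P * ('X - a%:P))`_i.+1 + a * P`_i.+1 by rewrite coef subrK.
apply: cvgC_near (cvgCD (pP i.+1) (cvgCM ra IH)).
move: pr; apply: filterS => z; rewrite -dvdp_XsubCl => /divpK pz.
by rewrite -{1}pz coef subrK.
Unshelve. all: by end_near. Qed.

(** Roots are split off one at a time and the argument continues with the quotient, so repeated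
    values among the [a i] count with multiplicity. *)
Lemma root_continuity (I : finType) (p : R -> {poly C}) (P Q : {poly C}) D
    (a : I -> C) :
  (forall z, (size (p z) <= D)%N) -> pcvg p P -> P != 0 ->
  P = Q * \prod_i ('X - (a i)%:P) ->
  exists2 r : I -> R -> C, (forall i, cvgC (r i) (a i)) &
    \forall z \near 0^'+, \prod_i ('X - (r i z)%:P) %| p z.
Proof.
pose concl (s : seq I) (p : R -> {poly C}) := exists2 r : I -> R -> C,
  (forall i, i \in s -> cvgC (r i) (a i)) &
    \forall z \near 0^'+, \prod_(i <- s) ('X - (r i z)%:P) %| p z.
suff ind s : uniq s -> forall (p : R -> {poly C}) (P : {poly C}),
    (forall z, (size (p z) <= D)%N) -> pcvg p P ->
    P != 0 -> P = Q * \prod_(i <- s) ('X - (a i)%:P) -> concl s p.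
  move=> pD pP P0 PE; have [|r ra rp] := ind _ (enum_uniq I) p P pD pP P0.
    by rewrite big_enum.
  exists r; first by move=> i; apply: ra; rewrite mem_enum.
  by apply: filterS rp => z; rewrite big_enum.
elim: s => [|i s IHs] /= => [_ {}p {}P _ _ _ _|/andP[is_ us] {}p {}P pD pP P0 PE].
  by exists (fun _ _ => 0) => //; near=> z; rewrite big_nil dvd1p.
rewrite big_cons mulrCA mulrC in PE.
have [|r [ra rp]] := root_continuity1 (a := a i) pD pP P0.
  by rewrite PE rootM root_XsubC eqxx orbT.
rewrite PE in pP; have qP := root_quotient pD pP ra rp.
have [||r' ra' rp'] := IHs us _ _ _ qP _ erefl.
- by move=> z; rewrite (leq_trans (leq_divp _ _)).
- by move: P0; rewrite PE mulf_eq0 negb_or => /andP[].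
exists (fun j => if j == i then r else r' j).
  move=> j; rewrite in_cons; case: (eqVneq j i) => [-> _|_ /=] //.
  exact: ra'.
move: rp rp'; apply: filterS2 => z; rewrite -dvdp_XsubCl => /divpK rp rp'.
rewrite big_cons eqxx mulrC -rp dvdp_mul // big_seq.
rewrite (eq_bigr (fun j => 'X - (r' j z)%:P)); first by rewrite -big_seq.
by move=> j js; case: eqVneq is_ => // <-; rewrite js.
Unshelve. all: by end_near. Qed.

End RootContinuity.

(** * Positions in Jordan chains *)

Section Selectors.
Context {R : realType}.
Local Notation C := R[i].

(** Block rows are read by left multiplication. The position is a plain number and the selector is
    [0] out of range, so the shift past the last block needs no separate case. *)
Definition bsel (r h a : nat) : 'M[C]_(h, bdim r h) :=
  \mxrow_(b < r) (if b == a :> nat then 1%:M else 0).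

Lemma bselE r h (a : 'I_r) n (A : 'M[C]_(bdim r h, n)) :
  bsel r h a *m A = submxcol (p_ := fun=> h) A a.
Proof.
rewrite -{1}(submxcolK A) mul_mxrow_mxcol (bigD1 a) //= eqxx mul1mx big1 ?addr0 //.
by move=> b /negPf; rewrite -val_eqE /= => ->; rewrite mul0mx.
Qed.

Lemma bsel_out r h a : (r <= a)%N -> bsel r h a = 0.
Proof.
move=> ra; rewrite /bsel -[RHS](mxrow0 (q_ := fun=> h)).
by apply: eq_mxrow => b; case: eqP => // ba; have := ltn_ord b; rewrite ba ltnNge ra.
Qed.

Lemma bsel_ext r h n (A B : 'M[C]_(bdim r h, n)) :
  (forall a, (a < r)%N -> bsel r h a *m A = bsel r h a *m B) -> A = B.
Proof.
by move=> AB; apply/mxcolP => a; rewrite -!bselE; apply: AB.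
Qed.

Lemma bsel_tr r h a b : (a < r)%N ->
  bsel r h a *m (bsel r h b)^T = if a == b then 1%:M else 0.
Proof.
move=> ar; rewrite (bselE (Ordinal ar)) tr_mxrow mxcolK /=.
by case: eqP => _; rewrite ?trmx1 ?trmx0.
Qed.

Lemma bsel_Theta r h (S : 'M[C]_h) a : (a.+1 < r)%N ->
  bsel r h a *m Thetamx r S = bsel r h a.+1.
Proof.
move=> ar; rewrite (bselE (Ordinal (ltnW ar))) /Thetamx mxblockEv mxcolK /=.
apply: eq_mxrow => b; case: eqP => // _.
by rewrite (ltn_eqF ar).
Qed.

Lemma bsel_Theta_last r h (S : 'M[C]_h) :
  bsel r.+1 h r *m Thetamx r.+1 S = S *m bsel r.+1 h 0.
Proof.
rewrite (bselE ord_max) /Thetamx mxblockEv mxcolK /= mul_mxrow.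
apply: eq_mxrow => b; rewrite (ltn_eqF (ltn_ord b)) eqxx /=.
by case: (_ == _); rewrite ?mulmx1 ?mulmx0.
Qed.

Lemma bsel_N r h a : (a < r)%N -> bsel r h a *m Nblock r h = bsel r h a.+1.
Proof.
move=> ar; rewrite (bselE (Ordinal ar)) /Nblock mxblockEv mxcolK /=.
by apply: eq_mxrow => b; case: eqP.
Qed.

Lemma bsel_Xdiag r h t a : (a < r)%N ->
  bsel r h a *m Xtilde_diag r h t =
  if a == 0 :> nat then 0 else tpow t (a%:R / r%:R) *: bsel r h a.
Proof.
move=> ar; rewrite (bselE (Ordinal ar)) /Xtilde_diag /mxdiag mxblockEv mxcolK /=.
case: a ar => [|a] ar /=.
  rewrite -[RHS](mxrow0 (q_ := fun=> h)); apply: eq_mxrow => b.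
  by case: ifP => // _; rewrite conform_mx_id.
rewrite -mul_scalar_mx mul_mxrow; apply: eq_mxrow => b.
rewrite -val_eqE /= eq_sym; case: ifP => _; rewrite ?mulmx1 ?mulmx0 //.
by rewrite conform_mx_id.
Qed.

End Selectors.

Section Frames.
Context {R : realType}.
Local Notation C := R[i].
Variable s : nat -> nat.

(** Given entrywise because the dimensions [s k.+1] and [s j.+1] agree only when [j = k], so an
    identity block would not be typable. *)
Definition jsel m (k a : nat) : 'M[C]_(s k.+1, pdim m s) :=
  \mxrow_(j < m) \mxrow_(b < j.+1)
     (\matrix_(x, y) ((j == k :> nat) && (b == a :> nat) && (x == y :> nat))%:R).

Lemma jselE m (k : 'I_m) a n (A : 'M[C]_(pdim m s, n)) :
  jsel m k a *m A =
  bsel k.+1 (s k.+1) a *m submxcol (p_ := fun j : 'I_m => bdim j.+1 (s j.+1)) A k.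
Proof.
rewrite -{1}(submxcolK A) mul_mxrow_mxcol (bigD1 k) //= big1 => [|j].
  rewrite addr0; congr (_ *m _); apply: eq_mxrow => b; apply/matrixP => x y.
  by rewrite !mxE eqxx /=; case: eqP; rewrite !mxE.
rewrite -val_eqE /= => jk; rewrite -[RHS](mul0mx _ (submxcol A j)).
congr (_ *m _); rewrite -[RHS](mxrow0 (q_ := fun=> s j.+1)).
by apply: eq_mxrow => b; apply/matrixP => x y; rewrite !mxE (negPf jk).
Qed.

Lemma jsel_out m k a : (k < a)%N -> jsel m k a = 0.
Proof.
move=> ka; rewrite -[RHS](mxrow0 (q_ := fun j : 'I_m => bdim j.+1 (s j.+1))).
apply: eq_mxrow => j; rewrite -[RHS](mxrow0 (q_ := fun=> s j.+1)).
apply: eq_mxrow => b; apply/matrixP => x y; rewrite !mxE.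
by case: eqP => //= jk; case: eqP => //= ba; have := ltn_ord b; lia.
Qed.

(* [e k a] selects the rows of position [a] in the Jordan blocks of size
   [k.+1]. *)
Record jframe (m p : nat) (N : 'M[C]_p)
    (e : forall k a : nat, 'M[C]_(s k.+1, p)) : Prop := JFrame {
  jframe_id : forall k a, (k < m)%N -> (a <= k)%N -> e k a *m (e k a)^T = 1%:M;
  jframe_ortho : forall k a l b, (k != l) || (a != b) -> e k a *m (e l b)^T = 0;
  jframe_out : forall k a, (k < a)%N -> e k a = 0;
  jframe_sum : \sum_(k < m) \sum_(a < k.+1) (e k a)^T *m e k a = 1%:M;
  jframe_N : forall k a, (k < m)%N -> e k a *m N = e k a.+1 }.

Section Theory.
Variables (m p : nat) (N : 'M[C]_p) (e : forall k a : nat, 'M[C]_(s k.+1, p)).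
Hypothesis fr : jframe m N e.

Lemma jframe_ext n (A B : 'M[C]_(p, n)) :
  (forall k a, (k < m)%N -> (a <= k)%N -> e k a *m A = e k a *m B) -> A = B.
Proof.
move=> AB; rewrite -[A]mul1mx -[B]mul1mx -(jframe_sum fr) !mulmx_suml.
apply: eq_bigr => k _; rewrite !mulmx_suml; apply: eq_bigr => a _.
by rewrite -!mulmxA AB // -ltnS.
Qed.

Definition assemble n (y : forall k a : nat, 'M[C]_(s k.+1, n)) : 'M[C]_(p, n) :=
  \sum_(k < m) \sum_(a < k.+1) (e k a)^T *m y k a.

Lemma assembleE n (y : forall k a : nat, 'M[C]_(s k.+1, n)) k a :
  (k < m)%N -> (a <= k)%N -> e k a *m assemble y = y k a.
Proof.
move=> km ak; rewrite /assemble mulmx_sumr (bigD1 (Ordinal km)) //=.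
rewrite mulmx_sumr (bigD1 (Ordinal (ak : (a < k.+1)%N))) //= mulmxA (jframe_id fr) //.
rewrite mul1mx big1 => [|b]; last first.
  by rewrite -val_eqE /= mulmxA => ab; rewrite (jframe_ortho fr) ?mul0mx // eq_sym ab orbT.
rewrite addr0 big1 ?addr0 // => l; rewrite -val_eqE /= => kl.
rewrite mulmx_sumr big1 // => b _; rewrite mulmxA (jframe_ortho fr) ?mul0mx //.
by rewrite eq_sym kl.
Qed.

Definition fdiag (phi : nat -> nat -> C) : 'M[C]_p :=
  \sum_(k < m) \sum_(a < k.+1) phi k a *: ((e k a)^T *m e k a).

Lemma fdiagE phi k a : (k < m)%N -> (a <= k)%N ->
  e k a *m fdiag phi = phi k a *: e k a.
Proof.
move=> km ak; have -> : fdiag phi = assemble (fun k a => phi k a *: e k a).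
  by do 2!apply: eq_bigr => ? _; rewrite scalemxAr.
by rewrite assembleE.
Qed.

Lemma fdiagEmx phi k a n (A : 'M[C]_(p, n)) : (k < m)%N -> (a <= k)%N ->
  e k a *m (fdiag phi *m A) = phi k a *: (e k a *m A).
Proof. by move=> km ak; rewrite mulmxA fdiagE // scalemxAl. Qed.

Lemma fdiag1 phi : (forall k a, (k < m)%N -> (a <= k)%N -> phi k a = 1) ->
  fdiag phi = 1%:M.
Proof.
move=> phi1; apply: jframe_ext => k a km ak.
by rewrite fdiagE // phi1 // scale1r mulmx1.
Qed.

Lemma fdiagM phi psi : fdiag phi *m fdiag psi = fdiag (fun k a => phi k a * psi k a).
Proof.
apply: jframe_ext => k a km ak.
by rewrite fdiagEmx // !fdiagE // scalerA.
Qed.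

Lemma fdiag_eq phi psi :
  (forall k a, (k < m)%N -> (a <= k)%N -> phi k a = psi k a) ->
  fdiag phi = fdiag psi.
Proof.
by move=> pp; apply: jframe_ext => k a km ak; rewrite !fdiagE // pp.
Qed.

Lemma fdiagN phi psi :
  (forall k a, (k < m)%N -> (a < k)%N -> phi k a.+1 = psi k a) ->
  N *m fdiag phi = fdiag psi *m N.
Proof.
move=> pp; apply: jframe_ext => k a km ak.
rewrite fdiagEmx // mulmxA (jframe_N fr) //.
move: ak; rewrite leq_eqVlt => /predU1P[->|ak].
  by rewrite (jframe_out fr) // mul0mx scaler0.
by rewrite fdiagE // pp.
Qed.

Lemma jframe_N_tr k a : (k < m)%N -> (a <= k)%N ->
  e k a *m N^T = if a == 0 then 0 else e k a.-1.
Proof.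
move=> km ak; apply: trmx_inj; rewrite trmx_mul trmxK.
apply: jframe_ext => l b lm bl; rewrite mulmxA (jframe_N fr) //.
case: a ak => [|a] ak /=.
  rewrite trmx0 mulmx0 (jframe_ortho fr) //; exact: orbT.
have [lk|lk] := eqVneq l k; last by rewrite !(jframe_ortho fr) ?lk.
subst l; have [ba|ba] := eqVneq b a; first subst b.
  by rewrite !(jframe_id fr).
by rewrite !(jframe_ortho fr) ?eqSS ?ba ?orbT.
Qed.

(** Transposing [N] reverses its chains, so the second subspace can reuse the whole construction.
    The guard is there because [k - a] truncates to [0] past the end, where a frame must vanish. *)
Lemma jframe_rev :
  jframe m N^T (fun k a => if (a <= k)%N then e k (k - a) else 0).
Proof.
split=> [k a km ak|k a l b h|k a ka||k a km].
- by rewrite ak (jframe_id fr) // leq_subr.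
- case: ifP => ak; last by rewrite mul0mx.
  case: ifP => bl; last by rewrite trmx0 mulmx0.
  rewrite (jframe_ortho fr) //; have [kl /=|] //= := eqVneq k l.
  by move: h; rewrite kl eqxx /= in ak *; lia.
- by rewrite leqNgt ka.
- rewrite -(jframe_sum fr); apply: eq_bigr => k _.
  rewrite [RHS](reindex_inj rev_ord_inj) /=; apply: eq_bigr => a _.
  by rewrite -ltnS ltn_ord /= subSS.
- case: (leqP a k) => ak; last by rewrite mul0mx leqNgt ltnW.
  rewrite jframe_N_tr ?leq_subr // subn_eq0 leqNgt.
  case: ltnP => // ak'; congr e; lia.
Qed.

End Theory.

Lemma jframe_jsel m : jframe m (Nmx m s) (jsel m).
Proof.
have E1 (k l : 'I_m) a b : (a <= k)%N ->
    jsel m k a *m (jsel m l b)^T =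
    \matrix_(x, y) ((l == k :> nat) && (a == b) && (x == y :> nat))%:R.
  move=> ak; rewrite jselE tr_mxrow mxcolK (bselE (Ordinal (ak : (a < k.+1)%N))).
  rewrite tr_mxrow mxcolK; apply/matrixP => x y; rewrite !mxE /=.
  by rewrite [k == l :> nat]eq_sym [y == x :> nat]eq_sym.
have sel0 k a : (m <= k)%N -> jsel m k a = 0.
  move=> mk; rewrite -[RHS](mxrow0 (q_ := fun j : 'I_m => bdim j.+1 (s j.+1))).
  apply: eq_mxrow => j; rewrite -[RHS](mxrow0 (q_ := fun=> s j.+1)).
  apply: eq_mxrow => b; apply/matrixP => x y; rewrite !mxE.
  by rewrite (ltn_eqF (leq_trans (ltn_ord j) mk)).
have id k a : (k < m)%N -> (a <= k)%N -> jsel m k a *m (jsel m k a)^T = 1%:M.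
  move=> km ak; rewrite (E1 (Ordinal km) (Ordinal km)) //.
  by apply/matrixP => x y; rewrite !mxE !eqxx.
have ortho k a l b : (k != l) || (a != b) -> jsel m k a *m (jsel m l b)^T = 0.
  move=> h; case: (ltnP k m) => km; last by rewrite sel0 // mul0mx.
  case: (ltnP l m) => lm; last by rewrite (sel0 l) // trmx0 mulmx0.
  case: (leqP a k) => ak; last by rewrite jsel_out // mul0mx.
  rewrite (E1 (Ordinal km) (Ordinal lm)) //=.
  apply/matrixP => x y; rewrite !mxE [l == k]eq_sym.
  by move: h; case: eqP; case: eqP.
split=> //.
- by move=> k a; apply: jsel_out.
- apply/mxcolP => k; apply: bsel_ext => a ak; rewrite -!jselE mulmx1.
  rewrite mulmx_sumr (bigD1 k) //= mulmx_sumr (bigD1 (Ordinal ak)) //=.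
  rewrite mulmxA id // mul1mx big1 => [|b]; last first.
    by rewrite -val_eqE /= mulmxA => ab; rewrite ortho ?mul0mx // eq_sym ab orbT.
  rewrite addr0 big1 ?addr0 // => l; rewrite -val_eqE /= => kl.
  by rewrite mulmx_sumr big1 // => b _; rewrite mulmxA ortho ?mul0mx // eq_sym kl.
- move=> k a km; rewrite (jselE (Ordinal km)).
  rewrite /Nmx /mxdiag mxblockEv mxcolK mul_mxrow; apply: eq_mxrow => j.
  case: eqVneq => [<-|kj]; last first.
    rewrite mulmx0 -[LHS](mxrow0 (q_ := fun=> s j.+1)).
    apply: eq_mxrow => b; apply/matrixP => x y; rewrite !mxE.
    by rewrite eq_sym (negPf (kj : k != j :> nat)).
  rewrite conform_mx_id /=; case: (leqP a k) => ak; last first.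
    rewrite bsel_out // mul0mx -[LHS](mxrow0 (q_ := fun=> s k.+1)).
    apply: eq_mxrow => b; apply/matrixP => x y; rewrite !mxE eqxx /=.
    by rewrite (ltn_eqF (leq_trans (ltn_ord b) (leqW ak))).
  rewrite bsel_N //; apply: eq_mxrow => b; apply/matrixP => x y.
  by rewrite !mxE eqxx /=; case: eqP; rewrite !mxE.
Qed.

End Frames.

(** * Characteristic polynomials *)

Section CharPoly.

(** Two Schur complements of one block matrix. Division is avoided because [c] will be a power of
    ['X] in a polynomial ring. *)
Lemma det_Sylvester (A : comNzRingType) d q (c : A) (U : 'M[A]_(d, q)) (W : 'M[A]_(q, d)) :
  \det (c%:M - U *m W) * c ^+ q = c ^+ d * \det (c%:M - W *m U).
Proof.
pose Z := block_mx c%:M U W (1%:M : 'M[A]_q).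
have -> : \det (c%:M - U *m W) = \det Z.
  have := det_mulmx Z (block_mx 1%:M 0 (- W) 1%:M).
  rewrite det_lblock !det1 !mulr1 => <-.
  by rewrite mulmx_block !mulmx1 !mulmx0 !add0r mul1mx subrr mulmxN det_ublock det1 mulr1.
have := det_mulmx (block_mx 1%:M 0 (- W) c%:M) Z.
rewrite det_lblock det1 mul1r det_scalar mulrC => <-.
rewrite mulmx_block !mul1mx !mul0mx !addr0 mulmx1 mul_mx_scalar mul_scalar_mx.
by rewrite scalerN addNr mulNmx addrC det_ublock det_scalar.
Qed.

(** The matrix [1 - P (1 - W) P'] acts as [W] on the range of [P] and has determinant [\det W] by
    [det_Sylvester]. It splits off [Z] as a right factor, without completing [P] to a basis. *)
Lemma char_poly_intertwine (F : fieldType) d q (A : 'M[F]_d) (B : 'M[F]_q)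
    (X : 'M[F]_(d, q)) (Q : 'M[F]_(q, d)) :
  Q *m X = 1%:M -> A *m X = X *m B -> char_poly B %| char_poly A.
Proof.
move=> QX AX; pose P := map_mx (@polyC F) X; pose P' := map_mx (@polyC F) Q.
have PP : P' *m P = 1%:M by rewrite -map_mxM QX map_mx1.
pose Z := char_poly_mx A; pose W := char_poly_mx B.
have ZP : Z *m P = P *m W.
  rewrite /Z /W /char_poly_mx mulmxBl mulmxBr -!map_mxM AX.
  by rewrite mul_scalar_mx mul_mx_scalar.
rewrite -[char_poly A]/(\det Z) -[char_poly B]/(\det W).
clearbody P P' Z W.
have -> : \det Z = \det (Z - Z *m P *m P' + P *m P') * \det W.
  have -> : \det W = \det (1%:M - P *m ((1%:M - W) *m P')).
    have := det_Sylvester 1 P ((1%:M - W) *m P').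
    rewrite !expr1n mulr1 mul1r => ->.
    by rewrite -mulmxA PP mulmx1 opprB addrC subrK.
  rewrite -det_mulmx; congr (\det _).
  have E : (Z - Z *m P *m P' + P *m P') *m P = P.
    by rewrite mulmxDl mulmxBl -!mulmxA PP !mulmx1 subrr add0r.
  rewrite mulmxBr mulmx1 [_ *m (P *m _)]mulmxA E mulmxBl mul1mx mulmxBr.
  by rewrite [P *m (W *m _)]mulmxA -ZP opprB addrCA addrK addrC subrK.
exact: dvdp_mull.
Qed.

Lemma char_poly_tr (F : comNzRingType) d (A : 'M[F]_d) : char_poly A^T = char_poly A.
Proof.
rewrite /char_poly -[RHS]det_tr; congr (\det _).
by rewrite /char_poly_mx linearB /= tr_scalar_mx map_trmx.
Qed.

Lemma char_poly_intertwiner (F : fieldType) d q (A : 'M[F]_d) (B : 'M[F]_q)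
    (X : 'M[F]_(d, q)) (Q : 'M[F]_(q, d)) :
  Q *m X = 1%:M -> Q *m A = B *m Q -> char_poly B %| char_poly A.
Proof.
move=> QX QA; rewrite -(char_poly_tr A) -(char_poly_tr B).
apply: (@char_poly_intertwine _ _ _ _ _ Q^T X^T).
  by rewrite -trmx_mul QX trmx1.
by rewrite -!trmx_mul QA.
Qed.

Lemma char_poly_affine (F : fieldType) q (A : 'M[F]_q) (b z : F) : z != 0 ->
  char_poly (b%:M + z *: A) = (z ^+ q)%:P * (char_poly A \Po (z^-1 *: ('X - b%:P))).
Proof.
move=> z0; rewrite /char_poly; set g := z^-1 *: _.
have -> : \det (char_poly_mx A) \Po g = \det (map_mx (comp_poly g) (char_poly_mx A)).
  by rewrite det_map_mx.
rewrite polyC_exp -detZ; congr (\det _); apply/matrixP => i j.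
rewrite !mxE comp_polyB comp_polyC raddfMn /= comp_polyX mulrBr mulrnAr.
have -> : z%:P * g = 'X - b%:P by rewrite /g mul_polyC scalerA divff // scale1r.
rewrite polyCD polyCM mulrnBl opprD addrA; congr (_ - _ - _).
by case: (i == j).
Qed.

Variable R : realType.
Local Notation C := R[i].

(** [Thetamx] is the nilpotent shift plus a corner of rank at most [h]. The block column [u] is, up
    to the factor [c], the resolvent of the shift applied to the last block, and [det_Sylvester]
    reduces the determinant to size [h]. *)
Lemma char_poly_Theta r h (S : 'M[C]_h) :
  char_poly (Thetamx r.+1 S) = char_poly S \Po 'X^(r.+1).
Proof.
set T := Thetamx _ _; pose f a := map_mx (@polyC C) (bsel r.+1 h a).
pose u := \sum_(a < r.+1) 'X^a *: (f a)^T.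
pose c : {poly C} := 'X^(r.+1).
pose S' := map_mx (@polyC C) S.
pose N' := map_mx (@polyC C) (Nblock (R := R) r.+1 h).
have TE : T = Nblock r.+1 h + (bsel r.+1 h r)^T *m (S *m bsel r.+1 h 0).
  apply: bsel_ext => a; rewrite ltnS leq_eqVlt => /predU1P[->|ar].
    rewrite bsel_Theta_last mulmxDr bsel_N // (@bsel_out _ _ _ r.+1) // add0r mulmxA.
    by rewrite bsel_tr // eqxx mul1mx.
  have ar' : (a < r.+1)%N by apply: ltnW.
  rewrite bsel_Theta // mulmxDr bsel_N //.
  by rewrite [bsel _ _ a *m (_ *m _)]mulmxA bsel_tr // (ltn_eqF ar) mul0mx addr0.
have fu : f 0 *m u = 1%:M.
  rewrite /u mulmx_sumr (bigD1 ord0) //= expr0 scale1r /f map_trmx -map_mxM.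
  rewrite bsel_tr // map_mx1 big1 ?addr0 // => a a0.
  rewrite -scalemxAr map_trmx -map_mxM bsel_tr // eq_sym.
  by rewrite (negPf (a0 : nat_of_ord a != 0)) map_mx0 scaler0.
have NT a : (a < r.+1)%N ->
    N' *m (f a)^T = if a == 0 then 0 else (f a.-1)^T.
  move=> ar; rewrite map_trmx -map_mxM.
  have -> : Nblock r.+1 h *m (bsel r.+1 h a)^T =
      if a == 0 then 0 else (bsel r.+1 h a.-1)^T :> 'M[C]__.
    apply: bsel_ext => b br; rewrite mulmxA bsel_N //.
    have [br'|br'] := ltnP b.+1 r.+1; last first.
      rewrite (@bsel_out _ _ _ b.+1) // mul0mx; case: a ar => [|a] ar; rewrite ?mulmx0 //=.
      by rewrite bsel_tr //; case: eqP => // ba; lia.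
    rewrite bsel_tr //; case: a ar => [|a] ar; rewrite ?mulmx0 //=.
    by rewrite bsel_tr.
  by case: (a == 0); rewrite ?map_mx0 ?map_trmx.
have XNu : ('X%:M - N') *m u = c *: (f r)^T.
  rewrite mulmxBl mul_scalar_mx /u.
  rewrite scaler_sumr big_ord_recr /= -[X in _ - X]/(N' *m _) mulmx_sumr.
  rewrite big_ord_recl /= -scalemxAr NT // scaler0 add0r scalerA -exprS.
  rewrite addrAC -[RHS]add0r; congr (_ + _); rewrite -sumrB big1 // => a _.
  rewrite -scalemxAr NT /=; last by have := ltn_ord a; rewrite /bump; lia.
  by rewrite add0n [bump 0 a]add1n exprS -scalerA subrr.
(* The factor [c] clears the denominators of the resolvent; its powers are cancelled at the end. *)
have key : c *: char_poly_mx T = ('X%:M - N') *m (c%:M - u *m (S' *m f 0)).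
  rewrite mulmxBr [_ *m (u *m _)]mulmxA XNu mul_mx_scalar -scalemxAl -scalerBr; congr (_ *: _).
  rewrite /char_poly_mx TE raddfD /= opprD addrA; congr (_ - _).
  by rewrite !map_mxM map_trmx.
have detN : \det ('X%:M - N') = 'X ^+ bdim r.+1 h.
  have := @char_poly_trig _ _ (Nblock (R := R) r.+1 h)^T.
  rewrite char_poly_tr /char_poly /char_poly_mx -/N' => ->; last first.
    rewrite /Nblock tr_mxblock; apply/is_trig_mxblockP; split=> [i j ij|i].
      by case: eqP => [E|_]; [lia | rewrite trmx0].
    case: eqP => [E|_]; first lia.
    by rewrite trmx0; apply/is_trig_mxP => *; rewrite mxE.
  rewrite (eq_bigr (fun=> 'X)) ?prodr_const ?card_ord // => i _.
  rewrite /Nblock !mxE; set k := tagnat.sig1 _.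
  by case: eqP => [E|_]; [lia | rewrite mxE subr0].
have := congr1 determinant key.
rewrite detZ det_mulmx detN => E.
have := det_Sylvester c u (S' *m f 0); rewrite -mulmxA fu mulmx1 => E2.
have dim : bdim r.+1 h = (r.+1 * h)%N by rewrite /bdim sum_nat_const card_ord.
have cX : c ^+ h = 'X ^+ bdim r.+1 h by rewrite /c -exprM dim.
have : (c ^+ bdim r.+1 h * c ^+ h) * \det (char_poly_mx T) =
   (c ^+ bdim r.+1 h * c ^+ h) * \det (c%:M - S').
  transitivity ('X ^+ bdim r.+1 h * (\det (c%:M - u *m (S' *m f 0)) * c ^+ h)).
    by rewrite mulrA -E mulrAC.
  by rewrite E2 cX mulrA [_ * c ^+ _]mulrC.
move=> /mulfI detE; rewrite /char_poly detE; last first.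
  by rewrite mulf_neq0 // expf_neq0 // expf_neq0 // polyX_eq0.
rewrite -[RHS](det_map_mx (comp_poly c)); congr (\det _).
apply/matrixP => i j; rewrite !mxE.
by rewrite [RHS]raddfB /= raddfMn /= comp_polyX comp_polyC.
Qed.

End CharPoly.

(** * Scaling of the perturbed Jordan form *)

Section Weights.
Variable rho : nat.

(* In the [a]-th position of a chain of length [k.+1] the expansion starts with
   [z ^ wgt k a] and the equation is divided by [z ^ rwgt k a]; these powers
   balance [N], [z] and [z ^ rho.+1 *: M] as [z] tends to [0]. *)
Definition wgt (k a : nat) : nat :=
  if (k < rho)%N then (rho - k + a)%N else minn a rho.+1.
Definition rwgt (k a : nat) : nat := minn (wgt k a).+1 rho.+1.

Lemma wgt_le k a : (a <= k)%N -> (wgt k a <= rho.+1)%N.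
Proof. rewrite /wgt; case: ifP; lia. Qed.

Lemma wgtS k a : (a < k)%N -> wgt k a.+1 = rwgt k a.
Proof. rewrite /rwgt /wgt; case: ifP; lia. Qed.

Lemma wgt_eq0 k a : (wgt k a == 0) = (a == 0) && (rho <= k)%N.
Proof. rewrite /wgt; case: ifP; lia. Qed.

Lemma wgt_lt k a : (k <= rho)%N -> (a <= k)%N -> (wgt k a <= rho)%N.
Proof. rewrite /wgt; case: ifP; lia. Qed.

(** At a chain end the term [z mu] has exponent [wgt rho k k + 1]. Up to length [rho.+1] this is the
    exponent of [z ^ rho.+1 *: M], and the two balance; on longer chains it is larger, and [M]
    stands alone in the limit. *)
Lemma wgt_last k : (rho < k)%N -> wgt k k = rho.+1.
Proof. rewrite /wgt; case: ifP; lia. Qed.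

Lemma wgt_diag k : (k <= rho)%N -> wgt k k = rho.
Proof. rewrite /wgt; case: ifP; lia. Qed.

End Weights.

Section Graded.
Context {R : realType}.
Local Notation C := R[i].

Lemma bigOz_block a b (F : R -> 'M[C]_a) (G : R -> 'M[C]_b) i :
  bigOz F i -> bigOz G i -> bigOz (fun z => block_mx (F z) 0 0 (G z)) i.
Proof.
move=> [f f0 Ff] [g g0 Gg]; exists (f + g); first exact: addr_ge0.
move: Ff Gg; apply: filterS2 => z Ff Gg; rewrite mulrDl.
apply: le_trans (lerD Ff Gg); rewrite /mnorm big_split_ord /=; apply: lerD.
  apply: ler_sum => j _; rewrite big_split_ord /= [X in _ + X]big1 => [|l _].
    by rewrite addr0; apply: ler_sum => l _; rewrite block_mxEul.
  by rewrite block_mxEur mxE normc0.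
apply: ler_sum => j _; rewrite big_split_ord /= [X in X + _]big1 => [|l _].
  by rewrite add0r; apply: ler_sum => l _; rewrite block_mxEdr.
by rewrite block_mxEdl mxE normc0.
Qed.

Lemma normcR (x : R) : normc (x%:C) = `|x|.
Proof. by rewrite /= expr0n /= addr0 sqrtr_sqr. Qed.

Lemma bigOz_pow a b k (A : 'M[C]_(a, b)) : bigOz (fun z => z%:C ^+ k *: A) k.
Proof.
exists (mnorm A); first exact: mnorm_ge0.
apply: filterS (near_z1 (R := R)) => z [z0 _].
by rewrite mnormZ -rmorphXn normcR ger0_norm ?exprn_ge0 ?(ltW z0) // mulrC.
Qed.

Lemma bigOz_0 a b i : bigOz (fun=> 0 : 'M[C]_(a, b)) i.
Proof.
exists 0 => //; apply: filterS (near_z1 (R := R)) => z _.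
by rewrite mnorm0 mul0r.
Qed.

Lemma bigOz_pow0 a b k (A : 'M[C]_(a, b)) :
  bigOz (fun z => (z%:C ^+ k - (0 : R)%:C ^+ k) *: A) 1.
Proof.
case: k => [|k].
  apply: bigOz_near (bigOz_0 _ _ _); apply: filterS (near_z1 (R := R)) => z _.
  by rewrite !expr0 subrr scale0r.
apply: (@bigOzW _ _ _ _ k.+1) => //; apply: bigOz_near (bigOz_pow _ A).
by apply: filterS (near_z1 (R := R)) => z _; rewrite rmorph0 expr0n subr0.
Qed.

Lemma bigOz_sum (I : Type) (t : seq I) a b (F : I -> R -> 'M[C]_(a, b)) i :
  (forall j, bigOz (F j) i) -> bigOz (fun z => \sum_(j <- t) F j z) i.
Proof.
move=> Fi; elim: t => [|j t IH].
  apply: bigOz_near (bigOz_0 _ _ _); apply: filterS (near_z1 (R := R)) => z _.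
  by rewrite big_nil.
apply: bigOz_near (bigOzD (Fi j) IH); apply: filterS (near_z1 (R := R)) => z _.
by rewrite big_cons.
Qed.

Variables (s : nat -> nat) (m p c : nat) (N : 'M[C]_p).
Variable e : forall k a : nat, 'M[C]_(s k.+1, p).
Hypothesis fr : jframe m N e.
Variables (rho : nat) (B : 'M[C]_c) (M : 'M[C]_(p + c)).

Local Notation r := rho.+1.
Local Notation w := (wgt rho).
Local Notation x := (rwgt rho).
Local Notation Dg := (fdiag m e).
Local Notation M11 := (ulsubmx M).

(** Since [0 ^+ 0 = 1], at [z = 0] this is the projection onto the positions with exponent [0]. *)
Definition gradmx (phi : nat -> nat -> nat) (n : nat) (z : R) : 'M[C]_(p + c) :=
  block_mx (Dg (fun k a => z%:C ^+ phi k a)) 0 0 (z%:C ^+ n)%:M.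

Lemma gradmxM phi psi i j z :
  gradmx phi i z *m gradmx psi j z =
  gradmx (fun k a => phi k a + psi k a)%N (i + j) z.
Proof.
rewrite /gradmx mulmx_block !mulmx0 !mul0mx !addr0 add0r (fdiagM fr).
rewrite -scalar_mxM -exprD; congr (block_mx _ _ _ _).
by apply: (fdiag_eq fr) => k a _ _; rewrite exprD.
Qed.

Lemma gradmx_eq phi psi i j z : i = j ->
  (forall k a, (k < m)%N -> (a <= k)%N -> phi k a = psi k a) ->
  gradmx phi i z = gradmx psi j z.
Proof.
move=> -> pp; congr (block_mx _ _ _ _).
by apply: (fdiag_eq fr) => k a km ak; rewrite pp.
Qed.

Lemma gradmx_cst n z : gradmx (fun _ _ => n) n z = (z%:C ^+ n)%:M.
Proof.
rewrite /gradmx; have -> : Dg (fun _ _ => z%:C ^+ n) = (z%:C ^+ n)%:M.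
  apply: (jframe_ext fr) => k a km ak.
  by rewrite (fdiagE fr) // mul_mx_scalar.
by rewrite -scalar_mx_block.
Qed.

Lemma bigOz_gradmx phi i : bigOz (fun z => gradmx phi i z - gradmx phi i 0) 1.
Proof.
have h : bigOz (fun z => block_mx
   (\sum_(k < m) \sum_(a < k.+1)
      (z%:C ^+ phi k a - (0 : R)%:C ^+ phi k a) *: ((e k a)^T *m e k a)) 0 0
   ((z%:C ^+ i - (0 : R)%:C ^+ i) *: (1%:M : 'M[C]_c))) 1.
  apply: bigOz_block; last exact: bigOz_pow0.
  by do 2![apply: bigOz_sum => ?]; apply: bigOz_pow0.
apply: bigOz_near h; apply: filterS (near_z1 (R := R)) => z _.
rewrite /gradmx opp_block_mx add_block_mx !subr0; congr (block_mx _ _ _ _).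
  rewrite /fdiag -sumrB; apply: eq_bigr => k _; rewrite -sumrB.
  by apply: eq_bigr => a _; rewrite scalerBl.
by rewrite scalerBl !scalemx1.
Qed.

(* The pencil [diag(N, B) + z ^ r M - z mu] after the change of scale: it is
   polynomial in [z] and keeps a solvable limit at [z = 0]. *)
Definition Amx z : 'M[C]_(p + c) := block_mx N 0 0 B +
  gradmx (fun k a => r - x k a)%N 0 z *m M *m gradmx w r z.
Definition Kmx z : 'M[C]_(p + c) := gradmx (fun k a => (w k a).+1 - x k a)%N 1 z.

Lemma Amx_scale z :
  (block_mx N 0 0 B + z%:C ^+ r *: M) *m gradmx w r z = gradmx x r z *m Amx z.
Proof.
rewrite /Amx mulmxDl mulmxDr; congr (_ + _).
  rewrite /gradmx !mulmx_block !mulmx0 !mul0mx !addr0 !add0r.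
  rewrite mul_mx_scalar mul_scalar_mx; congr (block_mx _ _ _ _).
  by apply: (fdiagN fr) => k a km ak; rewrite wgtS.
rewrite !mulmxA gradmxM -mul_scalar_mx -gradmx_cst; congr (_ *m _ *m _).
apply: gradmx_eq; first by rewrite addn0.
by move=> k a km ak; rewrite subnKC // geq_minr.
Qed.

Lemma Kmx_scale z : z%:C *: gradmx w r z = gradmx x r z *m Kmx z.
Proof.
have := gradmx_cst 1 z; rewrite expr1 => E.
rewrite -mul_scalar_mx -E /Kmx !gradmxM; apply: gradmx_eq; first by rewrite addnC.
by move=> k a km ak; rewrite subnKC ?geq_minl.
Qed.

(** Only coordinates of weight [0] meet [M] in the limit; those of the complement, of weight [r],
    drop out. *)
Lemma Amx0E n (y1 : 'M[C]_(p, n)) (y2 : 'M[C]_(c, n)) :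
  let v := Dg (fun k a => (0 : R)%:C ^+ w k a) *m y1 in
  Amx 0 *m col_mx y1 y2 =
  col_mx (N *m y1 + Dg (fun k a => (0 : R)%:C ^+ (r - x k a)) *m (M11 *m v))
         (B *m y2 + dlsubmx M *m v).
Proof.
move=> v; rewrite /Amx mulmxDl mul_block_col !mul0mx addr0 add0r.
rewrite -!mulmxA /gradmx [block_mx _ 0 0 ((0 : R)%:C ^+ r)%:M *m _]mul_block_col.
rewrite -/v [(0 : R)%:C ^+ r]exprS !mul0r !raddf0 !mul0mx !addr0.
rewrite -{1}(submxK M) !mul_block_col !mulmx0 !mul0mx !addr0 add0r expr0 mul1mx.
by rewrite add_col_mx.
Qed.

End Graded.

(** * The limit pencil at [z = 0] under an abstract normalisation *)

Section GradedDeflation.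
Context {R : realType}.
Local Notation C := R[i].
Variables (s : nat -> nat) (m p c : nat) (N : 'M[C]_p).
Variable e : forall k a : nat, 'M[C]_(s k.+1, p).
Hypothesis fr : jframe m N e.
Variables (rho : nat) (B : 'M[C]_c) (M : 'M[C]_(p + c)).

Local Notation r := rho.+1.
Local Notation w := (wgt rho).
Local Notation x := (rwgt rho).
Local Notation Dg := (fdiag m e).
Local Notation M11 := (ulsubmx M).

Variables (q : nat) (Th : 'M[C]_q) (g : 'M[C]_(p, s r)) (f0 : 'M[C]_(s r, q)).
Variables (y : forall k a : nat, 'M[C]_(s k.+1, q)).
Variables (Q : 'M[C]_(q, p)) (Qt : 'M[C]_(p, q)).

Hypotheses (rho_m : (rho < m)%N) (B_unit : B \in unitmx).
Hypothesis g_supp : forall k a, (k < m)%N -> (a <= k)%N ->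
  (a != 0) || (k < rho)%N -> e k a *m g = 0.
Hypothesis g_rho : e rho 0 *m g = 1%:M.
Hypothesis g_ker : forall k, (rho < k)%N -> (k < m)%N ->
  e k k *m (M11 *m g) = 0.
Hypothesis ker_uniq : forall v : 'M[C]_(p, q),
  (forall k a, (k < m)%N -> (a <= k)%N ->
     (a != 0) || (k <= rho)%N -> e k a *m v = 0) ->
  (forall k, (rho < k)%N -> (k < m)%N -> e k k *m (M11 *m v) = 0) -> v = 0.
Hypothesis y_rho : y rho 0 = f0.
Hypothesis yS : forall k a, (k <= rho)%N -> (a < k)%N -> y k a *m Th = y k a.+1.
Hypothesis y_last : forall k, (k <= rho)%N ->
  y k k *m Th = e k k *m (M11 *m (g *m f0)).
Hypothesis QQt : Q *m Qt = 1%:M.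
Hypothesis Q_supp : forall n (Y : 'M[C]_(p, n)),
  (forall k a, (k <= rho)%N -> (a <= k)%N -> e k a *m Y = 0) -> Q *m Y = 0.
Hypothesis Q_N : forall Y : 'M[C]_(p, q), Q *m Y = 0 -> Q *m (N *m Y) = 0.
Hypothesis Q_rho : forall Y : 'M[C]_(p, q), Q *m Y = 0 -> e rho 0 *m Y = 0.
Hypothesis Q_y : forall Y : 'M[C]_(p, q),
  (forall k a, (k <= rho)%N -> (a <= k)%N -> e k a *m Y = y k a) ->
  Q *m Y = 1%:M.
(** The two normalisations differ here: either [Q] already fixes the tops of the chains shorter than
    [r], or [Th] can be cancelled on the right and zero is propagated back from their ends. *)
Hypothesis Q_inj : forall k, (k < rho)%N ->
  (forall Y : 'M[C]_(p, q), Q *m Y = 0 -> e k 0 *m Y = 0) \/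
  (forall Z : 'M[C]_(s k.+1, q), Z *m Th = 0 -> Z = 0).

Let u := g *m f0.

(** Row [(k, a)] of the limit equation, solved for position [a.+1]. The two tests are the values at
    [z = 0] of the powers of [z] with exponents [(w k a).+1 - x k a] and [r - x k a]. *)
Fixpoint limit_row (k a : nat) : 'M[C]_(s k.+1, q) :=
  if a is a'.+1 then
    (if (w k a' < r)%N then limit_row k a' *m Th else 0) -
    (if x k a' == r then e k a' *m (M11 *m u) else 0)
  else if (k <= rho)%N then y k 0 else e k 0 *m u.

Let limit_rowS k a : limit_row k a.+1 =
    (if (w k a < r)%N then limit_row k a *m Th else 0) -
    (if x k a == r then e k a *m (M11 *m u) else 0).
Proof. by []. Qed.

Let xw k a : (k <= rho)%N -> (a <= k)%N -> x k a = (w k a).+1.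
Proof. by move=> kr ak; have := wgt_lt kr ak; rewrite /rwgt; lia. Qed.

Let limit_row_y k a : (k <= rho)%N -> (a <= k)%N -> limit_row k a = y k a.
Proof.
move=> kr; elim: a => [|a IHa] ak; first by rewrite /= kr.
have wa : (w k a <= rho)%N by apply: wgt_lt => //; apply: ltnW.
have xa : x k a != r by rewrite -wgtS //; have := wgt_lt kr ak; lia.
rewrite limit_rowS IHa ?(ltnW ak) // ifT // (negPf xa).
by rewrite subr0 yS.
Qed.

Let Y1 := assemble m e limit_row.
Let Y0 := col_mx Y1 (- (invmx B *m (dlsubmx M *m u))).

Let expr0C k : (0 : R)%:C ^+ k = (k == 0%N)%:R :> C.
Proof. by rewrite raddf0 expr0n. Qed.

Let proj_Y1 : Dg (fun k a => (0 : R)%:C ^+ w k a) *m Y1 = u.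
Proof.
apply: (jframe_ext fr) => k a km ak.
rewrite (fdiagEmx fr) // expr0C (assembleE fr) // wgt_eq0.
have [->|a0] /= := eqVneq a 0; last first.
  by rewrite scale0r mulmxA g_supp ?a0 // mul0mx.
have [kr|rk] := ltnP k rho.
  by rewrite scale0r mulmxA g_supp ?kr ?orbT // mul0mx.
rewrite scale1r; case: ifP => // kr.
have -> : k = rho by lia.
by rewrite y_rho mulmxA g_rho mul1mx.
Qed.

Let Q_fdiag phi : (forall k a, (k <= rho)%N -> (a <= k)%N -> phi k a = 1) ->
  Q *m Dg phi = Q.
Proof.
move=> phi1; apply/eqP; rewrite -subr_eq0 -[X in _ - X]mulmx1 -mulmxBr; apply/eqP.
apply: Q_supp => k a kr ak; have km := leq_ltn_trans kr rho_m.
by rewrite mulmxBr (fdiagE fr) // phi1 // scale1r mulmx1 subrr.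
Qed.

Let QK z : row_mx Q 0 *m Kmx m c e rho z = row_mx Q 0 :> 'M[C]_(q, p + c).
Proof.
rewrite /Kmx /gradmx mul_row_block !mulmx0 !mul0mx !addr0 Q_fdiag //.
by move=> k a kr ak; rewrite xw // subnn.
Qed.

Let QY0 : row_mx Q 0 *m Y0 = 1%:M.
Proof.
rewrite mul_row_col mul0mx addr0; apply: Q_y => k a kr ak.
by rewrite (assembleE fr) ?limit_row_y // (leq_ltn_trans kr).
Qed.

(** The recursion settles every row but the last of each chain. The last rows hold by [y_last] up to
    length [r] and by [g_ker] beyond; inverting [B] settles the complement. *)
Let limit_eq : Amx m N e rho B M 0 *m Y0 = Kmx m c e rho 0 *m (Y0 *m Th).
Proof.
rewrite Amx0E proj_Y1 mulmxN [B *m (invmx B *m _)]mulmxA mulmxV // mul1mx addNr.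
rewrite [Y0 *m Th]mul_col_mx /Kmx /gradmx mul_block_col !mul0mx addr0 add0r expr1.
rewrite raddf0 raddf0 mul0mx; congr (col_mx _ _).
apply: (jframe_ext fr) => k a km ak.
rewrite mulmxDr (fdiagEmx fr) // mulmxA (jframe_N fr) // (fdiagEmx fr) //.
rewrite !expr0C [e k a *m (Y1 *m _)]mulmxA (assembleE fr limit_row km ak).
have xr : (r - x k a == 0)%N = (x k a == r).
  by have := geq_minr (w k a).+1 r; rewrite -/(x k a); lia.
have wx : ((w k a).+1 - x k a == 0)%N = (w k a < r)%N.
  by rewrite /rwgt; have := wgt_le rho ak; lia.
rewrite xr wx; move: (ak); rewrite leq_eqVlt => /predU1P[ak'|ak']; last first.
  rewrite (assembleE fr) //= -/u.
  case: (w k a < r)%N; case: (x k a == r);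
  by rewrite ?scale1r ?scale0r ?subr0 ?sub0r ?addr0 ?subrK ?addNr.
subst a; rewrite (jframe_out fr) // mul0mx add0r.
have [kr|rk] := leqP k rho.
  by rewrite limit_row_y // y_last // ltnS wgt_lt // xw // wgt_diag // eqxx.
rewrite wgt_last // ltnn scale0r /u; rewrite !mulmxA -[e k k *m _ *m g]mulmxA g_ker //.
by rewrite mul0mx scaler0.
Qed.

(** The end rows of the long chains carry only [M], so [ker_uniq] gives [v = 0]. This removes [M]
    from all rows and, by [Q_N], the correction of [Th]; what is left propagates zero along each
    chain from its top. *)
Let inj (Y : 'M[C]_(p + c, q)) : row_mx Q 0 *m Y = 0 ->
  Amx m N e rho B M 0 *m Y =
  Kmx m c e rho 0 *m (Y *m Th + Y0 *m (row_mx Q 0 *m (Amx m N e rho B M 0 *m Y))) ->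
  Y = 0.
Proof.
rewrite -(vsubmxK Y); set y1 := usubmx Y; set y2 := dsubmx Y.
rewrite mul_row_col mul0mx addr0 => Qy1.
rewrite Amx0E; set v := Dg _ *m y1; move=> E.
have v_row k a : (k < m)%N -> (a <= k)%N ->
    e k a *m v = if (a == 0) && (rho <= k)%N then e k a *m y1 else 0.
  move=> km ak; rewrite (fdiagEmx fr) // expr0C wgt_eq0.
  by case: (_ && _); rewrite ?scale1r ?scale0r.
have row1 (A1 A2 : 'M[C]_(p, q)) (A3 A4 : 'M[C]_(c, q)) :
    col_mx A1 A3 = Kmx m c e rho 0 *m col_mx A2 A4 ->
    A3 = 0 /\ forall k a, (k < m)%N -> (a <= k)%N ->
      e k a *m A1 = if (w k a < r)%N then e k a *m A2 else 0.
  rewrite /Kmx /gradmx mul_block_col !mul0mx addr0 add0r expr1.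
  rewrite raddf0 raddf0 mul0mx => /eq_col_mx[-> ->]; split=> // k a km ak.
  rewrite (fdiagEmx fr) // expr0C.
  have -> : ((w k a).+1 - x k a == 0)%N = (w k a < r)%N.
    by rewrite /rwgt; have := wgt_le rho ak; lia.
  by case: ifP; rewrite ?scale1r ?scale0r.
have v0 : v = 0.
  apply: ker_uniq => [k a km ak h|k rk km].
    rewrite v_row //; case: eqP h => //= -> kr; case: ifP => // rk.
    have -> : k = rho by lia.
    exact: Q_rho.
  move: E; rewrite [col_mx y1 y2 *m Th]mul_col_mx [Y0 *m _]mul_col_mx add_col_mx.
  move=> /row1[_ /(_ k k km (leqnn k))].
  rewrite wgt_last // ltnn mulmxDr mulmxA (jframe_N fr) // (jframe_out fr) //.
  rewrite mul0mx add0r (fdiagEmx fr) // expr0C /rwgt wgt_last //.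
  by rewrite (minn_idPr _) // subnn scale1r.
move: E; rewrite v0 !mulmx0 !addr0 mul_row_col mul0mx addr0 Q_N // mulmx0 addr0.
rewrite [col_mx y1 y2 *m Th]mul_col_mx => /row1[By2 rows].
have y20 : y2 = 0 by rewrite -[y2]mul1mx -(mulVmx B_unit) -mulmxA By2 mulmx0.
have {}rows k a : (k < m)%N -> (a <= k)%N ->
    e k a.+1 *m y1 = if (w k a < r)%N then e k a *m y1 *m Th else 0.
  by move=> km ak; rewrite -mulmxA -rows // mulmxA (jframe_N fr).
have first k : (k < m)%N -> e k 0 *m y1 = 0.
  move=> km; have [kr|kr|->] := ltngtP k rho; last exact: Q_rho.
    have [h|Th_inj] := Q_inj kr; first exact: h.
    (* Start past the end of the chain, where the row is [0], and cancel [Th] once per position. *)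
    have back j : (j <= k)%N -> e k (k - j) *m y1 = 0.
      elim: j => [|j IHj] jk.
        rewrite subn0; apply: Th_inj; have := rows k k km (leqnn k).
        by rewrite (jframe_out fr) // mul0mx ltnS wgt_lt ?(ltnW kr) // => <-.
      apply: Th_inj; have := rows k (k - j.+1)%N km (leq_subr _ _).
      rewrite ltnS wgt_lt ?(ltnW kr) ?leq_subr // => <-.
      by rewrite -subSn // subSS IHj // ltnW.
    by have := back k (leqnn k); rewrite subnn.
  by have := v_row k 0 km (leq0n k); rewrite v0 mulmx0 (ltnW kr).
suff -> : y1 = 0 by rewrite y20 col_mx0.
apply: (jframe_ext fr) => k a km; rewrite mulmx0.
elim: a => [_|a IHa ak]; first exact: first.
have ak' := ltnW ak; rewrite rows // IHa // mul0mx; by case: ifP.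
Qed.

(** The third bound concerns the tops of the long chains: their weight is [0], so the scaling alone
    says nothing about their distance to the leading vector. *)
Lemma graded_deflation : exists (Y : R -> 'M[C]_(p + c, q)) (Tz : R -> 'M[C]_q),
  [/\ bigOz (fun z => Tz z - Th) 1, bigOz Y 0,
   forall k, (rho < k)%N -> (k < m)%N ->
     bigOz (fun z => e k 0 *m usubmx (Y z) - e k 0 *m (g *m f0)) 1 &
   \forall z \near 0^'+, row_mx Q 0 *m Y z = 1%:M /\
     (block_mx N 0 0 B + z%:C ^+ r *: M) *m (gradmx m c e w r z *m Y z) =
     z%:C *: (gradmx m c e w r z *m Y z *m Tz z)].
Proof.
have [||||Y [Tz [YO TO sol]]] :=
  @deflation R _ _ (Amx m N e rho B M) (Kmx m c e rho) (Amx m N e rho B M 0)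
    (Kmx m c e rho 0) (row_mx Q 0) (col_mx Qt 0) Y0 Th _ _ _ (QK 0) _ QY0 limit_eq inj.
- have h := bigOz_gradmx m c e (fun k a => r - x k a)%N 0.
  have h' := bigOz_gradmx m c e w r.
  have b0 : bigOz (gradmx m c e w r) 0 := bigOz_limit h'.
  apply: (@bigOz_near _ _ _ (fun z =>
    (gradmx m c e (fun k a => r - x k a)%N 0 z - gradmx m c e (fun k a => r - x k a)%N 0 0)
      *m M *m gradmx m c e w r z +
    gradmx m c e (fun k a => r - x k a)%N 0 0 *m M *m
      (gradmx m c e w r z - gradmx m c e w r 0))).
    apply: filterS (near_z1 (R := R)) => z _; rewrite /Amx.
    move: (block_mx N 0 0 B) (gradmx m c e _ 0 z) (gradmx m c e _ 0 0).
    move: (gradmx m c e w r z) (gradmx m c e w r 0) => L L0 X0 E E0.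
    by rewrite opprD addrACA subrr add0r mulmxBl mulmxBl mulmxBr addrA subrK.
  apply: bigOzD; first exact: (bigOzM (bigOzM h (bigOz_const M)) b0).
  exact: (bigOzM (bigOz_const _) h').
- exact: bigOz_gradmx.
- by rewrite mul_row_col mul0mx addr0.
- by apply: filterS (near_z1 (R := R)) => z _; apply: QK.
exists Y, Tz; split=> //.
- exact: bigOz_limit YO.
- move=> k rk km; pose E := row_mx (e k 0) (0 : 'M[C]_(s k.+1, c)).
  apply: (@bigOz_near _ _ _ (fun z => E *m (Y z - Y0))); last first.
    exact: (bigOzM (bigOz_const E) YO).
  apply: filterS (near_z1 (R := R)) => z _.
  rewrite mulmxBr -{1}(vsubmxK (Y z)) /E !mul_row_col !mul0mx !addr0.
  by rewrite (assembleE fr) //= leqNgt rk.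
- apply: filterS sol => z [QY AY]; split=> //.
  rewrite mulmxA (Amx_scale fr) -mulmxA AY mulmxA -(Kmx_scale c fr).
  by rewrite -scalemxAl mulmxA.
Qed.

End GradedDeflation.

(** * Expansion of the deflating subspaces *)

Section Tails.
Context {R : realType}.
Local Notation C := R[i].
Variables (s : nat -> nat) (m p : nat) (N : 'M[C]_p).
Variable e : forall k a : nat, 'M[C]_(s k.+1, p).
Hypothesis fr : jframe m N e.

(** Together with [tail_last], the chain coordinates of [Ups] and [Upsc]: tops and ends of all
    chains of length greater than [k]. *)
Definition tail_first (k : nat) : 'M[C]_(udim (m := m) (s := s) k, p) :=
  \mxcol_(i < m - k) e (k + i) 0.
Definition tail_last (k : nat) : 'M[C]_(udim (m := m) (s := s) k, p) :=
  \mxcol_(i < m - k) e (k + i) (k + i).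

Lemma tailP n k0 (phi : nat -> nat) (A B : 'M[C]_(p, n)) :
  ((\mxcol_(i < m - k0) e (k0 + i) (phi (k0 + i)%N)) *m A =
   (\mxcol_(i < m - k0) e (k0 + i) (phi (k0 + i)%N)) *m B) <->
  (forall k, (k0 <= k)%N -> (k < m)%N -> e k (phi k) *m A = e k (phi k) *m B).
Proof.
rewrite !mxcol_mul; split=> [/eq_mxcolP h k k0k km|h].
  have ki : (k - k0 < m - k0)%N by lia.
  have := h (Ordinal ki) => /=.
  by rewrite (_ : k0 + (k - k0) = k)%N // subnKC.
by apply: eq_mxcol => i; apply: h; [rewrite leq_addr | rewrite -ltn_subRL].
Qed.

Lemma tail_first_span n k0 (v : 'M[C]_(p, n)) :
  (forall k a, (k < m)%N -> (a <= k)%N -> (a != 0) || (k < k0)%N ->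
     e k a *m v = 0) ->
  v = (tail_first k0)^T *m (tail_first k0 *m v).
Proof.
move=> supp; rewrite /tail_first mxcol_mul tr_mxcol mul_mxrow_mxcol.
apply: (jframe_ext fr) => k a km ak; rewrite mulmx_sumr.
have [h|] := boolP ((a != 0) || (k < k0)%N).
  rewrite supp // big1 // => i _; rewrite mulmxA (jframe_ortho fr) ?mul0mx //.
  by move: h; lia.
rewrite negb_or negbK -leqNgt => /andP[/eqP-> k0k].
have ki : (k - k0 < m - k0)%N by lia.
rewrite (bigD1 (Ordinal ki)) //= (_ : k0 + (k - k0) = k)%N ?subnKC //.
rewrite mulmxA (jframe_id fr) // mul1mx big1 ?addr0 // => i.
rewrite -val_eqE /= => ik; rewrite mulmxA (jframe_ortho fr) ?mul0mx //.
by move: ik; lia.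
Qed.

Variable M11 : 'M[C]_p.

(** A [v] supported on the tops is determined by [tail_first k0 *m v], and the conditions at the
    ends say that the invertible pivot annihilates this matrix. *)
Lemma tail_inj n k0 (v : 'M[C]_(p, n)) :
  tail_last k0 *m M11 *m (tail_first k0)^T \in unitmx ->
  (forall k a, (k < m)%N -> (a <= k)%N -> (a != 0) || (k < k0)%N ->
     e k a *m v = 0) ->
  (forall k, (k0 <= k)%N -> (k < m)%N -> e k k *m (M11 *m v) = 0) -> v = 0.
Proof.
move=> Pu /tail_first_span vE vl.
have h : tail_last k0 *m (M11 *m v) = 0.
  rewrite -[RHS](mulmx0 _ (tail_last k0)); apply/(tailP _ id) => k k0k km.
  by rewrite mulmx0 vl.
have v0 : tail_first k0 *m v = 0.
  by rewrite -(mulKmx Pu (_ *m v)) -!mulmxA -vE h mulmx0.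
by rewrite vE v0 mulmx0.
Qed.

Variables (rho : nat) (rho_m : (rho < m)%N).
Hypothesis Pu : tail_last rho.+1 *m M11 *m (tail_first rho.+1)^T \in unitmx.

(* In the frame of the Jordan chains this is the paper's [hat G_rho]. *)
Definition tail_coef : 'M[C]_(udim (m := m) (s := s) rho.+1, s rho.+1) :=
  - (invmx (tail_last rho.+1 *m M11 *m (tail_first rho.+1)^T) *m
     (tail_last rho.+1 *m (M11 *m (e rho 0)^T))).

(** Chain coordinates of [Xi2_ Xi rho ord0 + Ups Xi rho.+1 *m Ghat T Xi Xic rho]. *)
Definition lead_vec : 'M[C]_(p, s rho.+1) :=
  (e rho 0)^T + (tail_first rho.+1)^T *m tail_coef.

Lemma row_tail k a : (k < m)%N -> (a <= k)%N -> (a != 0) || (k <= rho)%N ->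
  e k a *m (tail_first rho.+1)^T = 0.
Proof.
move=> km ak h; rewrite /tail_first tr_mxcol mul_mxrow.
rewrite -[RHS](mxrow0 (q_ := fun i : 'I_(m - rho.+1) => s (rho.+1 + i).+1)).
by apply: eq_mxrow => i; rewrite (jframe_ortho fr) //; move: h; lia.
Qed.

Lemma lead_vec_supp k a : (k < m)%N -> (a <= k)%N ->
  (a != 0) || (k < rho)%N -> e k a *m lead_vec = 0.
Proof.
move=> km ak h; rewrite mulmxDr mulmxA row_tail //; last by move: h; lia.
by rewrite mul0mx addr0 (jframe_ortho fr) //; move: h; lia.
Qed.

Lemma lead_vec_rho : e rho 0 *m lead_vec = 1%:M.
Proof.
by rewrite mulmxDr mulmxA row_tail ?leqnn // mul0mx addr0 (jframe_id fr).
Qed.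

Lemma lead_vec_ker k : (rho < k)%N -> (k < m)%N -> e k k *m (M11 *m lead_vec) = 0.
Proof.
move=> rk km; rewrite -[RHS](mulmx0 _ (e k k)); move: k rk km.
apply/(tailP _ id); rewrite mulmx0 -/(tail_last _).
rewrite /lead_vec mulmxDr mulmxDr /tail_coef !mulmxN.
by rewrite !mulmxA mulmxV // mul1mx subrr.
Qed.

Lemma lead_vec_uniq n (v : 'M[C]_(p, n)) :
  (forall k a, (k < m)%N -> (a <= k)%N ->
     (a != 0) || (k <= rho)%N -> e k a *m v = 0) ->
  (forall k, (rho < k)%N -> (k < m)%N -> e k k *m (M11 *m v) = 0) -> v = 0.
Proof. exact: tail_inj Pu. Qed.

(** A Schur complement of one pivot in the next. If it kills [x], then [lead_vec *m x] meets the
    conditions of [tail_inj] for [rho] and is zero, while its row at [e rho 0] is [x]. *)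
Lemma lead_pivot_unit :
  tail_last rho *m M11 *m (tail_first rho)^T \in unitmx ->
  e rho rho *m (M11 *m lead_vec) \in unitmx.
Proof.
move=> Pu'; rewrite -unitmx_tr -row_free_unit -kermx_eq0; apply/eqP.
set S := _ *m _; pose x := (kermx S^T)^T.
have Sx : S *m x = 0 by apply: trmx_inj; rewrite trmx_mul trmxK mulmx_ker trmx0.
apply: trmx_inj; rewrite -/x trmx0.
have gx : lead_vec *m x = 0.
  apply: (tail_inj Pu') => [k a km ak h|k rk km].
    by rewrite mulmxA lead_vec_supp // mul0mx.
  move: rk; rewrite leq_eqVlt => /predU1P[<-|rk].
    by rewrite !mulmxA -(mulmxA (e rho rho)).
  by rewrite !mulmxA -(mulmxA (e k k)) lead_vec_ker // mul0mx.
by rewrite -[x]mul1mx -lead_vec_rho -mulmxA gx mulmx0.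
Qed.

End Tails.

Section Expansions.
Context {R : realType}.
Local Notation C := R[i].

Lemma bigOzZ a b (F : R -> 'M[C]_(a, b)) i j :
  bigOz F j -> bigOz (fun z => z%:C ^+ i *: F z) (i + j).
Proof.
move=> Fj; apply: bigOz_near (bigOzM (bigOz_pow i (1%:M : 'M[C]_a)) Fj).
by apply: filterS (near_z1 (R := R)) => z _; rewrite -scalemxAl mul1mx.
Qed.

Variables (s : nat -> nat) (m p c : nat) (N : 'M[C]_p).
Variable e : forall k a : nat, 'M[C]_(s k.+1, p).
Hypothesis fr : jframe m N e.
Variables (rho : nat) (rho_m : (rho < m)%N) (B : 'M[C]_c) (M : 'M[C]_(p + c)).
Hypothesis B_unit : B \in unitmx.

Local Notation r := rho.+1.
Local Notation h := (s rho.+1).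
Local Notation w := (wgt rho).
Local Notation M11 := (ulsubmx M).

Hypothesis Pu : tail_last m e r *m M11 *m (tail_first m e r)^T \in unitmx.

Local Notation g := (lead_vec m e M11 rho).
Local Notation S := (e rho rho *m (M11 *m g)).

Section Deflated.
Variables (q : nat) (Q : 'M[C]_(q, p)).

Lemma deflated_left_inverse z (Y : 'M[C]_(p + c, q)) : z != 0 ->
  row_mx Q 0 *m Y = 1%:M ->
  exists W, W *m (gradmx m c e w r z *m Y) = 1%:M.
Proof.
move=> z0 QY; have zC : z%:C != 0 by apply: contra z0 => /eqP [->].
exists (row_mx Q 0 *m block_mx (fdiag m e (fun k a => (z%:C ^+ w k a)^-1)) 0 0
                         ((z%:C ^+ r)^-1)%:M).
rewrite -mulmxA [_ *m (gradmx _ _ _ _ _ _ *m _)]mulmxA.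
rewrite /gradmx mulmx_block !mulmx0 !mul0mx !addr0 add0r (fdiagM fr).
rewrite (fdiag1 fr) => [|k a _ _]; last by rewrite mulVf ?expf_neq0.
by rewrite -scalar_mxM mulVf ?expf_neq0 // -scalar_mx_block mul1mx.
Qed.

End Deflated.

Section Small.
Local Notation q := (pdim r s).
Local Notation e' := (jsel (R := R) s r).
Local Notation fr' := (jframe_jsel (R := R) s r).

(* Normalising on all chains of length at most [rho.+1], and not only on those
   of length [rho.+1], spares the assumption that [Psi_rho] is invertible; the
   price is a limit matrix larger than [Theta_rho]. *)
Definition small_Theta : 'M[C]_q :=
  assemble r e' (fun k a => if (a < k)%N then e' k a.+1
                            else e k k *m (M11 *m (g *m e' rho 0))).

Lemma small_Theta_row k a : (k < r)%N -> (a <= k)%N -> e' k a *m small_Theta =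
  if (a < k)%N then e' k a.+1 else e k k *m (M11 *m (g *m e' rho 0)).
Proof. by move=> kr ak; rewrite (assembleE fr'). Qed.

(** The rows belonging to chains of length [rho.+1] are closed under right multiplication by
    [small_Theta], which acts on them as [Thetamx]. This gives an intertwiner on the left. *)
Lemma char_poly_small_Theta :
  char_poly (Thetamx r S) %| char_poly small_Theta.
Proof.
pose Q : 'M[C]_(bdim r h, q) := \sum_(a < r) (bsel r h a)^T *m e' rho a.
have QE a : (a < r)%N -> bsel r h a *m Q = e' rho a.
  move=> ar; rewrite /Q mulmx_sumr (bigD1 (Ordinal ar)) //= mulmxA bsel_tr //.
  rewrite eqxx mul1mx big1 ?addr0 // => b; rewrite -val_eqE /= eq_sym => /negPf ab.
  by rewrite mulmxA bsel_tr // ab mul0mx.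
apply: (@char_poly_intertwiner _ _ _ _ _ Q^T Q).
  apply: bsel_ext => a ar; rewrite mulmxA QE // mulmx1.
  apply: trmx_inj; rewrite trmx_mul trmxK /Q mulmx_suml.
  rewrite (bigD1 (Ordinal ar)) //= -mulmxA (jframe_id fr') // mulmx1.
  rewrite big1 ?addr0 // => b; rewrite -val_eqE /= => ab.
  by rewrite -mulmxA (jframe_ortho fr') ?mulmx0 // ab orbT.
apply: bsel_ext => a ar; rewrite [LHS]mulmxA QE // small_Theta_row //.
rewrite [RHS]mulmxA; move: (ar); rewrite ltnS leq_eqVlt => /predU1P[->|ar'].
  by rewrite ltnn bsel_Theta_last -[RHS]mulmxA QE // !mulmxA.
by rewrite ar' bsel_Theta // QE.
Qed.

Lemma expansion_small : exists (X : R -> 'M[C]_(p + c, q)) (Tz : R -> 'M[C]_q),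
  bigOz (fun z => Tz z - small_Theta) 1 /\
  \forall z \near 0^'+, (exists W, W *m X z = 1%:M) /\
     (block_mx N 0 0 B + z%:C ^+ r *: M) *m X z = z%:C *: (X z *m Tz z).
Proof.
pose Q : 'M[C]_(q, p) := assemble r e' e.
have QE k a : (k <= rho)%N -> (a <= k)%N -> e' k a *m Q = e k a.
  by move=> kr ak; rewrite (assembleE fr').
have Q0 n (Y : 'M[C]_(p, n)) : Q *m Y = 0 ->
    forall k a, (k <= rho)%N -> e k a *m Y = 0.
  move=> QY k a kr; case: (leqP a k) => ak; last by rewrite (jframe_out fr) // mul0mx.
  by rewrite -QE // -mulmxA QY mulmx0.
have Q_supp n (Y : 'M[C]_(p, n)) :
    (forall k a, (k <= rho)%N -> (a <= k)%N -> e k a *m Y = 0) -> Q *m Y = 0.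
  move=> h0; apply: (jframe_ext fr') => k a kr ak.
  by rewrite mulmxA QE // h0 // mulmx0.
have km k : (k <= rho)%N -> (k < m)%N by move=> kr; apply: leq_ltn_trans rho_m.
have [||||||||||Y [Tz [TO _ _ sol]]] :=
  @graded_deflation R s m p c N e fr rho B M q small_Theta g (e' rho 0) e' Q Q^T
    rho_m B_unit (lead_vec_supp fr rho_m Pu) (lead_vec_rho fr rho_m Pu) (lead_vec_ker Pu).
- by move=> v; apply: (lead_vec_uniq fr Pu).
- by [].
- by move=> k a kr ak; rewrite small_Theta_row ?ak // ltnW.
- by move=> k kr; rewrite small_Theta_row // ltnn.
- apply: (jframe_ext fr') => k a kr ak; rewrite mulmxA QE // mulmx1.
  apply: trmx_inj; rewrite trmx_mul trmxK.
  apply: (jframe_ext fr') => l b lr bl; rewrite mulmxA QE //.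
  have [kl|kl] := eqVneq l k; last by rewrite (jframe_ortho fr) ?(jframe_ortho fr') ?kl.
  subst l; have [ab|ab] := eqVneq b a.
    by subst b; rewrite (jframe_id fr) ?(jframe_id fr') ?km.
  by rewrite (jframe_ortho fr) ?(jframe_ortho fr') ?ab ?orbT.
- exact: Q_supp.
- move=> Y /Q0 QY; apply: Q_supp => k a kr ak.
  by rewrite mulmxA (jframe_N fr) ?km // QY.
- by move=> Y /Q0 ->.
- move=> Y QY; apply: (jframe_ext fr') => k a kr ak.
  by rewrite mulmxA QE // QY // mulmx1.
- by move=> k kr; left => Y /Q0 ->; rewrite // ltnW.
exists (fun z => gradmx m c e w r z *m Y z), Tz; split=> //.
move: (near_z1 (R := R)) sol; apply: filterS2 => z [z0 _] [QY AY].
by split; [apply: (deflated_left_inverse _ QY); rewrite gt_eqF | rewrite AY].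
Qed.

End Small.
End Expansions.

Section Pivot.
Context {R : realType}.
Local Notation C := R[i].

Lemma Theta_unit rho h (S : 'M[C]_h) : S \in unitmx -> Thetamx rho.+1 S \in unitmx.
Proof.
move=> Su; set r := rho.+1.
pose T : 'M[C]_(bdim r h) := \sum_(b < r)
  (bsel r h b)^T *m (if b == 0 :> nat then invmx S *m bsel r h rho else bsel r h b.-1).
have TE b : (b < r)%N -> bsel r h b *m T =
    if b == 0 :> nat then invmx S *m bsel r h rho else bsel r h b.-1.
  move=> br; rewrite /T mulmx_sumr (bigD1 (Ordinal br)) //= mulmxA bsel_tr //.
  rewrite eqxx mul1mx big1 ?addr0 // => a; rewrite -val_eqE /= eq_sym => /negPf ab.
  by rewrite mulmxA bsel_tr // ab mul0mx.
suff /mulmx1_unit[] : Thetamx r S *m T = 1%:M by [].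
apply: bsel_ext => a; rewrite ltnS mulmx1 mulmxA leq_eqVlt => /predU1P[->|ar].
  by rewrite bsel_Theta_last -mulmxA TE //= mulmxA mulmxV // mul1mx.
by rewrite bsel_Theta // TE.
Qed.

Variables (s : nat -> nat) (m p c : nat) (N : 'M[C]_p).
Variable e : forall k a : nat, 'M[C]_(s k.+1, p).
Hypothesis fr : jframe m N e.
Variables (rho : nat) (rho_m : (rho < m)%N) (B : 'M[C]_c) (M : 'M[C]_(p + c)).
Hypothesis B_unit : B \in unitmx.

Local Notation r := rho.+1.
Local Notation h := (s rho.+1).
Local Notation w := (wgt rho).
Local Notation M11 := (ulsubmx M).

Hypothesis Pu : tail_last m e r *m M11 *m (tail_first m e r)^T \in unitmx.
Hypothesis Pu' : tail_last m e rho *m M11 *m (tail_first m e rho)^T \in unitmx.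

Local Notation g := (lead_vec m e M11 rho).
Local Notation S := (e rho rho *m (M11 *m g)).
Local Notation q := (bdim r h).
Local Notation Th := (Thetamx r S).

(** [Q] picks exactly the rows of the chains of length [r], so in [Z] these rows are exact monomials
    and not just estimates. *)
Lemma expansion_pivot : exists (Z : R -> 'M[C]_(p, q)) (V : R -> 'M[C]_(c, q))
    (Tz : R -> 'M[C]_q),
  [/\ bigOz (fun z => Tz z - Th) 1 /\ bigOz V 0,
      forall k a, (k < m)%N -> (a <= k)%N -> bigOz (fun z => e k a *m Z z) (w k a),
      forall k, (rho < k)%N -> (k < m)%N ->
        bigOz (fun z => e k 0 *m (Z z - g *m bsel r h 0)) 1,
      \forall z \near 0^'+, forall a, (a < r)%N ->
        e rho a *m Z z = z%:C ^+ a *: bsel r h a &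
      \forall z \near 0^'+,
        (block_mx N 0 0 B + z%:C ^+ r *: M) *m col_mx (Z z) (z%:C ^+ r *: V z) =
        z%:C *: (col_mx (Z z) (z%:C ^+ r *: V z) *m Tz z)].
Proof.
have Th_unit : Th \in unitmx.
  by apply/Theta_unit/(lead_pivot_unit fr rho_m Pu Pu').
(* Built backwards: the equation at the chain end prescribes the last row times [Th], and each step
   towards the top divides by [Th] once more. *)
pose y (k a : nat) : 'M[C]_(s k.+1, q) :=
  iter (k.+1 - a) (fun A => A *m invmx Th) (e k k *m (M11 *m (g *m bsel r h 0))).
have y_rho j : (j <= rho)%N -> y rho (rho - j)%N = bsel r h (rho - j).
  rewrite /y; elim: j => [|j IHj] jr.
    rewrite subn0 subSnn /=; apply: (can_inj (mulmxK Th_unit)).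
    by rewrite mulmxKV // bsel_Theta_last !mulmxA.
  have -> : (r - (rho - j.+1) = (r - (rho - j)).+1)%N by lia.
  rewrite iterS IHj ?(ltnW jr) //; apply: (can_inj (mulmxK Th_unit)).
  rewrite mulmxKV // bsel_Theta; first by congr bsel; lia.
  by rewrite ltnS; lia.
have {}y_rho a : (a <= rho)%N -> y rho a = bsel r h a.
  by move=> ar; rewrite -(subKn ar) y_rho ?leq_subr.
pose Q : 'M[C]_(q, p) := \sum_(a < r) (bsel r h a)^T *m e rho a.
have QE a : (a < r)%N -> bsel r h a *m Q = e rho a.
  move=> ar; rewrite /Q mulmx_sumr (bigD1 (Ordinal ar)) //= mulmxA bsel_tr //.
  rewrite eqxx mul1mx big1 ?addr0 // => b; rewrite -val_eqE /= eq_sym => /negPf ab.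
  by rewrite mulmxA bsel_tr // ab mul0mx.
have Q0 n (Y : 'M[C]_(p, n)) : Q *m Y = 0 -> forall a, e rho a *m Y = 0.
  move=> QY a; case: (leqP a rho) => ak; last by rewrite (jframe_out fr) // mul0mx.
  by rewrite -QE // -mulmxA QY mulmx0.
have Q_supp n (Y : 'M[C]_(p, n)) :
    (forall a, (a <= rho)%N -> e rho a *m Y = 0) -> Q *m Y = 0.
  move=> h0; rewrite /Q mulmx_suml big1 // => a _.
  by rewrite -mulmxA h0 ?mulmx0 // -ltnS.
have [||||||||||Y [Tz [TO YO Yfirst sol]]] :=
  @graded_deflation R s m p c N e fr rho B M q Th g (bsel r h 0) y Q Q^T
    rho_m B_unit (lead_vec_supp fr rho_m Pu) (lead_vec_rho fr rho_m Pu) (lead_vec_ker Pu).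
- by move=> v; apply: (lead_vec_uniq fr Pu).
- exact: y_rho.
- move=> k a kr ak; rewrite /y.
  have -> : (k.+1 - a = (k.+1 - a.+1).+1)%N by lia.
  by rewrite iterS mulmxKV.
- by move=> k kr; rewrite /y subSnn /= mulmxKV.
- apply: bsel_ext => a ar; rewrite mulmxA QE // mulmx1.
  apply: trmx_inj; rewrite trmx_mul trmxK /Q mulmx_suml.
  rewrite (bigD1 (Ordinal ar)) //= -mulmxA (jframe_id fr) // mulmx1.
  rewrite big1 ?addr0 // => b; rewrite -val_eqE /= => ab.
  by rewrite -mulmxA (jframe_ortho fr) ?mulmx0 // ab orbT.
- by move=> n Y h0; apply: Q_supp => a; apply: h0.
- move=> Y /Q0 QY; apply: Q_supp => a ar.
  by rewrite mulmxA (jframe_N fr) // QY.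
- by move=> Y /Q0 ->.
- move=> Y QY; apply: bsel_ext => a ar.
  by rewrite mulmxA QE // QY // y_rho // mulmx1.
- move=> k kr; right => Z ZT; rewrite -(mulmxK Th_unit Z) ZT; exact: mul0mx.
pose D z : 'M[C]_p := fdiag m e (fun k a => z%:C ^+ w k a).
have grad z : gradmx m c e w r z *m Y z =
    col_mx (D z *m usubmx (Y z)) (z%:C ^+ r *: dsubmx (Y z)).
  rewrite /gradmx -{1}(vsubmxK (Y z)) mul_block_col !mul0mx addr0 add0r.
  by rewrite mul_scalar_mx.
have uO : bigOz (fun z => usubmx (Y z)) 0.
  apply: bigOz_near (bigOzM (bigOz_const (row_mx (1%:M : 'M[C]_p) (0 : 'M[C]_(p, c)))) YO).
  apply: filterS (near_z1 (R := R)) => z _.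
  by rewrite -{1}(vsubmxK (Y z)) mul_row_col mul1mx mul0mx addr0.
have dO : bigOz (fun z => dsubmx (Y z)) 0.
  apply: bigOz_near (bigOzM (bigOz_const (row_mx (0 : 'M[C]_(c, p)) (1%:M : 'M[C]_c))) YO).
  apply: filterS (near_z1 (R := R)) => z _.
  by rewrite -{1}(vsubmxK (Y z)) mul_row_col mul1mx mul0mx add0r.
exists (fun z => D z *m usubmx (Y z)), (fun z => dsubmx (Y z)), Tz; split=> //.
- move=> k a km ak; rewrite -[w k a]addn0.
  apply: bigOz_near (bigOzZ _ (bigOzM (bigOz_const (e k a)) uO)).
  by apply: filterS (near_z1 (R := R)) => z _; rewrite (fdiagEmx fr).
- move=> k rk km; apply: bigOz_near (Yfirst k rk km).
  apply: filterS (near_z1 (R := R)) => z _; rewrite mulmxBr (fdiagEmx fr) //.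
  have /eqP-> : w k 0 == 0%N by rewrite wgt_eq0 ltnW.
  by rewrite expr0 scale1r.
- apply: filterS sol => z [QY _] a ar.
  have wa : w rho a = a by rewrite /wgt ltnn; lia.
  rewrite (fdiagEmx fr) // wa; congr (_ *: _).
  by rewrite -QE // -mulmxA -[RHS]mulmx1 -QY -{2}(vsubmxK (Y z)) mul_row_col mul0mx addr0.
- by apply: filterS sol => z [_]; rewrite grad.
Qed.

End Pivot.

Section MatrixFacts.
Context {R : realType}.
Local Notation C := R[i].

Lemma mulmx_dim0 a b c (A : 'M[C]_(a, b)) (B : 'M[C]_(b, c)) :
  b = 0%N -> A *m B = 0.
Proof. by move=> b0; subst b; rewrite [A]thinmx0 mul0mx. Qed.

Lemma unitmx_dim0 a (A : 'M[C]_a) : a = 0%N -> A \in unitmx.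
Proof. by move=> a0; subst a; rewrite unitmxE det_mx00 unitr1. Qed.

Lemma unitmx_inj a (A : 'M[C]_a) :
  (forall x : 'M[C]_a, A *m x = 0 -> x = 0) -> A \in unitmx.
Proof.
move=> Ainj; rewrite -unitmx_tr -row_free_unit -kermx_eq0; apply/eqP.
apply: trmx_inj; rewrite trmx0; apply: Ainj.
by apply: trmx_inj; rewrite trmx_mul trmxK mulmx_ker trmx0.
Qed.

Lemma invmx_opp a (A : 'M[C]_a) : invmx (- A) = - invmx A.
Proof.
have u : (-1 : C) \is a GRing.unit by rewrite unitfE oppr_eq0 oner_eq0.
case: (boolP (A \in unitmx)) => Au; last first.
  have NAu : - A \in unitmx = false by rewrite -scaleN1r unitmxZ // (negPf Au).
  by rewrite /invmx NAu (negPf Au).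
rewrite -scaleN1r invmxZ; first by rewrite invrN1 scaleN1r.
by rewrite unitmxZ.
Qed.

Lemma castmx_tr_mul a b c d (E : a = b) (A : 'M[C]_(a, c)) (B : 'M[C]_(a, d)) :
  (castmx (E, erefl) A)^T *m castmx (E, erefl) B = A^T *m B.
Proof. by case: b / E. Qed.

Lemma mulmx1C_dim a b (E : a = b) (A : 'M[C]_(a, b)) (B : 'M[C]_(b, a)) :
  A *m B = 1%:M -> B *m A = 1%:M.
Proof. by subst b; apply: mulmx1C. Qed.

(** A kernel vector of [b + N] is determined at position [a] by position [a.+1]; start past the
    chain end, where it vanishes. *)
Lemma jframe_unit s m p (N : 'M[C]_p) (e : forall k a, 'M[C]_(s k.+1, p)) (b : C) :
  jframe m N e -> b != 0 -> b%:M + N \in unitmx.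
Proof.
move=> fr b0; apply: unitmx_inj => x bNx.
have step k a : (k < m)%N -> (a <= k)%N -> e k a.+1 *m x = 0 -> e k a *m x = 0.
  move=> km ak h; have := congr1 (mulmx (e k a)) bNx.
  rewrite mulmx0 mulmxA mulmxDr mul_mx_scalar (jframe_N fr) // mulmxDl h addr0.
  by rewrite -scalemxAl => /eqP; rewrite scaler_eq0 (negPf b0) => /eqP.
apply: (jframe_ext fr) => k a km ak; rewrite mulmx0.
have back j : (j <= k)%N -> e k (k - j)%N *m x = 0.
  elim: j => [|j IHj] jk; apply: step => //; rewrite ?leq_subr //.
    by rewrite subn0 (jframe_out fr) // mul0mx.
  by rewrite -subSn // subSS IHj // ltnW.
by rewrite -(subKn ak) back // leq_subr.
Qed.

End MatrixFacts.

Section TailRec.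
Context {R : realType}.
Local Notation C := R[i].
Variables (s : nat -> nat) (m n : nat) (F : forall k : nat, 'M[C]_(s k.+1, n)).

(** Reads a row by a number that carries no bound, so that blocks whose heights are equal but not
    convertible can be compared. *)
Let ent d (A : 'M[C]_(d, n)) (y : nat) j : C :=
  if (insub y : option 'I_d) is Some y' then A y' j else 0.

Let entE d (A : 'M[C]_(d, n)) (y : 'I_d) j : ent A y j = A y j.
Proof. by rewrite /ent valK. Qed.

(** The two stackings agree only through the cast along [udim_recl], so rows are matched by their
    flat number, a sum of the preceding block heights. *)
Lemma mxcol_tail_recl (rho : 'I_m) :
  \mxcol_(i < m - rho) F (rho + i) =
  castmx (udim_recl (s := s) rho, erefl)
    (col_mx (F rho) (\mxcol_(i < m - rho.+1) F (rho.+1 + i))).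
Proof.
have rk k (x : 'I_(m - k)) (y : 'I_(s (k + x).+1)) j :
    (\mxcol_(i < m - k) F (k + i)) (tagnat.Rank x y) j = ent (F (k + x)) y j.
  rewrite entE.
  have := congr1 (fun A : 'M[C]_(s (k + x).+1, n) => A y j)
    (mxcolK (fun i : 'I_(m - k) => F (k + i)) x).
  by rewrite /submxcol {1}mxE.
have sumw L (X : 'I_L) (f : nat -> nat) :
    (\sum_(k < L | (k < X)%N) f k = \sum_(k < X) f k)%N.
  by rewrite (big_ord_widen L f (ltnW (ltn_ord X))).
have r0 : (0 < m - rho)%N by rewrite subn_gt0.
apply/matrixP => i j; rewrite castmxE /= cast_ord_id.
set i' := cast_ord _ i; have ii' : i = i' :> nat by [].
case: (fintype.split_ordP i') => y iy.
  rewrite iy col_mxEu -[RHS]entE.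
  have ylt : (y < s (rho + Ordinal r0).+1)%N by rewrite addn0.
  have -> : i = tagnat.Rank (Ordinal r0) (Ordinal ylt).
    apply: ord_inj; rewrite tagnat.RankEsum [X in (X + _)%N]big_pred0 => [|k]; last by [].
    by rewrite ii' iy.
  by rewrite rk /= addn0.
rewrite iy col_mxEd -(tagnat.sig2K y); set x := tagnat.sig1 y; set y' := tagnat.sig2 y.
have xlt : (x.+1 < m - rho)%N by have := ltn_ord x; lia.
have ylt : (y' < s (rho + Ordinal xlt).+1)%N by rewrite /= addnS.
have -> : i = tagnat.Rank (Ordinal xlt) (Ordinal ylt).
  have yv : y = tagnat.Rank x y' :> nat by rewrite tagnat.sig2K.
  apply: ord_inj; rewrite [LHS]ii' iy [LHS]/= yv !tagnat.RankEsum.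
  rewrite (sumw _ (Ordinal xlt) (fun k => s (rho + k).+1)).
  rewrite (sumw _ x (fun k => s (rho.+1 + k).+1)) /= big_ord_recl addn0 addnA.
  by congr (_ + _ + _)%N; apply: eq_bigr => k _; rewrite addnS.
by rewrite !rk /= addnS.
Qed.

End TailRec.

(** * The matrices of the statement in chain coordinates *)

Section Identification.
Context {R : realType}.
Local Notation C := R[i].
Variables (n m : nat) (s : nat -> nat).
Implicit Types Xi : 'M[C]_(n + n, pdim m s).
Local Notation e := (jsel (R := R) s m).

Lemma Xi2E Xi (k : 'I_m) (a : 'I_k.+1) : Xi2_ Xi k a = Xi *m (e k a)^T.
Proof.
apply: trmx_inj; rewrite trmx_mul trmxK jselE bselE.
by rewrite /Xi2_ /Xi_ !tr_submxrow.
Qed.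

Lemma UpsE Xi k : Ups Xi k = Xi *m (tail_first m e k)^T.
Proof.
rewrite /tail_first tr_mxcol mul_mxrow; apply: eq_mxrow => i.
by rewrite Xi2E.
Qed.

Lemma UpscE Xi k : Upsc Xi k = Xi *m (tail_last m e k)^T.
Proof.
rewrite /tail_last tr_mxcol mul_mxrow; apply: eq_mxrow => i.
by rewrite Xi2E.
Qed.

Lemma Ups_IG_first Xi (rho : 'I_m) (G : 'M[C]_(udim (m := m) (s := s) rho.+1, s rho.+1)) :
  Ups Xi rho *m IG_first G =
  Xi *m (((e rho 0)^T + (tail_first m e rho.+1)^T *m G) *m bsel rho.+1 (s rho.+1) 0).
Proof.
rewrite UpsE -mulmxA; congr (_ *m _).
rewrite [tail_first m e rho](mxcol_tail_recl (fun k => e k 0) rho).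
rewrite /IG_first castmx_tr_mul tr_col_mx.
have -> : \mxrow_(a < rho.+1) (if a == ord0 then col_mx 1%:M G else 0) =
    col_mx 1%:M G *m bsel rho.+1 (s rho.+1) 0.
  rewrite /bsel mul_mxrow; apply: eq_mxrow => a.
  by rewrite -val_eqE /=; case: ifP; rewrite ?mulmx1 ?mulmx0.
by rewrite mulmxA mul_row_col mulmx1.
Qed.

Lemma Upsc_IG_last Xi (rho : 'I_m) (G : 'M[C]_(udim (m := m) (s := s) rho.+1, s rho.+1)) :
  Upsc Xi rho *m IG_last G =
  Xi *m (((e rho rho)^T + (tail_last m e rho.+1)^T *m G) *m bsel rho.+1 (s rho.+1) rho).
Proof.
rewrite UpscE -mulmxA; congr (_ *m _).
rewrite [tail_last m e rho](mxcol_tail_recl (fun k => e k k) rho).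
rewrite /IG_last castmx_tr_mul tr_col_mx.
have -> : \mxrow_(a < rho.+1) (if a == ord_max then col_mx 1%:M G else 0) =
    col_mx 1%:M G *m bsel rho.+1 (s rho.+1) rho.
  rewrite /bsel mul_mxrow; apply: eq_mxrow => a.
  by rewrite -val_eqE /=; case: ifP; rewrite ?mulmx1 ?mulmx0.
by rewrite mulmxA mul_row_col mulmx1.
Qed.

Lemma sum_Xi Xi q (X : 'M[C]_(pdim m s, q)) :
  \sum_(k < m) Xi_ Xi k *m submxcol (p_ := fun j : 'I_m => bdim j.+1 (s j.+1)) X k
  = Xi *m X.
Proof. by rewrite -{2}(submxrowK Xi) -{2}(submxcolK X) mul_mxrow_mxcol. Qed.

End Identification.

(** * Hamiltonian structure *)

Section ConjTranspose.
Context {R : realType}.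
Local Notation C := R[i].

Lemma ctM a b c (A : 'M[C]_(a, b)) (B : 'M[C]_(b, c)) :
  (A *m B)^t* = (B^t* : 'M[C]_(c, b)) *m (A^t* : 'M[C]_(b, a)).
Proof. by rewrite trmx_mul map_mxM. Qed.

Lemma ctD a b (A B : 'M[C]_(a, b)) : (A + B)^t* = (A^t* : 'M[C]_(b, a)) + (B^t* : 'M[C]_(b, a)).
Proof. by rewrite linearD map_mxD. Qed.

Lemma ctN a b (A : 'M[C]_(a, b)) : (- A)^t* = - (A^t* : 'M[C]_(b, a)).
Proof. by rewrite linearN map_mxN. Qed.

Lemma ct0 a b : (0 : 'M[C]_(a, b))^t* = (0 : 'M[C]_(b, a)).
Proof. by rewrite trmx0 map_mx0. Qed.

Lemma ctK a b (A : 'M[C]_(a, b)) : A^t*^t* = A.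
Proof. exact: trmxCK. Qed.

Lemma ctZ a b x (A : 'M[C]_(a, b)) : (x *: A)^t* = conjc x *: (A^t* : 'M[C]_(b, a)).
Proof. by rewrite linearZ map_mxZ. Qed.

Lemma ct_scalar a (x : C) : (x%:M : 'M[C]_a)^t* = ((conjc x)%:M : 'M[C]_a).
Proof. by rewrite tr_scalar_mx map_scalar_mx. Qed.

Lemma ct1 a : (1%:M : 'M[C]_a)^t* = (1%:M : 'M[C]_a).
Proof. by rewrite trmx1 map_mx1. Qed.

Lemma ct_row_mx a b c (A : 'M[C]_(a, b)) (B : 'M[C]_(a, c)) :
  (row_mx A B)^t* = col_mx (A^t*) (B^t*).
Proof. by rewrite tr_row_mx map_col_mx. Qed.

Lemma ct_block a b c d (A : 'M[C]_(a, b)) B (D : 'M[C]_(c, b)) (E : 'M[C]_(c, d)) :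
  (block_mx A B D E)^t* = block_mx (A^t*) (D^t*) (B^t*) (E^t*).
Proof. by rewrite tr_block_mx map_block_mx. Qed.

Lemma mnorm_ct a b (A : 'M[C]_(a, b)) : mnorm (A^t*) = mnorm A.
Proof.
rewrite /mnorm exchange_big; apply: eq_bigr => i _; apply: eq_bigr => j _.
by rewrite !mxE; case: (A i j) => x y /=; rewrite sqrrN.
Qed.

Lemma bigOz_ct a b (F : R -> 'M[C]_(a, b)) i :
  bigOz F i -> bigOz (fun z => (F z)^t*) i.
Proof.
by move=> [c c0 Fc]; exists c => //; apply: filterS Fc => z; rewrite mnorm_ct.
Qed.

Lemma ct_Jmx k : (Jmx k : 'M[C]_(k + k))^t* = - (Jmx k : 'M[C]_(k + k)).
Proof.
by rewrite /Jmx ct_block !ct0 ctN ct1 opp_block_mx !oppr0 opprK.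
Qed.

Lemma Jmx_sqr k : (Jmx k : 'M[C]_(k + k)) *m Jmx k = - 1%:M.
Proof.
rewrite /Jmx mulmx_block !mulmx0 !mul0mx !mulmx1 !mul1mx !addr0 !add0r.
by rewrite (scalar_mx_block k k) opp_block_mx !oppr0.
Qed.

(* A matrix [A] with [J A] Hermitian is skew-adjoint for the form [J]. *)
Lemma ham_skew n (A : 'M[C]_(n + n)) : hamiltonian A ->
  (A^t* : 'M[C]_(n + n)) *m Jmx n = - (Jmx n *m A).
Proof. by rewrite /hamiltonian => ->; rewrite ctM ct_Jmx mulmxN opprK. Qed.

Lemma ham_add n (A B : 'M[C]_(n + n)) (x : R) : hamiltonian A -> hamiltonian B ->
  hamiltonian (A + x%:C *: B).
Proof.
rewrite /hamiltonian => hA hB; rewrite mulmxDr -scalemxAr ctD ctZ -hA -hB.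
by rewrite conjc_real.
Qed.

End ConjTranspose.

(** * Neumann inverses and Sylvester equations near [z = 0] *)

Section Small.
Context {R : realType}.
Local Notation C := R[i].

Lemma bigOz_small a b (F : R -> 'M[C]_(a, b)) (d : R) : bigOz F 1 -> 0 < d ->
  \forall z \near 0^'+, mnorm (F z) <= d.
Proof.
case=> f f0 Ff d0; near=> z.
have Fz : mnorm (F z) <= f * z ^+ 1 by near: z.
apply: le_trans Fz _; rewrite expr1.
have fz : z * (f + 1) <= d.
  rewrite -ler_pdivlMr ?ltr_wpDl //; apply: ltW; near: z.
  by apply: nbhs_right_lt; rewrite divr_gt0 // ltr_wpDl.
have z0 : 0 < z by near: z; exact: nbhs_right_gt.
by move: fz z0; lra.
Unshelve. all: by end_near. Qed.

(** Once [|D z| <= 1 / 2], a kernel element satisfies [|x| <= |x| / 2], and [W = 1 - D W] bounds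
    [|W|] by twice the norm of the identity. *)
Lemma neumann q (D : R -> 'M[C]_q) : bigOz D 1 ->
  (\forall z \near 0^'+, 1%:M + D z \in unitmx) /\
  bigOz (fun z => invmx (1%:M + D z) - 1%:M) 1.
Proof.
move=> DO; have half : 0 < 1 / 2 :> R by lra.
have un : \forall z \near 0^'+, mnorm (D z) <= 1 / 2 /\ 1%:M + D z \in unitmx.
  apply: filterS (bigOz_small DO half) => z Dz; split=> //.
  apply: unitmx_inj => x; rewrite mulmxDl mul1mx => /eqP; rewrite addr_eq0 => /eqP xE.
  apply/mnorm_eq0/eqP; rewrite eq_le mnorm_ge0 andbT.
  have := mnormM (D z) x; rewrite -mnormN -xE => h.
  have := ler_wpM2r (mnorm_ge0 x) Dz; lra.
split; first by apply: filterS un => z [].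
case: DO => c c0 Dc; exists (c * (mnorm (1%:M : 'M[C]_q) + mnorm (1%:M : 'M[C]_q))).
  by rewrite mulr_ge0 // addr_ge0 // mnorm_ge0.
move: (near_z1 (R := R)) un Dc; apply: filterS3 => z [z0 _] [Dz u] Dc.
set W := invmx _; have WE : W - 1%:M = - (D z *m W).
  have := mulmxV u; rewrite -/W mulmxDl mul1mx => <-.
  by rewrite opprD addrA subrr add0r.
rewrite WE mnormN (le_trans (mnormM _ _)) //.
have W2 : mnorm W <= mnorm (1%:M : 'M[C]_q) + mnorm (1%:M : 'M[C]_q).
  have h1 : mnorm W <= mnorm (1%:M : 'M[C]_q) + mnorm (D z) * mnorm W.
    have := mnormB 1%:M (D z *m W); rewrite -WE addrC subrK => h.
    by apply: le_trans h _; rewrite lerD2l mnormM.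
  have := ler_wpM2r (mnorm_ge0 W) Dz; lra.
rewrite expr1 in Dc; rewrite expr1 mulrAC; apply: ler_pM => //; exact: mnorm_ge0.
Qed.

(** The scalar parts multiply [G] by [lambda + conjc lambda], twice the real part of [lambda], while
    the [O(z)] parts contribute at most half of that in norm. One neighbourhood serves every [G]. *)
Lemma sylvester_near q (lambda : C) (T T0 : R -> 'M[C]_q) : complex.Re lambda != 0 ->
  bigOz T 0 -> bigOz T0 0 -> \forall z \near 0^'+, forall G : 'M[C]_q,
    G *m (lambda%:M + z%:C *: T z) + ((conjc lambda)%:M + z%:C *: T0 z) *m G = 0 ->
    G = 0.
Proof.
move=> l0 TO T0O.
have [l l_gt0 lE] : exists2 l : R, 0 < l & l = `|2 * complex.Re lambda|.
  by exists `|2 * complex.Re lambda| => //; rewrite normr_gt0 mulf_neq0.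
have zT : bigOz (fun z => z%:C ^+ 1 *: T z) 1 by apply: bigOzZ TO.
have zT0 : bigOz (fun z => z%:C ^+ 1 *: T0 z) 1 by apply: bigOzZ T0O.
have l4 : 0 < l / 4 by rewrite divr_gt0.
move: (bigOz_small zT l4) (bigOz_small zT0 l4); apply: filterS2 => z.
rewrite expr1 => h h0 G; rewrite mulmxDr mulmxDl mul_mx_scalar mul_scalar_mx.
move: (z%:C *: T z) (z%:C *: T0 z) h h0 => A A0 hA hA0.
rewrite addrACA -scalerDl => /eqP; rewrite addr_eq0 => /eqP E.
have n1 : normc (lambda + conjc lambda) = l.
  case: (lambda) lE => x y /= ->; rewrite addrN expr0n /= addr0 sqrtr_sqr.
  by rewrite mulr2n mulrDl mul1r.
have := congr1 (@mnorm _ _ _) E; rewrite mnormZ n1 mnormN => E2.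
have h1 := mnormD (G *m A) (A0 *m G).
have h2 := mnormM G A; have h3 := mnormM A0 G.
have G0 := mnorm_ge0 G.
have h4 := ler_wpM2l G0 hA; have h5 := ler_wpM2r G0 hA0.
apply: mnorm_eq0; apply/eqP; rewrite eq_le G0 andbT.
rewrite -(pmulr_rle0 _ l_gt0); lra.
Qed.

Lemma isotropic_eq n q (A : 'M[C]_(n + n)) (X : 'M[C]_(n + n, q)) L :
  hamiltonian A -> A *m X = X *m L ->
  (X^t* *m Jmx n *m X) *m L + L^t* *m (X^t* *m Jmx n *m X) = 0.
Proof.
move=> hA AX; rewrite -mulmxA -AX [L^t* *m _]mulmxA [L^t* *m _]mulmxA -ctM -AX ctM.
by rewrite -(mulmxA _ (A^t*)) ham_skew // mulmxN mulNmx -!mulmxA addrN.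
Qed.

(** The Gram matrix solves a Sylvester equation whose coefficients do not involve [A] or [X], so
    both may vary with [z]. *)
Lemma isotropic_near n q (lambda : C) (T : R -> 'M[C]_q) :
  complex.Re lambda != 0 -> bigOz T 0 ->
  \forall z \near 0^'+, forall (A : 'M[C]_(n + n)) (X : 'M[C]_(n + n, q)),
    hamiltonian A -> A *m X = X *m (lambda%:M + z%:C *: T z) ->
    X^t* *m Jmx n *m X = 0.
Proof.
move=> l0 TO; have := sylvester_near l0 TO (bigOz_ct TO).
apply: filterS => z reg A X hA AX; apply: reg.
have := isotropic_eq hA AX.
by rewrite ctD ct_scalar ctZ conjc_real.
Qed.

End Small.

(** * The substitution [z = t^(1/r)] *)

Section RootChange.
Context {R : realType}.
Local Notation C := R[i].
Variable rho : nat.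
Local Notation r := rho.+1.

Definition rroot (t : R) : R := t `^ r%:R^-1.

Lemma rrootX (t : R) i : 0 < t -> rroot t ^+ i = t `^ (i%:R / r%:R).
Proof.
move=> t0; rewrite /rroot -powR_mulrn ?powR_ge0 // -powRrM.
by rewrite mulrC.
Qed.

Lemma rrootK (t : R) : 0 < t -> rroot t ^+ r = t.
Proof. by move=> t0; rewrite rrootX // divff // powRr1 // ltW. Qed.

Lemma tpowE (t : R) i : 0 < t -> tpow t (i%:R / r%:R) = (rroot t)%:C ^+ i.
Proof. by move=> t0; rewrite /tpow -rmorphXn /= rrootX. Qed.

Lemma near_rroot (P : R -> Prop) :
  (\forall z \near 0^'+, P z) -> \forall t \near 0^'+, P (rroot t).
Proof.
case/nbhs_ballP => d /= d0 dP; near=> t.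
have t0 : 0 < t by near: t; exact: nbhs_right_gt.
have rt0 : 0 < rroot t by apply: powR_gt0.
apply: dP => //; rewrite /ball /= sub0r normrN gtr0_norm //.
rewrite -(ltr_pXn2r (ltn0Sn rho)) ?nnegrE ?ltW // rrootK //.
by near: t; apply: nbhs_right_lt; rewrite exprn_gt0.
Unshelve. all: by end_near. Qed.

Lemma bigOz_is_bigO a b (F : R -> 'M[C]_(a, b)) (G : R -> 'M[C]_(a, b)) i (d : R) :
  bigOz F i -> d = i%:R / r%:R ->
  (\forall t \near 0^'+, G t = F (rroot t)) -> is_bigO d G.
Proof.
move=> [c c0 Fc] -> GF; exists c; move: (near_rroot Fc) GF (near_z1 (R := R)).
apply: filterS3 => t Fct -> [t0 _] x y.
rewrite -[`|_|]/((normc (F (rroot t) x y))%:C) lecR -rrootX //.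
exact: le_trans (normc_le_mnorm _ _ _) Fct.
Qed.

End RootChange.

Section HamSpectrum.
Context {R : realType}.
Local Notation C := R[i].

(** [J] intertwines [A^t*] with [- A], and the characteristic polynomial of [A^t*] is the conjugate
    of that of [A]. Stating the symmetry for divisors keeps track of multiplicities. *)
Lemma ham_char_poly_dvd n (A : 'M[C]_(n + n)) (f : {poly C}) : hamiltonian A ->
  f %| char_poly A -> map_poly conjc f \Po (- 'X) %| char_poly A.
Proof.
move=> hA fA; have J2 := @Jmx_sqr R n.
have d1 : char_poly (A^t*) %| char_poly (- A).
  apply: (@char_poly_intertwine _ _ _ _ _ (Jmx n) (- Jmx n)).
    by rewrite mulNmx J2 opprK.
  have h1 : Jmx n *m (A^t* *m Jmx n) *m Jmx n = - (Jmx n *m A^t*).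
    by rewrite -!mulmxA J2 !mulmxN mulmx1.
  have h2 : Jmx n *m (- (Jmx n *m A)) *m Jmx n = A *m Jmx n.
    by rewrite mulmxN mulNmx [Jmx n *m (_ *m _)]mulmxA J2 mulNmx mul1mx mulNmx opprK.
  by rewrite mulNmx -h2 -ham_skew // h1 opprK.
have d2 : map_poly conjc (char_poly A) %| char_poly (- A).
  by apply: dvdp_trans d1; rewrite -map_char_poly char_poly_tr; apply: dvdpp.
have NA : char_poly (- A) = ((-1) ^+ (n + n))%:P * (char_poly A \Po (- 'X)).
  have N1 : (-1 : C) != 0 by rewrite oppr_eq0 oner_eq0.
  have := @char_poly_affine _ _ A 0 (-1) N1.
  by rewrite raddf0 add0r scaleN1r invrN1 scaleN1r subr0.
have d3 : map_poly conjc f %| map_poly conjc (char_poly A) by rewrite dvdp_map.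
have := dvdp_comp_poly (- 'X) (dvdp_trans d3 d2).
rewrite NA comp_polyM comp_polyC -comp_polyA.
have -> : (- 'X : {poly C}) \Po (- 'X) = 'X.
  by rewrite raddfN /= comp_polyX opprK.
by rewrite comp_polyXr mul_polyC dvdpZr // expf_neq0 // oppr_eq0 oner_eq0.
Qed.

Lemma coprimep_prod_XsubC (I : finType) (J : finType) (a : I -> C) (b : J -> C) :
  (forall i j, a i != b j) ->
  coprimep (\prod_i ('X - (a i)%:P)) (\prod_j ('X - (b j)%:P)).
Proof.
move=> ab; apply: (big_ind (fun u => coprimep u _)).
- exact: coprime1p.
- by move=> x y hx hy; rewrite coprimepMl hx.
move=> i _; apply: (big_ind (fun u => coprimep _ u)).
- exact: coprimep1.
- by move=> x y hx hy; rewrite coprimepMr hx.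
by move=> j _; rewrite coprimep_XsubC root_XsubC eq_sym.
Qed.

Lemma bigOz_cvgC a b (F : R -> 'M[C]_(a, b)) (F0 : 'M[C]_(a, b)) i j :
  bigOz (fun z => F z - F0) 1 -> cvgC (fun z => F z i j) (F0 i j).
Proof.
move=> FO d d0; have d2 : 0 < d / 2 by lra.
apply: filterS (bigOz_small FO d2) => z h.
have := normc_le_mnorm (F z - F0) i j; rewrite !mxE; lra.
Qed.

Lemma cvgC_z : cvgC (fun z : R => z%:C) 0.
Proof.
move=> d d0; near=> z; rewrite subr0 normcR ger0_norm; last first.
  by apply: ltW; near: z; exact: nbhs_right_gt.
by near: z; apply: nbhs_right_lt.
Unshelve. all: by end_near. Qed.

Lemma char_poly_affine_dvd (I : finType) q (A : 'M[C]_q) (b z : C) (a : I -> C) :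
  z != 0 -> \prod_i ('X - (a i)%:P) %| char_poly A ->
  \prod_i ('X - (b + z * a i)%:P) %| char_poly (b%:M + z *: A).
Proof.
move=> z0 aA; rewrite char_poly_affine // dvdp_mull //.
set g := z^-1 *: _; have := dvdp_comp_poly g aA.
rewrite rmorph_prod /=; apply: dvdp_trans.
have -> : \prod_i ('X - (b + z * a i)%:P) =
    (z ^+ #|I|)%:P * \prod_i (('X - (a i)%:P) \Po g).
  rewrite polyC_exp -prodr_const -big_split; apply: eq_bigr => i _ /=.
  rewrite comp_polyB comp_polyX comp_polyC mulrBr -polyCM.
  have -> : z%:P * g = 'X - b%:P by rewrite /g mul_polyC scalerA divff // scale1r.
  by rewrite polyCD opprD addrA.
by rewrite mul_polyC dvdpZl // expf_neq0.
Qed.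

End HamSpectrum.

Section RealSelectors.
Context {R : realType}.
Local Notation C := R[i].

Lemma ct_jsel s m k a : (jsel (R := R) s m k a)^t* = (jsel s m k a)^T.
Proof. by apply/matrixP => i j; rewrite !mxE conjC_nat. Qed.

Lemma ct_jselT s m k a : ((jsel (R := R) s m k a)^T)^t* = jsel s m k a.
Proof. by apply/matrixP => i j; rewrite !mxE conjC_nat. Qed.

Lemma ct_Nmx m s : (Nmx m s : 'M[C]__)^t* = (Nmx m s)^T.
Proof.
apply: trmx_inj; rewrite trmxK; apply: (jframe_ext (jframe_jsel s m)) => k a km ak.
have -> : (map_mx Num.conj (Nmx m s)^T)^T = map_mx Num.conj (Nmx m s : 'M[C]__).
  by apply/matrixP => i j; rewrite !mxE.
have E l b : jsel s m l b = map_mx Num.conj (jsel (R := R) s m l b).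
  by apply/matrixP => i j; rewrite !mxE conjC_nat.
by rewrite {1}E -map_mxM (jframe_N (jframe_jsel s m)) // -E (jframe_N (jframe_jsel s m)).
Qed.

Lemma ct_tail_first s m k :
  ((tail_first m (jsel (R := R) s m) k)^T)^t* = tail_first m (jsel s m) k.
Proof. by apply/matrixP => i j; rewrite !mxE conjC_nat. Qed.

Lemma ct_tail_last s m k :
  ((tail_last m (jsel (R := R) s m) k)^T)^t* = tail_last m (jsel s m) k.
Proof. by apply/matrixP => i j; rewrite !mxE conjC_nat. Qed.

Lemma ct_tail_lastT s m k :
  (tail_last m (jsel (R := R) s m) k)^t* = (tail_last m (jsel s m) k)^T.
Proof. by apply/matrixP => i j; rewrite !mxE conjC_nat. Qed.

Lemma ct_bsel r h a : (bsel (R := R) r h a)^t* = (bsel r h a)^T.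
Proof.
apply/matrixP => i j; rewrite !mxE; by case: ifP => _; rewrite !mxE ?conjC_nat ?rmorph0.
Qed.

Lemma unitmx_ct a (A : 'M[C]_a) : (A^t* \in unitmx) = (A \in unitmx).
Proof. by rewrite map_unitmx unitmx_tr. Qed.

Lemma eigenvalue_sub_unit a (A : 'M[C]_a) x :
  ~~ eigenvalue A x -> A - x%:M \in unitmx.
Proof.
by rewrite /eigenvalue negbK /eigenspace kermx_eq0 row_free_unit.
Qed.

Lemma ulsubmx_compress a b1 b2 (A : 'M[C]_(b1, a)) (B : 'M[C]_(b2, a)) (T : 'M[C]_a)
    (D : 'M[C]_(a, b1)) (E : 'M[C]_(a, b2)) :
  ulsubmx (col_mx A B *m T *m row_mx D E) = A *m T *m D.
Proof. by rewrite mul_col_mx mul_col_row block_mxKul. Qed.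

Lemma mul_col_row3 a b1 b2 b3 (A1 : 'M[C]_(b1, a)) (A2 : 'M[C]_(b2, a))
    (A3 : 'M[C]_(b3, a)) (D1 : 'M[C]_(a, b1)) (D2 : 'M[C]_(a, b2))
    (D3 : 'M[C]_(a, b3)) :
  A1 *m D1 = 1%:M -> A1 *m D2 = 0 -> A1 *m D3 = 0 ->
  A2 *m D1 = 0 -> A2 *m D2 = 1%:M -> A2 *m D3 = 0 ->
  A3 *m D1 = 0 -> A3 *m D2 = 0 -> A3 *m D3 = 1%:M ->
  col_mx A1 (col_mx A2 A3) *m row_mx D1 (row_mx D2 D3) = 1%:M.
Proof.
move=> E11 E12 E13 E21 E22 E23 E31 E32 E33.
rewrite mul_col_row mul_mx_row mul_col_mx mul_col_row.
rewrite E11 E12 E13 E21 E22 E23 E31 E32 E33 row_mx0 col_mx0.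
by rewrite -!scalar_mx_block.
Qed.

Lemma udim_out m s k : (m <= k)%N -> udim (m := m) (s := s) k = 0%N.
Proof.
rewrite -subn_eq0 => /eqP mk0; rewrite /udim big1 // => i _.
by have := ltn_ord i; rewrite {2}mk0.
Qed.

End RealSelectors.

(** * The perturbed Hamiltonian matrix *)

Section Core.
Context {R : realType}.
Local Notation C := R[i].
Variables (n m : nat) (s : nat -> nat).
Variables (H T : 'M[C]_(n + n)) (lambda : C).
Variables (Xi Xic : 'M[C]_(n + n, pdim m s)).
Variable PhiC : 'M[C]_(n + n, (n - pdim m s) + (n - pdim m s)).
Variable HC : 'M[C]_((n - pdim m s) + (n - pdim m s)).
Hypothesis hpn : (pdim m s <= n)%N.
Hypothesis hT : hamiltonian T.
Hypothesis hlambda : complex.Re lambda != 0.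
Hypothesis hHPhi : H *m row_mx (row_mx Xi Xic) PhiC =
     row_mx (row_mx Xi Xic) PhiC *m
       bdiag_mx (bdiag_mx (lambda%:M + Nmx m s) (- (lambda%:M + Nmx m s) ^t*))
                HC.
Hypothesis hPhiJ : (row_mx (row_mx Xi Xic) PhiC) ^t* *m Jmx n *m
             row_mx (row_mx Xi Xic) PhiC =
     bdiag_mx (Jmx (pdim m s)) (Jmx (n - pdim m s)).
Hypotheses (hHC1 : ~~ eigenvalue HC lambda) (hHC2 : ~~ eigenvalue HC (- conjc lambda)).
Variable rho : 'I_m.

Local Notation p := (pdim m s).
Local Notation c0 := ((n - pdim m s) + (n - pdim m s))%N.
Local Notation c := (p + c0)%N.
Local Notation J := (Jmx n).
Local Notation J' := (Jmx (n - pdim m s)).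
Local Notation N := (Nmx m s).
Local Notation e := (jsel (R := R) s m).
Local Notation fr := (jframe_jsel (R := R) s m).
Local Notation e2 := (fun k a => if (a <= k)%N then e k (k - a)%N else 0).
Local Notation fr2 := (jframe_rev fr).

Lemma J_products :
  [/\ [/\ Xi^t* *m J *m Xi = 0, Xi^t* *m J *m Xic = 1%:M & Xi^t* *m J *m PhiC = 0],
      [/\ Xic^t* *m J *m Xi = - 1%:M, Xic^t* *m J *m Xic = 0 & Xic^t* *m J *m PhiC = 0] &
      [/\ PhiC^t* *m J *m Xi = 0, PhiC^t* *m J *m Xic = 0 & PhiC^t* *m J *m PhiC = J']].
Proof.
move: hPhiJ; rewrite /bdiag_mx !ct_row_mx [_ *m J]mul_col_mx mul_col_row.
move=> /eq_block_mx[h1 h2 h3 ->].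
move: h1; rewrite [_ *m J]mul_col_mx mul_col_row /Jmx => /eq_block_mx[-> -> -> ->].
move: h2; rewrite !mul_col_mx -[X in _ = X]col_mx0 => /eq_col_mx[-> ->].
by move: h3; rewrite mul_mx_row -[X in _ = X]row_mx0 => /eq_row_mx[-> ->].
Qed.

Lemma H_products :
  [/\ H *m Xi = Xi *m (lambda%:M + N), H *m Xic = - (Xic *m (lambda%:M + N)^t*) &
      H *m PhiC = PhiC *m HC].
Proof.
move: hHPhi; rewrite /bdiag_mx mul_mx_row mul_row_block !mulmx0 addr0 add0r.
move=> /eq_row_mx[h ->]; move: h.
rewrite mul_mx_row mul_row_block !mulmx0 addr0 add0r => /eq_row_mx[-> ->].
by rewrite mulmxN.
Qed.

(** The same columns in two orders: [Phi2] puts [Xic] first, on which [- H] has the eigenvalue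
    [conjc lambda] with chains given by [N^T]. *)
Definition Phi1 : 'M[C]_(n + n, p + c) := row_mx Xi (row_mx Xic PhiC).
Definition Phi2 : 'M[C]_(n + n, p + c) := row_mx Xic (row_mx Xi PhiC).
(** Read off from the [J]-products of the columns; the signs come from [Xic^t* J Xi = - 1] and
    [J' J' = - 1]. *)
Definition Inv1 : 'M[C]_(p + c, n + n) := col_mx (- (Xic^t* *m J))
  (col_mx (Xi^t* *m J) (- (J' *m PhiC^t* *m J))).
Definition Inv2 : 'M[C]_(p + c, n + n) := col_mx (Xi^t* *m J)
  (col_mx (- (Xic^t* *m J)) (- (J' *m PhiC^t* *m J))).

Let dimE : (p + c = n + n)%N.
Proof. by rewrite -[RHS](Phi_dimE hpn) addnA. Qed.

Lemma Inv1K : Inv1 *m Phi1 = 1%:M.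
Proof.
have [[E1 E2 E3] [E4 E5 E6] [E7 E8 E9]] := J_products.
apply: mul_col_row3; rewrite ?mulNmx ?E1 ?E2 ?E3 ?E4 ?E5 ?E6 ?opprK ?oppr0 //.
- by rewrite -!(mulmxA J') E7 mulmx0 oppr0.
- by rewrite -!(mulmxA J') E8 mulmx0 oppr0.
- by rewrite -!(mulmxA J') E9 Jmx_sqr opprK.
Qed.

Lemma Inv2K : Inv2 *m Phi2 = 1%:M.
Proof.
have [[E1 E2 E3] [E4 E5 E6] [E7 E8 E9]] := J_products.
apply: mul_col_row3; rewrite ?mulNmx ?E1 ?E2 ?E3 ?E4 ?E5 ?E6 ?opprK ?oppr0 //.
- by rewrite -!(mulmxA J') E8 mulmx0 oppr0.
- by rewrite -!(mulmxA J') E7 mulmx0 oppr0.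
- by rewrite -!(mulmxA J') E9 Jmx_sqr opprK.
Qed.

Lemma Phi1K : Phi1 *m Inv1 = 1%:M.
Proof. exact: (@mulmx1C_dim R _ _ dimE Inv1 Phi1 Inv1K). Qed.

Lemma Phi2K : Phi2 *m Inv2 = 1%:M.
Proof. exact: (@mulmx1C_dim R _ _ dimE Inv2 Phi2 Inv2K). Qed.

Definition B1 : 'M[C]_c :=
  block_mx (- (lambda%:M + N)^t* - lambda%:M) 0 0 (HC - lambda%:M).
Definition B2 : 'M[C]_c :=
  block_mx (- (lambda%:M + N) - (conjc lambda)%:M) 0 0 (- HC - (conjc lambda)%:M).

Let addr_conj_neq0 : lambda + conjc lambda != 0.
Proof.
case: (lambda) hlambda => x y /= x0; rewrite eq_complex /= negb_and.
by rewrite -mulr2n mulrn_eq0 /= x0.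
Qed.

Lemma unit_block a b (A : 'M[C]_a) (B : 'M[C]_b) :
  A \in unitmx -> B \in unitmx -> block_mx A 0 0 B \in unitmx.
Proof. by rewrite !unitmxE det_ublock => *; rewrite unitrM; apply/andP. Qed.

Lemma unitmxN a (A : 'M[C]_a) : (- A \in unitmx) = (A \in unitmx).
Proof.
by rewrite -scaleN1r unitmxZ // unitfE oppr_eq0 oner_eq0.
Qed.

(** The first block is minus a Jordan matrix with eigenvalue [lambda + conjc lambda], which is
    nonzero because [lambda] is not imaginary. *)
Lemma B1_unit : B1 \in unitmx.
Proof.
apply: unit_block; last exact: eigenvalue_sub_unit.
rewrite -opprD unitmxN ctD ct_scalar ct_Nmx addrAC -raddfD /=.
by apply: (jframe_unit fr2); rewrite addrC addr_conj_neq0.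
Qed.

Lemma B2_unit : B2 \in unitmx.
Proof.
apply: unit_block.
  by rewrite -opprD unitmxN addrAC -raddfD /=; exact: (jframe_unit fr addr_conj_neq0).
rewrite -opprD unitmxN; have := eigenvalue_sub_unit hHC2.
by rewrite raddfN /= opprK.
Qed.

Lemma H_Phi1 : H *m Phi1 = Phi1 *m (lambda%:M + block_mx N 0 0 B1).
Proof.
have [E1 E2 E3] := H_products.
rewrite /Phi1 /B1 !mul_mx_row E1 E2 E3 [lambda%:M in RHS]scalar_mx_block.
rewrite [X in block_mx _ _ _ X + _]scalar_mx_block !add_block_mx !addr0.
rewrite !mul_row_block !mulmx0 !addr0 !add0r.
by rewrite ![_%:M + (_ - _)]addrC !subrK mulmxN.
Qed.

Lemma H_Phi2 : - H *m Phi2 = Phi2 *m ((conjc lambda)%:M + block_mx N^T 0 0 B2).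
Proof.
have [E1 E2 E3] := H_products.
rewrite /Phi2 /B2 !mul_mx_row !mulNmx E1 E2 E3 opprK ctD ct_scalar ct_Nmx.
rewrite [(conjc lambda)%:M in RHS]scalar_mx_block.
rewrite [X in block_mx _ _ _ X + _]scalar_mx_block !add_block_mx !addr0.
rewrite !mul_row_block !mulmx0 !addr0 !add0r.
by rewrite ![_%:M + (_ - _)]addrC !subrK !mulmxN.
Qed.

Definition M1 := Inv1 *m T *m Phi1.
Definition M2 := Inv2 *m (- T) *m Phi2.

Lemma T_Phi1 : T *m Phi1 = Phi1 *m M1.
Proof. by rewrite /M1 !mulmxA Phi1K mul1mx. Qed.

Lemma T_Phi2 : - T *m Phi2 = Phi2 *m M2.
Proof. by rewrite /M2 !mulmxA Phi2K mul1mx. Qed.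

Lemma ulM1 : ulsubmx M1 = - (Xic^t* *m (J *m T) *m Xi).
Proof. by rewrite /M1 ulsubmx_compress !mulNmx !mulmxA. Qed.

(** [J T] is Hermitian. This is why the pivots of the second problem are the conjugate transposes of
    those of the first, and why its [tail_coef] is [Ghatc]. *)
Lemma ulM2 : ulsubmx M2 = (ulsubmx M1)^t*.
Proof.
rewrite ulM1 /M2 ulsubmx_compress ctN ctM [(_ *m (J *m T))^t*]ctM ctK -hT.
rewrite mulmxN mulNmx !mulmxA; congr (- _).
Qed.

Lemma ulM2E : ulsubmx M2 = - (Xi^t* *m (J *m T) *m Xic).
Proof. by rewrite /M2 ulsubmx_compress mulmxN mulNmx !mulmxA. Qed.

Lemma PsiE k : Psi T Xi Xic k =
  - (tail_last m e k *m ulsubmx M1 *m (tail_first m e k)^T).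
Proof.
rewrite /Psi UpsE UpscE ctM ct_tail_last ulM1 mulmxN mulNmx opprK.
by rewrite !mulmxA.
Qed.

Lemma pivot_unit k : Psi T Xi Xic k \in unitmx ->
  tail_last m e k *m ulsubmx M1 *m (tail_first m e k)^T \in unitmx.
Proof. by rewrite PsiE unitmxN. Qed.

Lemma tail_first_rev k : tail_first m e2 k = tail_last m e k.
Proof. by apply: eq_mxcol => i; rewrite leq0n subn0. Qed.

Lemma tail_last_rev k : tail_last m e2 k = tail_first m e k.
Proof. by apply: eq_mxcol => i; rewrite leqnn subnn. Qed.

Lemma pivot2E k : tail_last m e2 k *m ulsubmx M2 *m (tail_first m e2 k)^T =
  (tail_last m e k *m ulsubmx M1 *m (tail_first m e k)^T)^t*.
Proof.
rewrite tail_first_rev tail_last_rev ulM2 !ctM ct_tail_first ct_tail_lastT.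
exact: esym (mulmxA _ _ _).
Qed.

Lemma pivot_unit2 k : Psi T Xi Xic k \in unitmx ->
  tail_last m e2 k *m ulsubmx M2 *m (tail_first m e2 k)^T \in unitmx.
Proof. by rewrite pivot2E unitmx_ct; apply: pivot_unit. Qed.

Lemma GhatE : Ghat T Xi Xic rho = tail_coef m e (ulsubmx M1) rho.
Proof.
rewrite /Ghat /tail_coef PsiE invmx_opp UpscE ctM ct_tail_last Xi2E !mulNmx opprK.
rewrite ulM1 !(mulmxN, mulNmx) !mulmxA opprK; congr (_ *m _).
Qed.

Lemma GhatcE : Ghatc T Xi Xic rho = tail_coef m e2 (ulsubmx M2) rho.
Proof.
rewrite /tail_coef pivot2E /Ghatc PsiE invmx_opp UpsE [(Xi *m _)^t*]ctM.
rewrite ct_tail_first Xi2E ctN.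
rewrite !mulNmx opprK trmx_inv map_invmx.
rewrite tail_last_rev /= subn0 ulM2E.
rewrite !(mulmxN, mulNmx) !mulmxA opprK; congr (_ *m _).
Qed.

Lemma ShatE : - Shat T Xi Xic rho =
  e rho rho *m (ulsubmx M1 *m lead_vec m e (ulsubmx M1) rho).
Proof.
have -> : Shat T Xi Xic rho = (Xi2_ Xic rho ord_max)^t* *m (J *m T) *m
      (Xi2_ Xi rho ord0 + Ups Xi rho.+1 *m Ghat T Xi Xic rho).
  (* When [rho.+1 = m] the matrix [Ups Xi rho.+1] has no columns, so both branches of [Shat]
     agree. *)
  rewrite /Shat; case: ltnP => // mr; congr (_ *m _).
  by rewrite [Ups _ _ *m _]mulmx_dim0 ?addr0 // udim_out.
rewrite GhatE UpsE !Xi2E -[Xi *m _ *m _]mulmxA -mulmxDr -/(lead_vec _ _ _ _).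
rewrite ctM ct_jselT ulM1 mulNmx mulmxN !mulmxA; congr (- (_ *m _)).
Qed.

End Core.

(** * Expansion of the eigenvalues *)

Section PartA.
Context {R : realType}.
Local Notation C := R[i].
Variables (n m : nat) (s : nat -> nat).
Variables (H T : 'M[C]_(n + n)) (lambda : C).
Variables (Xi Xic : 'M[C]_(n + n, pdim m s)).
Variable PhiC : 'M[C]_(n + n, (n - pdim m s) + (n - pdim m s)).
Variable HC : 'M[C]_((n - pdim m s) + (n - pdim m s)).
Hypothesis hpn : (pdim m s <= n)%N.
Hypotheses (hH : hamiltonian H) (hT : hamiltonian T).
Hypothesis hlambda : complex.Re lambda != 0.
Hypothesis hHPhi : H *m row_mx (row_mx Xi Xic) PhiC =
     row_mx (row_mx Xi Xic) PhiC *m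
       bdiag_mx (bdiag_mx (lambda%:M + Nmx m s) (- (lambda%:M + Nmx m s) ^t*))
                HC.
Hypothesis hPhiJ : (row_mx (row_mx Xi Xic) PhiC) ^t* *m Jmx n *m
             row_mx (row_mx Xi Xic) PhiC =
     bdiag_mx (Jmx (pdim m s)) (Jmx (n - pdim m s)).
Hypothesis hHC1 : ~~ eigenvalue HC lambda.
Variable rho : 'I_m.

Local Notation N := (Nmx m s).
Local Notation e := (jsel (R := R) s m).
Local Notation fr := (jframe_jsel (R := R) s m).


Lemma eigen_expansion (gamma : 'I_(s rho.+1) -> C) (mu : 'I_(s rho.+1) -> 'I_rho.+1 -> C) :
  Psi T Xi Xic rho.+1 \in unitmx ->
  char_poly (- Shat T Xi Xic rho) = \prod_(i < s rho.+1) ('X - (gamma i)%:P) ->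
  (forall i, 'X^(rho.+1) - (gamma i)%:P = \prod_(j < rho.+1) ('X - (mu i j)%:P)) ->
  exists2 rr : 'I_(s rho.+1) * 'I_rho.+1 -> R -> C,
    (forall ij, cvgC (rr ij) (mu ij.1 ij.2)) &
    \forall z \near 0^'+, \prod_ij ('X - (lambda + z%:C * rr ij z)%:P) %|
      char_poly (H + z%:C ^+ rho.+1 *: T).
Proof.
move=> hPsi gammaE muE; have Pu := pivot_unit PhiC hPsi.
have [X [Tz [TO sol]]] := expansion_small fr (ltn_ord rho)
  (B1_unit hlambda hHC1) Pu.
set M := M1 _ _ _ _ in Pu TO sol.
(* The cofactor [f] accounts for the remaining roots of the limit polynomial; only the roots [mu]
   are followed. *)
have /dvdpP[f fE] := char_poly_small_Theta m e rho M.
have cE : char_poly (Thetamx rho.+1 (e rho rho *m (ulsubmx M *m lead_vec m e (ulsubmx M) rho)))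
    = \prod_(ij : 'I_(s rho.+1) * 'I_rho.+1) ('X - (mu ij.1 ij.2)%:P).
  rewrite -ShatE char_poly_Theta gammaE rmorph_prod /=.
  rewrite -(pair_big xpredT xpredT (fun i j => 'X - (mu i j)%:P)) /=.
  apply: eq_bigr => i _; rewrite -muE.
  by rewrite raddfB /= comp_polyX comp_polyC.
have [||||rr rr_cvg rr_dvd] := @root_continuity R _ (fun z => char_poly (Tz z))
    (char_poly (small_Theta m e rho M)) f (pdim rho.+1 s).+1 (fun ij => mu ij.1 ij.2).
- by move=> z; rewrite size_char_poly.
- by apply: pcvg_char_poly => i j; apply: bigOz_cvgC.
- exact/monic_neq0/char_poly_monic.
- by rewrite fE cE.
exists rr => //; move: (near_z1 (R := R)) sol rr_dvd.
apply: filterS3 => z [z0 _] [[W WX] AX] dvd.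
have zC : z%:C != 0 by rewrite -(rmorph0 (real_complex R)) (inj_eq (@complexI R)) gt_eqF.
apply: dvdp_trans (char_poly_affine_dvd lambda zC dvd) _.
apply: (@char_poly_intertwine _ _ _ _ _ (Phi1 Xi Xic PhiC *m X z)
         (W *m Inv1 Xi Xic PhiC)).
  by rewrite -mulmxA [Inv1 _ _ _ *m _]mulmxA (Inv1K hPhiJ) mul1mx.
rewrite mulmxA mulmxDl (H_Phi1 hHPhi) -scalemxAl (T_Phi1 T hpn hPhiJ).
rewrite scalemxAr -mulmxDr -!mulmxA; congr (_ *m _).
rewrite -addrA mulmxDl AX mul_scalar_mx mulmxDr mul_mx_scalar.
by rewrite scalemxAr.
Qed.

(** The product over the [lam i j t] divides by [eigen_expansion] and the mirrored one by the
    Hamiltonian symmetry; they are coprime, so both divide together. *)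
Lemma eigen_pairs (gamma : 'I_(s rho.+1) -> C) (mu : 'I_(s rho.+1) -> 'I_rho.+1 -> C) :
  Psi T Xi Xic rho.+1 \in unitmx ->
  char_poly (- Shat T Xi Xic rho) = \prod_(i < s rho.+1) ('X - (gamma i)%:P) ->
  (forall i, 'X^(rho.+1) - (gamma i)%:P = \prod_(j < rho.+1) ('X - (mu i j)%:P)) ->
  exists lam : 'I_(s rho.+1) -> 'I_rho.+1 -> R -> C,
       (\forall t \near 0^'+,
          \prod_(i < s rho.+1) \prod_(j < rho.+1)
             (('X - (lam i j t)%:P) * ('X - (- conjc (lam i j t))%:P))
          %| char_poly (H + t%:C *: T)) /\
       (forall i j,
          is_littleo (rho.+1%:R^-1)
            (fun t => lam i j t - (lambda + tpow t (rho.+1%:R^-1) * mu i j))).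
Proof.
move=> hPsi gammaE muE; have [rr rr_cvg rr_dvd] := eigen_expansion hPsi gammaE muE.
exists (fun i j t => lambda + (rroot rho t)%:C * rr (i, j) (rroot rho t)); split; last first.
  move=> i j; rewrite /is_littleo; apply/cvgr0Pnorm_lt => d d0.
  move: (near_z1 (R := R)) (near_rroot rho (rr_cvg (i, j) _ d0)).
  apply: filterS2 => t [t0 _] /=; rewrite /tpow -/(rroot rho t).
  have rt0 : 0 < rroot rho t by apply: powR_gt0.
  rewrite opprD addrACA subrr add0r -mulrBr normcM normcR.
  rewrite (ger0_norm (ltW rt0)) mulrAC divff ?gt_eqF // mul1r.
  by rewrite ger0_norm ?normc_ge0.
have re0 : 0 < `|complex.Re lambda| by rewrite normr_gt0.
have close : \forall z \near 0^'+, forall ij, normc (z%:C * rr ij z) < `|complex.Re lambda|.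
  apply: filter_forall => ij; have := cvgCM (@cvgC_z R) (rr_cvg ij).
  by rewrite mul0r => /(_ _ re0); apply: filterS => z; rewrite subr0.
move: (near_z1 (R := R)) (near_rroot rho rr_dvd) (near_rroot rho close).
apply: filterS3 => t [t0 _]; set z := rroot rho t; rewrite -rmorphXn /= rrootK // => dvd lt.
pose l (ij : 'I_(s rho.+1) * 'I_rho.+1) := lambda + z%:C * rr ij z.
have -> : \prod_(i < s rho.+1) \prod_(j < rho.+1)
   (('X - (l (i, j))%:P) * ('X - (- conjc (l (i, j)))%:P)) =
   (\prod_ij ('X - (l ij)%:P)) * \prod_ij ('X - (- conjc (l ij))%:P).
  rewrite -big_split /=.
  rewrite (pair_big xpredT xpredT (fun i j =>
     ('X - (l (i, j))%:P) * ('X - (- conjc (l (i, j)))%:P))) /=.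
  by apply: eq_bigr => -[i j].
rewrite Gauss_dvdp; last first.
  (* A common root would make twice the real part of [lambda] equal to minus the sum of two real
     parts, each smaller in modulus than that of [lambda]. *)
  apply: coprimep_prod_XsubC => ij kl; apply/eqP => /(congr1 (@complex.Re R)).
  rewrite /l; have := lt ij; have := lt kl.
  move/(le_lt_trans (Re_le_normc _)) => h1 /(le_lt_trans (Re_le_normc _)) h2.
  move: h1 h2; case: (lambda) => x1 x2; case: (z%:C * rr ij z) => y1 y2.
  case: (z%:C * rr kl z) => u1 u2 /= h1 h2 E.
  have : `|2 * x1| < 2 * `|x1|.
    have -> : 2 * x1 = - (y1 + u1) by move: E; lra.
    by rewrite normrN; have := ler_normD y1 u1; lra.
  by rewrite normrM ger0_norm // ltxx.
rewrite dvd /=.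
have := ham_char_poly_dvd (ham_add t hH hT) dvd.
rewrite !rmorph_prod /=; apply: dvdp_trans.
rewrite [X in _ %| X](eq_bigr (fun ij => (-1)%:P * ('X - (- conjc (l ij))%:P))).
  by rewrite big_split /= dvdp_mull.
move=> ij _; rewrite map_polyXsubC /= comp_polyB comp_polyX comp_polyC.
by rewrite polyCN mulN1r polyCN opprK opprD.
Qed.

End PartA.

Section Flip.
Context {R : realType}.
Local Notation C := R[i].

(* [flipmx] reverses the order of the blocks: the chains of [Xi^(c)] run
   backwards because [N] is replaced by its transpose. *)
Definition flipmx (r h : nat) : 'M[C]_(bdim r h) :=
  \sum_(a < r) (bsel r h a)^T *m bsel r h (r.-1 - a).

Lemma bsel_flip r h a : (a < r)%N -> bsel r h a *m flipmx r h = bsel r h (r.-1 - a).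
Proof.
move=> ar; rewrite /flipmx mulmx_sumr (bigD1 (Ordinal ar)) //= mulmxA bsel_tr //.
rewrite eqxx mul1mx big1 ?addr0 // => b; rewrite -val_eqE /= eq_sym => /negPf ab.
by rewrite mulmxA bsel_tr // ab mul0mx.
Qed.

Lemma flipmxK r h : flipmx r h *m flipmx r h = 1%:M.
Proof.
apply: bsel_ext => a ar; rewrite mulmxA bsel_flip // bsel_flip; last lia.
by rewrite mulmx1; congr bsel; lia.
Qed.

Lemma bsel_Xcdiag r h t a : (a < r)%N ->
  bsel r h a *m Xtildec_diag r h t =
  if a.+1 == r :> nat then 0 else tpow t ((r - a.+1)%:R / r%:R) *: bsel (R := R) r h a.
Proof.
move=> ar; rewrite (bselE (Ordinal ar)) /Xtildec_diag /mxdiag mxblockEv mxcolK /=.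
case: (eqVneq a.+1 r) => [ar'|ar'].
  rewrite -[RHS](mxrow0 (q_ := fun=> h)); apply: eq_mxrow => b.
  by case: ifP => // _; rewrite conform_mx_id.
rewrite -mul_scalar_mx mul_mxrow; apply: eq_mxrow => b.
rewrite -val_eqE /= eq_sym; case: ifP => _; rewrite ?mulmx1 ?mulmx0 //.
by rewrite conform_mx_id.
Qed.

End Flip.

Section Transfer.
Context {R : realType}.
Local Notation C := R[i].

Lemma jframe_bigOz s m p q (N : 'M[C]_p) (e : forall k a, 'M[C]_(s k.+1, p))
    (Z : R -> 'M[C]_(p, q)) i : jframe m N e ->
  (forall k a, (k < m)%N -> (a <= k)%N -> bigOz (fun z => e k a *m Z z) i) ->
  bigOz Z i.
Proof.
move=> fr ZO.
have h : bigOz (fun z => \sum_(k < m) \sum_(a < k.+1) (e k a)^T *m (e k a *m Z z)) i.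
  do 2![apply: bigOz_sum => ?]; rewrite -(add0n i); apply: bigOzM (bigOz_const _) _.
  by apply: ZO => //; rewrite -ltnS.
apply: bigOz_near h; apply: filterS (near_z1 (R := R)) => z _.
rewrite -[RHS]mul1mx -(jframe_sum fr) mulmx_suml; apply: eq_bigr => k _.
by rewrite mulmx_suml; apply: eq_bigr => a _; rewrite mulmxA.
Qed.

Lemma bigOzV a b (F : R -> 'M[C]_(a, b)) i j :
  bigOz F (i + j) -> bigOz (fun z => (z%:C ^+ i)^-1 *: F z) j.
Proof.
move=> [c c0 Fc]; exists c => //; move: (near_z1 (R := R)) Fc.
apply: filterS2 => z [z0 _] Fc.
have zi : 0 < z ^+ i by rewrite exprn_gt0.
rewrite mnormZ normcV -rmorphXn normcR gtr0_norm // mulrC ler_pdivrMr //.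
by rewrite -mulrA -exprD addnC.
Qed.

Lemma correction_split a b c (E : 'M[C]_(a, b)) (Z G : 'M[C]_(b, c)) (P W : 'M[C]_c) :
  E *m (Z - G) *m (P *m W) + E *m G *m P *m (W - 1%:M) =
  E *m (Z *m (P *m W) - G *m P).
Proof.
by rewrite !(mulmxBr, mulmxBl) mulmx1 !mulmxA addrA subrK.
Qed.

Lemma transfer n2 p q (A T : 'M[C]_n2) (Phi : 'M[C]_(n2, p)) (D M : 'M[C]_p)
    (X : 'M[C]_(p, q)) (L : 'M[C]_q) (b x z : C) :
  A *m Phi = Phi *m (b%:M + D) -> T *m Phi = Phi *m M ->
  (D + x *: M) *m X = z *: (X *m L) ->
  (A + x *: T) *m (Phi *m X) = Phi *m X *m (b%:M + z *: L).
Proof.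
move=> AP TP DX; rewrite mulmxA mulmxDl AP -scalemxAl TP scalemxAr -mulmxDr.
rewrite -!mulmxA; congr (_ *m _); rewrite -addrA mulmxDl DX.
by rewrite mul_scalar_mx mulmxDr mul_mx_scalar scalemxAr.
Qed.

End Transfer.

(** * The pair of deflating subspaces and its symplectic normalisation *)

Section PartB.
Context {R : realType}.
Local Notation C := R[i].
Variables (n m : nat) (s : nat -> nat).
Variables (H T : 'M[C]_(n + n)) (lambda : C).
Variables (Xi Xic : 'M[C]_(n + n, pdim m s)).
Variable PhiC : 'M[C]_(n + n, (n - pdim m s) + (n - pdim m s)).
Variable HC : 'M[C]_((n - pdim m s) + (n - pdim m s)).
Hypothesis hpn : (pdim m s <= n)%N.
Hypotheses (hH : hamiltonian H) (hT : hamiltonian T).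
Hypothesis hlambda : complex.Re lambda != 0.
Hypothesis hHPhi : H *m row_mx (row_mx Xi Xic) PhiC =
     row_mx (row_mx Xi Xic) PhiC *m
       bdiag_mx (bdiag_mx (lambda%:M + Nmx m s) (- (lambda%:M + Nmx m s) ^t*))
                HC.
Hypothesis hPhiJ : (row_mx (row_mx Xi Xic) PhiC) ^t* *m Jmx n *m
             row_mx (row_mx Xi Xic) PhiC =
     bdiag_mx (Jmx (pdim m s)) (Jmx (n - pdim m s)).
Hypotheses (hHC1 : ~~ eigenvalue HC lambda) (hHC2 : ~~ eigenvalue HC (- conjc lambda)).
Variable rho : 'I_m.

Local Notation p := (pdim m s).
Local Notation r := rho.+1.
Local Notation h := (s rho.+1).
Local Notation q := (bdim r h).
Local Notation w := (wgt rho).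
Local Notation J := (Jmx n).
Local Notation N := (Nmx m s).
Local Notation e := (jsel (R := R) s m).
Local Notation fr := (jframe_jsel (R := R) s m).
Local Notation e2 := (fun k a => if (a <= k)%N then e k (k - a)%N else 0).
Local Notation fr2 := (jframe_rev fr).


(** A position and its mirror image have weights adding up to exactly [rho] on chains of length [r],
    and to at least [r] on all others. This gap is the extra factor [z] in the Gram matrix. *)
Lemma wgt_rev k a : (a <= k)%N -> (k == rho) = false ->
  (r <= w k a + w k (k - a))%N.
Proof. by move=> ak kr; rewrite /wgt; case: ifP; lia. Qed.

Hypotheses (Psi_rho : Psi T Xi Xic rho \in unitmx)
  (Psi_rhoS : Psi T Xi Xic rho.+1 \in unitmx).

Local Notation g1 := (lead_vec m e (ulsubmx (M1 T Xi Xic PhiC)) rho).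
Local Notation g2 := (lead_vec m e2 (ulsubmx (M2 T Xi Xic PhiC)) rho).
Local Notation P := (flipmx (R := R) r h).

Local Notation ct A := (map_mx Num.conj (trmx A) : 'M[C]_(_, _)).

(* Only the chains of length [rho.+1] contribute at order [z ^ rho]. *)
Lemma gram_estimate (Z1 Z2 : R -> 'M[C]_(p, q)) :
  (forall k a, (k < m)%N -> (a <= k)%N -> bigOz (fun z => e k a *m Z1 z) (w k a)) ->
  (forall k a, (k < m)%N -> (a <= k)%N -> bigOz (fun z => e2 k a *m Z2 z) (w k a)) ->
  (\forall z \near 0^'+, forall a, (a < r)%N -> e rho a *m Z1 z = z%:C ^+ a *: bsel r h a) ->
  (\forall z \near 0^'+, forall a, (a < r)%N -> e2 rho a *m Z2 z = z%:C ^+ a *: bsel r h a) ->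
  bigOz (fun z => (ct (Z1 z)) *m Z2 z - z%:C ^+ rho *: P) r.
Proof.
move=> Z1O Z2O Z1E Z2E.
have term k a : (k < m)%N -> (a <= k)%N -> (k == rho) = false ->
    bigOz (fun z => (ct (e k a *m Z1 z)) *m (e k a *m Z2 z)) r.
  move=> km ak kr; apply: bigOzW (wgt_rev ak kr) _.
  apply: bigOzM; first by apply/bigOz_ct/Z1O.
  by have := Z2O k (k - a)%N km (leq_subr _ _); rewrite leq_subr subKn.
have S0 : bigOz (fun z => \sum_(k < m) \sum_(a < k.+1)
    (if k == rho then 0 else (ct (e k a *m Z1 z)) *m (e k a *m Z2 z))) r.
  apply: bigOz_sum => k; apply: bigOz_sum => a.
  case: eqVneq => [_|kr]; first exact: bigOz_0.
  by apply: term; [exact: ltn_ord | rewrite -ltnS | exact/negbTE].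
apply: bigOz_near S0; move: (near_z1 (R := R)) Z1E Z2E.
apply: filterS3 => z _ Z1E Z2E.
have -> : (ct (Z1 z)) *m Z2 z = \sum_(k < m) \sum_(a < k.+1)
    (ct (e k a *m Z1 z)) *m (e k a *m Z2 z).
  rewrite -{1}[Z2 z]mul1mx -(jframe_sum fr) mulmx_suml mulmx_sumr.
  apply: eq_bigr => k _; rewrite mulmx_suml mulmx_sumr; apply: eq_bigr => a _.
  rewrite ctM ct_jsel -[(e k a)^T *m _ *m _]mulmxA; exact: mulmxA.
rewrite (bigD1 rho) //= big1 => [|a _]; last by rewrite eqxx.
rewrite add0r [in RHS](bigD1 rho) //= addrAC.
have -> : \sum_(a < r) (ct (e rho a *m Z1 z)) *m (e rho a *m Z2 z) = z%:C ^+ rho *: P.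
  rewrite /flipmx scaler_sumr; apply: eq_bigr => a _.
  have ar : (a <= rho)%N by rewrite -ltnS.
  have := Z2E (rho - a)%N; rewrite leq_subr subKn // => ->; last by rewrite ltnS leq_subr.
  rewrite Z1E // ctZ ct_bsel -scalemxAl -scalemxAr scalerA -rmorphXn conjc_real.
  by rewrite rmorphXn -exprD subnKC.
rewrite subrr add0r; apply: eq_bigr => k kr; apply: eq_bigr => a _.
by rewrite (negPf kr).
Qed.

(** The correction of the Gram matrix is put entirely on the second subspace: the first keeps its
    exact monomial rows and the second acquires an error. This is the source of the asymmetry
    between the two sides. *)
Lemma pivot_pairs : exists (Z1 Zc V1 Vc : _) (Th : R -> 'M[C]_q),
  [/\ bigOz (fun z => Th z - Thetamx r (- Shat T Xi Xic rho)) 1,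
      [/\ bigOz V1 0,
      forall k a, (k < m)%N -> (a <= k)%N -> bigOz (fun z => e k a *m Z1 z) (w k a),
      forall k, (rho < k)%N -> (k < m)%N ->
        bigOz (fun z => e k 0 *m (Z1 z - g1 *m bsel r h 0)) 1 &
      \forall z \near 0^'+, forall a, (a < r)%N ->
        e rho a *m Z1 z = z%:C ^+ a *: bsel r h a],
      [/\ bigOz Vc 0,
      forall k a, (k < m)%N -> (a <= k)%N -> bigOz (fun z => e2 k a *m Zc z) (w k a),
      forall k, (rho < k)%N -> (k < m)%N ->
        bigOz (fun z => e2 k 0 *m (Zc z - g2 *m bsel r h rho)) 1 &
      forall a, (a < r)%N ->
        bigOz (fun z => e2 rho a *m Zc z - z%:C ^+ a *: bsel r h (rho - a)) a.+1] &
      \forall z \near 0^'+,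
        let X1 := Xi *m Z1 z + z%:C ^+ r *: (row_mx Xic PhiC *m V1 z) in
        let Xc := Xic *m Zc z + z%:C ^+ r *: (row_mx Xi PhiC *m Vc z) in
        (H + z%:C ^+ r *: T) *m row_mx X1 Xc =
          row_mx X1 Xc *m bdiag_mx (lambda%:M + z%:C *: Th z)
                                   (- (ct (lambda%:M + z%:C *: Th z))) /\
        (ct (row_mx X1 Xc)) *m J *m row_mx X1 Xc = z%:C ^+ rho *: Jmx q].
Proof.
have [Z1 [V1 [T1 [[T1O V1O] Z1O Z1g Z1E sol1]]]] :=
  expansion_pivot fr (ltn_ord rho) (B1_unit hlambda hHC1)
    (pivot_unit PhiC Psi_rhoS) (pivot_unit PhiC Psi_rho).
have [Z2 [V2 [T2 [[T2O V2O] Z2O Z2g Z2E sol2]]]] :=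
  expansion_pivot fr2 (ltn_ord rho) (B2_unit hlambda hHC2)
    (pivot_unit2 PhiC hT Psi_rhoS) (pivot_unit2 PhiC hT Psi_rho).
rewrite -ShatE in T1O.
pose X1 z := Xi *m Z1 z + z%:C ^+ r *: (row_mx Xic PhiC *m V1 z).
pose X2 z := Xic *m Z2 z + z%:C ^+ r *: (row_mx Xi PhiC *m V2 z).
have [[XX XXc XP] [XcX XcXc XcP] _] := J_products hPhiJ.
pose G z := (ct (X1 z)) *m J *m X2 z.
have Z1b : bigOz Z1 0 := jframe_bigOz fr (fun k a km ak => bigOzW (leq0n _) (Z1O k a km ak)).
have Z2b : bigOz Z2 0 := jframe_bigOz fr2 (fun k a km ak => bigOzW (leq0n _) (Z2O k a km ak)).
have X2b : bigOz X2 0.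
  apply: bigOzD; first exact: (bigOzM (bigOz_const _) Z2b).
  exact: bigOzW (bigOzZ r (bigOzM (bigOz_const _) V2O)).
have GO : bigOz (fun z => G z *m P - z%:C ^+ rho *: 1%:M) r.
  (* Since [Xi^t* J Xic = 1], the leading part of [G] is [Z1^t* Z2]; [U] collects all that carries
     the factor [z ^ r]. *)
  pose U z := (ct (Z1 z)) *m (ct Xi) *m J *m (row_mx Xi PhiC *m V2 z) +
     (ct (row_mx Xic PhiC *m V1 z)) *m J *m X2 z.
  have UO : bigOz U 0.
    apply: bigOzD; last first.
      apply: (@bigOzM _ _ _ _ _ _ 0 0) X2b; apply: (@bigOzM _ _ _ _ _ _ 0 0) (bigOz_const _).
      by apply: bigOz_ct; apply: (bigOzM (bigOz_const _) V1O).
    apply: (@bigOzM _ _ _ _ _ _ 0 0) (bigOzM (bigOz_const _) V2O).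
    apply: (@bigOzM _ _ _ _ _ _ 0 0) (bigOz_const _).
    by apply: (@bigOzM _ _ _ _ _ _ 0 0) (bigOz_const _); apply: bigOz_ct.
  have h1 : bigOz (fun z => ((ct (Z1 z)) *m Z2 z - z%:C ^+ rho *: P) *m P +
      z%:C ^+ r *: (U z *m P)) r.
    apply: bigOzD.
      by have := bigOzM (gram_estimate Z1O Z2O Z1E Z2E) (bigOz_const P); rewrite addn0.
    by have := bigOzZ r (bigOzM UO (bigOz_const P)); rewrite !addn0.
  apply: bigOz_near h1; apply: filterS (near_z1 (R := R)) => z _.
  have -> : G z = (ct (Z1 z)) *m Z2 z + z%:C ^+ r *: U z.
    rewrite /G {1}/X1 ctD ctZ ctM -rmorphXn conjc_real !mulmxDl -!scalemxAl.
    rewrite scalerDr addrA; congr (_ + _).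
    rewrite {1}/X2 mulmxDr -scalemxAr; congr (_ + _).
    by rewrite -!mulmxA [(ct Xi) *m _]mulmxA [(ct Xi) *m _ *m _]mulmxA XXc mul1mx.
    by rewrite rmorphXn.
  rewrite [in LHS]mulmxBl [in RHS]mulmxDl -!scalemxAl flipmxK.
  by rewrite addrAC.
(* The error has order [rho + 1], so division by [z ^ rho] still leaves [O(z)] and [neumann]
   applies. *)
pose D z := (z%:C ^+ rho)^-1 *: (G z *m P - z%:C ^+ rho *: 1%:M).
have DO : bigOz D 1 by apply: bigOzV; rewrite addn1.
have [Wu WO] := neumann DO.
pose W z := invmx (1%:M + D z).
exists Z1, (fun z => Z2 z *m (P *m W z)), V1, (fun z => V2 z *m (P *m W z)), T1.
have Wb : bigOz W 0 := bigOz_limit WO.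
have PWb : bigOz (fun z => P *m W z) 0 := bigOzM (bigOz_const P) Wb.
split; first exact: T1O.
- by split; [exact: V1O | exact: Z1O | exact: Z1g | exact: Z1E].
- split=> [|k a km ak|k rk km|a ar].
  - exact: (bigOzM V2O PWb).
  - have := bigOzM (Z2O k a km ak) PWb; rewrite addn0.
    by apply: bigOz_near; apply: filterS (near_z1 (R := R)) => z _; exact: esym (mulmxA _ _ _).
  - have h1 := bigOzM (Z2g k rk km) PWb.
    have h2 := bigOzM (bigOz_const (e2 k 0 *m (g2 *m bsel r h 0) *m P)) WO.
    apply: bigOz_near (bigOzD h1 h2); apply: filterS (near_z1 (R := R)) => z _.
    have -> : bsel r h rho = bsel r h 0 *m P by rewrite bsel_flip //= subn0.
    by rewrite [g2 *m (_ *m P)]mulmxA; apply: correction_split.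
  - have := bigOzZ a (bigOzM (bigOz_const (bsel r h (rho - a))) WO).
    rewrite add0n addn1; apply: bigOz_near; apply: filterS Z2E => z Z2E.
    rewrite mulmxA Z2E // mulmxBr mulmx1 scalerBr; congr (_ - _).
    by rewrite -scalemxAl mulmxA bsel_flip.
have T1b : bigOz T1 0 := bigOz_limit T1O.
have T2b : bigOz T2 0 := bigOz_limit T2O.
have l2 : complex.Re (conjc lambda) != 0 by case: (lambda) hlambda.
have iso1 := isotropic_near n hlambda T1b.
have iso2 := isotropic_near n l2 T2b.
have sols : \forall z \near 0^'+,
    (H + z%:C ^+ r *: T) *m X1 z = X1 z *m (lambda%:M + z%:C *: T1 z) /\
    (- (H + z%:C ^+ r *: T)) *m X2 z = X2 z *m ((conjc lambda)%:M + z%:C *: T2 z).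
  move: sol1 sol2; apply: filterS2 => z s1 s2; split.
    have -> : X1 z = Phi1 Xi Xic PhiC *m col_mx (Z1 z) (z%:C ^+ r *: V1 z).
      by rewrite /X1 /Phi1 mul_row_col scalemxAr.
    exact: (transfer (H_Phi1 hHPhi) (T_Phi1 T hpn hPhiJ) s1).
  have -> : X2 z = Phi2 Xi Xic PhiC *m col_mx (Z2 z) (z%:C ^+ r *: V2 z).
    by rewrite /X2 /Phi2 mul_row_col scalemxAr.
  rewrite opprD -scalerN.
  exact: (transfer (H_Phi2 hHPhi) (T_Phi2 T hpn hPhiJ) s2).
near=> z.
have z0 : 0 < z by near: z; exact: nbhs_right_gt.
have [AX1 AX2] : (H + z%:C ^+ r *: T) *m X1 z = X1 z *m (lambda%:M + z%:C *: T1 z) /\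
    (- (H + z%:C ^+ r *: T)) *m X2 z = X2 z *m ((conjc lambda)%:M + z%:C *: T2 z).
  by near: z.
have Iso1 : forall (A : 'M[C]_(n + n)) X, hamiltonian A ->
    A *m X = X *m (lambda%:M + z%:C *: T1 z) -> ct X *m J *m X = 0.
  near: z; exact: iso1.
have Iso2 : forall (A : 'M[C]_(n + n)) X, hamiltonian A ->
    A *m X = X *m ((conjc lambda)%:M + z%:C *: T2 z) -> ct X *m J *m X = 0.
  near: z; exact: iso2.
have Du : 1%:M + D z \in unitmx by near: z.
have zC : z%:C ^+ rho != 0.
  by rewrite expf_neq0 // -(rmorph0 (real_complex R)) (inj_eq (@complexI R)) gt_eqF.
have hA : hamiltonian (H + z%:C ^+ r *: T) by rewrite -rmorphXn; apply: ham_add.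
have G1 : (ct (X1 z)) *m J *m X1 z = 0 := Iso1 _ _ hA AX1.
set A := H + _ in AX1 AX2 hA *; set L := lambda%:M + z%:C *: T1 z in AX1 *.
have hNA : hamiltonian (- A) by rewrite /hamiltonian mulmxN ctN -hA.
have G2 : (ct (X2 z)) *m J *m X2 z = 0 := Iso2 _ _ hNA AX2.
pose Xc := X2 z *m (P *m W z).
have XcE : Xic *m (Z2 z *m (P *m W z)) + z%:C ^+ r *: (row_mx Xi PhiC *m (V2 z *m (P *m W z))) = Xc.
  by rewrite /Xc /X2 mulmxDl -scalemxAl !mulmxA.
have Gc : (ct Xc) *m J *m Xc = 0.
  rewrite /Xc ctM -!mulmxA [(ct (X2 z)) *m _]mulmxA [(ct (X2 z)) *m _ *m _]mulmxA G2.
  by rewrite mul0mx mulmx0.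
have K : (ct (X1 z)) *m J *m Xc = (z%:C ^+ rho)%:M.
  have GP : G z *m P = z%:C ^+ rho *: (1%:M + D z).
    rewrite /D; move: (G z *m P) => M.
    by rewrite scalerDr scalerA (divff zC) scale1r addrCA subrr addr0.
  by rewrite /Xc !mulmxA -/(G z) GP -scalemxAl mulmxV // scale_scalar_mx mulr1.
have K' : (ct Xc) *m J *m X1 z = - (z%:C ^+ rho)%:M.
  have := congr1 (fun Z : 'M[C]_q => (ct Z)) K.
  rewrite !ctM ct_Jmx ctK ct_scalar -rmorphXn conjc_real => <-.
  by rewrite mulNmx mulmxN opprK mulmxA.
have PWu : P *m W z \in unitmx.
  rewrite unitmx_mul unitmx_inv Du andbT; exact: (mulmx1_unit (flipmxK r h)).1.
pose Bc := - (invmx (P *m W z) *m (((conjc lambda)%:M + z%:C *: T2 z) *m (P *m W z))).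
have AXc : A *m Xc = Xc *m Bc.
  rewrite /Bc mulmxN /Xc -[X2 z *m _ *m _]mulmxA mulKVmx // [RHS in _ = - RHS]mulmxA -AX2.
  by rewrite mulNmx mulNmx opprK mulmxA.
(* Pairing [A Xc] with [X1] determines [Bc]: the form moves [A] to the other side with a sign, where
   it acts as [L]. *)
have BcE : Bc = - (ct L).
  have E : (ct (X1 z)) *m J *m (A *m Xc) = - ((ct L) *m (z%:C ^+ rho)%:M).
    rewrite mulmxA -(mulmxA _ J A).
    have -> : J *m A = - ((ct A) *m J) by rewrite ham_skew // opprK.
    by rewrite mulmxN [ct (X1 z) *m (_ *m J)]mulmxA -ctM AX1 ctM mulNmx -K !mulmxA.
  rewrite AXc mulmxA K mul_mx_scalar mul_scalar_mx -scalerN in E.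
  by move/scalerI: E; apply.
rewrite XcE -/(X1 z); split.
  by rewrite mul_mx_row AX1 AXc BcE /bdiag_mx mul_row_block !mulmx0 addr0 add0r.
rewrite ct_row_mx mul_col_mx mul_col_row G1 Gc K K' /Jmx scale_block_mx !scaler0.
by rewrite scalerN scale_scalar_mx mulr1.
Unshelve. all: by end_near. Qed.

End PartB.

(** * Translation into the orders [delta_k(t)] *)

Section Assembly.
Context {R : realType}.
Local Notation C := R[i].
Variables (n m : nat) (s : nat -> nat).
Variables (H T : 'M[C]_(n + n)) (lambda : C).
Variables (Xi Xic : 'M[C]_(n + n, pdim m s)).
Variable PhiC : 'M[C]_(n + n, (n - pdim m s) + (n - pdim m s)).
Variable HC : 'M[C]_((n - pdim m s) + (n - pdim m s)).
Hypothesis hpn : (pdim m s <= n)%N.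
Hypotheses (hH : hamiltonian H) (hT : hamiltonian T).
Hypothesis hlambda : complex.Re lambda != 0.
Hypothesis hHPhi : H *m row_mx (row_mx Xi Xic) PhiC =
     row_mx (row_mx Xi Xic) PhiC *m
       bdiag_mx (bdiag_mx (lambda%:M + Nmx m s) (- (lambda%:M + Nmx m s) ^t*))
                HC.
Hypothesis hPhiJ : (row_mx (row_mx Xi Xic) PhiC) ^t* *m Jmx n *m
             row_mx (row_mx Xi Xic) PhiC =
     bdiag_mx (Jmx (pdim m s)) (Jmx (n - pdim m s)).
Hypotheses (hHC1 : ~~ eigenvalue HC lambda) (hHC2 : ~~ eigenvalue HC (- conjc lambda)).
Variable rho : 'I_m.

Local Notation p := (pdim m s).
Local Notation c0 := ((n - pdim m s) + (n - pdim m s))%N.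
Local Notation c := (p + c0)%N.
Local Notation r := rho.+1.
Local Notation h := (s rho.+1).
Local Notation q := (bdim r h).
Local Notation w := (wgt rho).
Local Notation N := (Nmx m s).
Local Notation e := (jsel (R := R) s m).
Local Notation fr := (jframe_jsel (R := R) s m).
Local Notation e2 := (fun k a => if (a <= k)%N then e k (k - a)%N else 0).
Local Notation fr2 := (jframe_rev fr).


Lemma submxcol2E a (A : 'M[C]_(p, a)) (k : 'I_m) (x : 'I_k.+1) :
  submxcol (p_ := fun _ : 'I_k.+1 => s k.+1)
    (submxcol (p_ := fun j : 'I_m => bdim j.+1 (s j.+1)) A k) x = e k x *m A.
Proof. by rewrite jselE bselE. Qed.

(** The exponents in [delta_k] are the weights divided by [r], except at the tops of the longer
    chains: there the weight is [0], and the exponent [1 / r] is reached by subtracting the leading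
    vector. *)
Lemma delta_expE (k : 'I_m) (x : nat) : (k != rho :> nat) -> (x <= k)%N ->
  (if (k.+1 < r)%N then 1 - (k.+1 - x)%:R / r%:R
   else if k.+1 == r then x.+1%:R / r%:R
   else if x == 0 then r%:R^-1 else (minn x r)%:R / r%:R) =
  (if (k < rho)%N || (x != 0) then w k x else 1)%:R / r%:R :> R.
Proof.
move=> kr xk; rewrite ltnS eqSS (negPf kr) /wgt; case: ltnP => /= [lt|_].
  have r0 : r%:R != 0 :> R by rewrite pnatr_eq0.
  apply: (mulIf r0); rewrite mulrBl mul1r !divfK // -natrB; last by lia.
  by congr (_%:R); lia.
by case: eqVneq => //= _; rewrite mul1r.
Qed.

Lemma rows_bigO (k : 'I_m) (F : R -> 'M[C]_(p, q)) : (k != rho :> nat) ->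
  forall e' : (forall k a : nat, 'M[C]_(s k.+1, p)),
  (forall k a, (k < m)%N -> (a <= k)%N -> (a != 0) || (k < rho)%N ->
    bigOz (fun z => e' k a *m F z) (w k a)) ->
  (forall k, (rho < k)%N -> (k < m)%N -> bigOz (fun z => e' k 0 *m F z) 1) ->
  forall x, (x <= k)%N ->
    bigOz (fun z => e' k x *m F z) (if (k < rho)%N || (x != 0) then w k x else 1).
Proof.
move=> kr e' h1 h2 x xk; case: ifP => [c|]; first by apply: h1 => //; rewrite orbC.
move/negbT; rewrite negb_or negbK -leqNgt => /andP[rk /eqP->].
by apply: h2 => //; rewrite ltn_neqAle eq_sym kr.
Qed.

Lemma pivot_statement : Psi T Xi Xic rho \in unitmx -> Psi T Xi Xic rho.+1 \in unitmx ->
   exists (Xit Xict : R -> 'M[R[i]]_(n + n, bdim rho.+1 (s rho.+1)))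
     (X Xc : forall k : 'I_m,
        R -> 'M[R[i]]_(bdim k.+1 (s k.+1), bdim rho.+1 (s rho.+1)))
     (Th : R -> 'M[R[i]]_(bdim rho.+1 (s rho.+1))),
     [/\ is_bigO 1 (fun t => Xit t - (Ups Xi rho *m IG_first (Ghat T Xi Xic rho) +
                                  \sum_(k < m) Xi_ Xi k *m X k t)),
         is_bigO 1 (fun t => Xict t - (Upsc Xic rho *m IG_last (Ghatc T Xi Xic rho) +
                                   \sum_(k < m) Xi_ Xic k *m Xc k t)),
         (forall k : 'I_m, k != rho ->
            is_bigO_rows (delta_exp rho.+1 (k := k.+1)) (X k) /\
            is_bigO_rows (deltac_exp rho.+1 (k := k.+1)) (Xc k)),
         (\forall t \near 0^'+, X rho t = Xtilde_diag rho.+1 (s rho.+1) t) /\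
         is_bigO_rows (deltac_exp rho.+1 (k := rho.+1))
           (fun t => Xc rho t - Xtildec_diag rho.+1 (s rho.+1) t) &
         is_bigO (rho.+1%:R^-1)
           (fun t => Th t - Thetamx rho.+1 (- Shat T Xi Xic rho)) /\
         \forall t \near 0^'+,
           (H + t%:C *: T) *m row_mx (Xit t) (Xict t) =
             row_mx (Xit t) (Xict t) *m
               bdiag_mx (lambda%:M + tpow t (rho.+1%:R^-1) *: Th t)
                        (- (lambda%:M + tpow t (rho.+1%:R^-1) *: Th t) ^t*) /\
           (row_mx (Xit t) (Xict t)) ^t* *m Jmx n *m row_mx (Xit t) (Xict t) =
             tpow t (1 - rho.+1%:R^-1) *: Jmx (bdim rho.+1 (s rho.+1))].
Proof.
move=> Psi_rho Psi_rhoS.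
have [Z1 [Zc [V1 [Vc [Th [ThO [V1O Z1O Z1g Z1E] [VcO ZcO Zcg ZcE] sol]]]]]] :=
  pivot_pairs hpn hH hT hlambda hHPhi hPhiJ hHC1 hHC2 Psi_rho Psi_rhoS.
set g1 := lead_vec _ _ _ _ in Z1g; set g2 := lead_vec _ _ _ _ in Zcg.
have pu := pivot_unit PhiC Psi_rhoS.
have pu2 := pivot_unit2 PhiC hT Psi_rhoS.
(* With the leading vector subtracted, the sum over the chains is exact, so the whole [O(t)]
   remainder is the complementary part with its factor [z ^ r = t]. *)
pose F z := Z1 z - g1 *m bsel r h 0.
pose Fc z := Zc z - g2 *m bsel r h rho.
have r0 : r%:R != 0 :> R by rewrite pnatr_eq0.
have r1 : r%:R^-1 = 1%:R / r%:R :> R by rewrite mul1r.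
have one : 1 = r%:R / r%:R :> R by rewrite divff.
exists (fun t => Xi *m Z1 (rroot rho t) +
    (rroot rho t)%:C ^+ r *: (row_mx Xic PhiC *m V1 (rroot rho t))),
  (fun t => Xic *m Zc (rroot rho t) +
    (rroot rho t)%:C ^+ r *: (row_mx Xi PhiC *m Vc (rroot rho t))),
  (fun k t => submxcol (p_ := fun j : 'I_m => bdim j.+1 (s j.+1)) (F (rroot rho t)) k),
  (fun k t => submxcol (p_ := fun j : 'I_m => bdim j.+1 (s j.+1)) (Fc (rroot rho t)) k),
  (fun t => Th (rroot rho t)).
split.
- have h0 := bigOzZ r (bigOzM (bigOz_const (row_mx Xic PhiC)) V1O).
  rewrite !addn0 in h0; apply: (bigOz_is_bigO h0 one).
  apply: filterS (near_z1 (R := R)) => t _; rewrite sum_Xi Ups_IG_first (GhatE T Xi Xic PhiC).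
  rewrite -/(lead_vec m e (ulsubmx (M1 T Xi Xic PhiC)) rho) -/g1 -mulmxDr.
  by rewrite /F [g1 *m _ + _]addrC subrK addrC addKr.
- have h0 := bigOzZ r (bigOzM (bigOz_const (row_mx Xi PhiC)) VcO).
  rewrite !addn0 in h0; apply: (bigOz_is_bigO h0 one).
  apply: filterS (near_z1 (R := R)) => t _; rewrite sum_Xi Upsc_IG_last (GhatcE Xi Xic PhiC hT).
  have -> : (e rho rho)^T +
      (tail_last m e r)^T *m tail_coef m e2 (ulsubmx (M2 T Xi Xic PhiC)) rho = g2.
    by rewrite /g2 /lead_vec leq0n subn0 tail_first_rev.
  by rewrite -mulmxDr /Fc [g2 *m _ + _]addrC subrK addrC addKr.
- move=> k kr; have kr' : (k != rho :> nat) by rewrite -val_eqE in kr.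
  split=> x.
    have xk : (x <= k)%N by rewrite -ltnS.
    have h0 : bigOz (fun z => e k x *m F z) (if (k < rho)%N || (x != 0 :> nat) then w k x else 1).
      apply: (rows_bigO kr' (e' := e) _ Z1g xk) => k' a km ak c.
      apply: bigOz_near (Z1O k' a km ak); apply: filterS (near_z1 (R := R)) => z _.
      by rewrite mulmxBr mulmxA (lead_vec_supp fr (ltn_ord rho) pu) // mul0mx subr0.
    apply: (bigOz_is_bigO h0); first by rewrite /delta_exp delta_expE.
    by apply: filterS (near_z1 (R := R)) => t _; rewrite submxcol2E.
  (* [e2] counts positions from the end, so block [x] is position [k - x] of the reversed chain;
     this matches the reversal in [deltac_exp]. *)
  have xk : (k - x <= k)%N by rewrite leq_subr.
  have h0 : bigOz (fun z => e2 k (k - x)%N *m Fc z)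
      (if (k < rho)%N || (k - x != 0)%N then w k (k - x) else 1).
    apply: (rows_bigO kr' (e' := e2) _ Zcg xk) => k' a km ak c.
    apply: bigOz_near (ZcO k' a km ak); apply: filterS (near_z1 (R := R)) => z _.
    by rewrite mulmxBr [_ *m (g2 *m _)]mulmxA (lead_vec_supp fr2 (ltn_ord rho) pu2) // mul0mx subr0.
  apply: (bigOz_is_bigO h0).
    by rewrite /deltac_exp /delta_exp /= subSS delta_expE.
  apply: filterS (near_z1 (R := R)) => t _; rewrite submxcol2E.
  by rewrite leq_subr subKn // -ltnS.
- split.
    move: (near_z1 (R := R)) (near_rroot rho Z1E); apply: filterS2 => t [t0 _] E.
    apply: bsel_ext => a ar; rewrite bsel_Xdiag // -jselE mulmxBr E // mulmxA.
    have [->|a0] := eqVneq a 0.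
      by rewrite (lead_vec_rho fr (ltn_ord rho) pu) mul1mx expr0 scale1r subrr.
    by rewrite (lead_vec_supp fr (ltn_ord rho) pu) ?a0 // mul0mx subr0 tpowE.
  move=> x; have xr : (rho - x < r)%N by rewrite ltnS leq_subr.
  have xr' : (x <= rho)%N by rewrite -ltnS.
  apply: (bigOz_is_bigO (ZcE (rho - x)%N xr)).
    by rewrite /deltac_exp /delta_exp /= ltnn eqxx subSS.
  apply: filterS (near_z1 (R := R)) => t [t0 _].
  rewrite submxcolB submxcol2E -(bselE x (Xtildec_diag _ _ _)) bsel_Xcdiag //.
  rewrite leq_subr subKn // /Fc mulmxBr -addrA; congr (_ + _); rewrite -opprD; congr (- _).
  have [xE|xN] := eqVneq (nat_of_ord x) rho.
    rewrite xE eqxx addr0 subnn expr0 scale1r mulmxA.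
    have := lead_vec_rho fr2 (ltn_ord rho) pu2; rewrite leq0n subn0 => ->.
    by rewrite mul1mx.
  rewrite eqSS (negPf xN) subSS tpowE // mulmxA.
  have xN0 : (rho - x != 0)%N by rewrite subn_eq0 -ltnNge ltn_neqAle xN.
  have := lead_vec_supp fr2 (ltn_ord rho) pu2 (ltn_ord rho) (leq_subr x rho).
  by rewrite xN0 /= leq_subr subKn // => ->; rewrite // mul0mx add0r.
split; first by apply: (bigOz_is_bigO ThO r1); apply: filterS (near_z1 (R := R)).
move: (near_z1 (R := R)) (near_rroot rho sol); apply: filterS2 => t [t0 _].
rewrite -rmorphXn /= rrootK //.
have -> : tpow t (1 - r%:R^-1) = (rroot rho t)%:C ^+ rho.
  rewrite -tpowE //; congr tpow; apply: (mulIf r0).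
  by rewrite mulrBl mulVf // mul1r divfK // -natr1 addrK.
by [].
Qed.

End Assembly.

Theorem theorem11 (R : realType) (n m : nat) (s : nat -> nat)
  (H T : 'M[R[i]]_(n + n)) (lambda : R[i])
  (Xi Xic : 'M[R[i]]_(n + n, pdim m s))
  (PhiC : 'M[R[i]]_(n + n, (n - pdim m s) + (n - pdim m s)))
  (HC : 'M[R[i]]_((n - pdim m s) + (n - pdim m s)))
  (hm : (1 <= m)%N) (hsm : (0 < s m)%N) (hpn : (pdim m s <= n)%N)
  (hH : hamiltonian H) (hT : hamiltonian T)
  (hlambda : complex.Re lambda != 0)
  (hPhi_inv : castmx (erefl, Phi_dimE hpn) (row_mx (row_mx Xi Xic) PhiC)
                \in unitmx)
  (hHPhi : H *m row_mx (row_mx Xi Xic) PhiC =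
     row_mx (row_mx Xi Xic) PhiC *m
       bdiag_mx (bdiag_mx (lambda%:M + Nmx m s) (- (lambda%:M + Nmx m s) ^t*))
                HC)
  (hPhiJ : (row_mx (row_mx Xi Xic) PhiC) ^t* *m Jmx n *m
             row_mx (row_mx Xi Xic) PhiC =
     bdiag_mx (Jmx (pdim m s)) (Jmx (n - pdim m s)))
  (hHC1 : ~~ eigenvalue HC lambda) (hHC2 : ~~ eigenvalue HC (- conjc lambda))
  (rho : 'I_m)
  (hPsi : (rho.+1 < m)%N -> Psi T Xi Xic rho.+1 \in unitmx)
  (gamma : 'I_(s rho.+1) -> R[i])
  (hgamma : char_poly (- Shat T Xi Xic rho) =
              \prod_(i < s rho.+1) ('X - (gamma i)%:P)) :
  (forall mu : 'I_(s rho.+1) -> 'I_rho.+1 -> R[i],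
     (forall i, 'X^(rho.+1) - (gamma i)%:P =
                  \prod_(j < rho.+1) ('X - (mu i j)%:P)) ->
     exists lam : 'I_(s rho.+1) -> 'I_rho.+1 -> R -> R[i],
       (\forall t \near 0^'+,
          \prod_(i < s rho.+1) \prod_(j < rho.+1)
             (('X - (lam i j t)%:P) * ('X - (- conjc (lam i j t))%:P))
          %| char_poly (H + t%:C *: T)) /\
       (forall i j,
          is_littleo (rho.+1%:R^-1)
            (fun t => lam i j t - (lambda + tpow t (rho.+1%:R^-1) * mu i j)))) /\
  ((forall k : 'I_m, Psi T Xi Xic k \in unitmx) ->
   exists (Xit Xict : R -> 'M[R[i]]_(n + n, bdim rho.+1 (s rho.+1)))
     (X Xc : forall k : 'I_m,
        R -> 'M[R[i]]_(bdim k.+1 (s k.+1), bdim rho.+1 (s rho.+1)))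
     (Th : R -> 'M[R[i]]_(bdim rho.+1 (s rho.+1))),
     [/\ is_bigO 1 (fun t => Xit t - (Ups Xi rho *m IG_first (Ghat T Xi Xic rho) +
                                  \sum_(k < m) Xi_ Xi k *m X k t)),
         is_bigO 1 (fun t => Xict t - (Upsc Xic rho *m IG_last (Ghatc T Xi Xic rho) +
                                   \sum_(k < m) Xi_ Xic k *m Xc k t)),
         (forall k : 'I_m, k != rho ->
            is_bigO_rows (delta_exp rho.+1 (k := k.+1)) (X k) /\
            is_bigO_rows (deltac_exp rho.+1 (k := k.+1)) (Xc k)),
         (\forall t \near 0^'+, X rho t = Xtilde_diag rho.+1 (s rho.+1) t) /\
         is_bigO_rows (deltac_exp rho.+1 (k := rho.+1))
           (fun t => Xc rho t - Xtildec_diag rho.+1 (s rho.+1) t) &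
         is_bigO (rho.+1%:R^-1)
           (fun t => Th t - Thetamx rho.+1 (- Shat T Xi Xic rho)) /\
         \forall t \near 0^'+,
           (H + t%:C *: T) *m row_mx (Xit t) (Xict t) =
             row_mx (Xit t) (Xict t) *m
               bdiag_mx (lambda%:M + tpow t (rho.+1%:R^-1) *: Th t)
                        (- (lambda%:M + tpow t (rho.+1%:R^-1) *: Th t) ^t*) /\
           (row_mx (Xit t) (Xict t)) ^t* *m Jmx n *m row_mx (Xit t) (Xict t) =
             tpow t (1 - rho.+1%:R^-1) *: Jmx (bdim rho.+1 (s rho.+1))]).

Proof.
(* For [rho.+1 = m] the matrix [Psi T Xi Xic rho.+1] is empty and hence a unit, so both cases of the
   statement are treated alike. *)
have PsiS : ((rho.+1 < m)%N -> Psi T Xi Xic rho.+1 \in unitmx) ->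
    Psi T Xi Xic rho.+1 \in unitmx.
  by case: ltnP => [_ /(_ isT)|mr _] //; apply: unitmx_dim0; apply: udim_out.
split=> [mu muE|Psi_unit].
  exact: (eigen_pairs hpn hH hT hlambda hHPhi hPhiJ hHC1 (PsiS hPsi) hgamma muE).
exact: (pivot_statement hpn hH hT hlambda hHPhi hPhiJ hHC1 hHC2
  (Psi_unit rho) (PsiS hPsi)).
Qed.
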